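(* Let $M$ be a closed, connected, piecewise linear $n$-manifold with a multisection $\{H_i\}$, where $0\le i\le k$ and $n=2k$ or $n=2k+1$. For $0\le j\le k-2$ let $$X_j=\bigcup\,(H_{i_1}\cap H_{i_2}\cap\cdots\cap H_{i_{k-j}}),$$ where the union is over all collections of $k-j$ pairwise distinct handlebodies of the multisection. Then the homomorphisms of homotopy groups induced by the inclusions $X_j\subset M$ satisfy: (1) If $n=2k$, then $\pi_{2j+2}(X_j)\to\pi_{2j+2}(M)$ is onto for $0\le j\le k-2$. Moreover, $\pi_m(X_j)\to\pi_m(M)$ is an isomorphism for $m\le 2j+1$ and $0\le j\le k-2$. (2) If $n=2k+1$, then $\pi_{2j+3}(X_j)\to\pi_{2j+3}(M)$ is onto for $0\le j\le k-2$. Moreover, $\pi_m(X_j)\to\pi_m(M)$ is an isomorphism for $m\le 2j+2$ and $0\le j\le k-2$.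
   Context: All manifolds and maps are piecewise linear (PL). Spine: let $N$ be a compact manifold with non-empty boundary. A subpolyhedron $P$ is a spine of $N$ if $P\subset \mathrm{int}(N)$ and $N$ PL collapses onto $P$. 1-handlebody: an $n$-dimensional 1-handlebody of genus $g$ is a PL $n$-manifold obtained from one $0$-handle (an $n$-ball) by attaching $g$ $1$-handles. Multisection: let $M$ be a closed, connected PL $n$-manifold and write $n=2k$ or $n=2k+1$. A multisection of $M$ is a collection of $k+1$ PL submanifolds $H_i\subset M$, $0\le i\le k$, such that (1) each $H_i$ has a single $0$-handle and a finite number $g_i$ of $1$-handles, and is PL homeomorphic to a standard $n$-dimensional 1-handlebody of genus $g_i$; (2) the $H_i$ have pairwise disjoint interiors and $M=\bigcup_i H_i$; (3) the intersection $H_{i_1}\cap\cdots\cap H_{i_r}$ of any proper (non-empty) subcollection of $r$ distinct handlebodies ($1\le r\le k$) is a compact, connected submanifold with boundary, of dimension $n-r+1$; moreover it has a spine of dimension $r$, except that if $n=2k$ and $r=k$ it has a spine of dimension $r-1$; (4) the intersection $H_0\cap H_1\cap\cdots\cap H_k$ of all handlebodies is a closed, connected submanifold of $M$ of dimension $n-k$ (the central submanifold). *)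

(* Defs.v *)
(* PL topology for compact polyhedra in Euclidean spaces 'rV[R]_N, following
   Rourke and Sanderson, Introduction to Piecewise-Linear Topology. *)
From mathcomp Require Import all_boot all_order all_algebra.
From mathcomp Require Import all_classical all_reals all_analysis.
Import Order.TTheory GRing.Theory Num.Theory.
Import numFieldNormedType.Exports.

Set Implicit Arguments.
Unset Strict Implicit.
Unset Printing Implicit Defensive.

Local Open Scope classical_set_scope.
Local Open Scope ring_scope.

Section PLMultisections.
Variable R : realType.

Definition hull N (s : seq 'rV[R]_N) : set 'rV[R]_N :=
  [set x | exists w : 'I_(size s) -> R,
     [/\ forall i, 0 <= w i, \sum_i w i = 1 & x = \sum_i w i *: s`_i]].

Definition affinely_independent N (s : seq 'rV[R]_N) : Prop :=
  forall w : 'I_(size s) -> R,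
    \sum_i w i = 0 -> \sum_i w i *: s`_i = 0 -> forall i, w i = 0.

(* The simplices of [K] may overlap arbitrarily: [K] need not be a simplicial
   complex.  This changes neither the class of polyhedra, nor that of PL maps,
   nor the dimension. *)
Definition simplicial_cover N (K : seq (seq 'rV[R]_N)) (X : set 'rV[R]_N) :
    Prop :=
  (forall s, s \in K -> affinely_independent s) /\
  X = \bigcup_(s in [set` K]) hull s.

Definition compact_polyhedron N (X : set 'rV[R]_N) : Prop :=
  exists K, simplicial_cover K X.

Definition polyhedron_dim N (X : set 'rV[R]_N) (d : nat) : Prop :=
  exists K, [/\ simplicial_cover K X,
    forall s, s \in K -> (size s <= d.+1)%N &
    exists2 s, s \in K & size s = d.+1].

Definition affine_on N N' (A : set 'rV[R]_N) (f : 'rV[R]_N -> 'rV[R]_N') :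
    Prop :=
  forall x y (t : R), A x -> A y -> 0 <= t <= 1 ->
    f (t *: x + (1 - t) *: y) = t *: f x + (1 - t) *: f y.

(* The values of [f] outside [X] are irrelevant.  Continuity on [X] is
   automatic, an affine map on a simplex being continuous. *)
Definition pl_map N N' (X : set 'rV[R]_N) (Y : set 'rV[R]_N')
    (f : 'rV[R]_N -> 'rV[R]_N') : Prop :=
  set_fun X Y f /\
  exists K, simplicial_cover K X /\ forall s, s \in K -> affine_on (hull s) f.

Definition pl_homeo N N' (X : set 'rV[R]_N) (Y : set 'rV[R]_N')
    (f : 'rV[R]_N -> 'rV[R]_N') : Prop :=
  exists g : 'rV[R]_N' -> 'rV[R]_N,
    [/\ pl_map X Y f, pl_map Y X g, {in X, cancel f g} & {in Y, cancel g f}].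

Definition cube n : set 'rV[R]_n := [set t | forall i, 0 <= t ord0 i <= 1].
Arguments cube : clear implicits.

Definition open_cube n : set 'rV[R]_n := [set t | forall i, 0 < t ord0 i < 1].

Definition cube_boundary n : set 'rV[R]_n := cube n `\` open_cube (n:=n).

Definition pl_ball n N (B : set 'rV[R]_N) : Prop :=
  exists f, pl_homeo B (cube n) f.

Definition pl_chart n N (X : set 'rV[R]_N) (x : 'rV[R]_N)
    (U : set 'rV[R]_N) (f : 'rV[R]_N -> 'rV[R]_n) : Prop :=
  [/\ U x, U `<=` X, within X (nbhs x) U & pl_homeo U (cube n) f].

(* Compact manifold, possibly with boundary. *)
Definition pl_manifold n N (X : set 'rV[R]_N) : Prop :=
  compact_polyhedron X /\
  forall x, X x -> exists U (f : 'rV[R]_N -> 'rV[R]_n), pl_chart X x U f.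

Definition pl_interior n N (X : set 'rV[R]_N) : set 'rV[R]_N :=
  [set x | exists U (f : 'rV[R]_N -> 'rV[R]_n),
     pl_chart X x U f /\ open_cube (f x)].

Definition pl_boundary n N (X : set 'rV[R]_N) : set 'rV[R]_N :=
  X `\` pl_interior n X.

Definition pl_closed_manifold n N (X : set 'rV[R]_N) : Prop :=
  pl_manifold n X /\ pl_boundary n X = set0.

(* [connected] alone holds of the empty set. *)
Definition nonempty_connected N (X : set 'rV[R]_N) : Prop :=
  X !=set0 /\ connected X.

(* [X] is [Y] together with a (d+1)-ball that meets [Y] exactly in a face. *)
Definition elementary_collapse N (X Y : set 'rV[R]_N) : Prop :=
  [/\ compact_polyhedron X, compact_polyhedron Y &
    exists d (B : set 'rV[R]_N) (f : 'rV[R]_N -> 'rV[R]_d.+1),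
      [/\ pl_homeo B (cube d.+1) f, X = Y `|` B &
          B `&` Y = [set x | B x /\ f x ord0 ord0 = 0]]].

Inductive collapses N (X : set 'rV[R]_N) : set 'rV[R]_N -> Prop :=
| collapses_refl : collapses X X
| collapses_step Y Z :
    collapses X Y -> elementary_collapse Y Z -> collapses X Z.

Definition spine n N (X P : set 'rV[R]_N) : Prop :=
  [/\ pl_manifold n X, pl_boundary n X !=set0, compact_polyhedron P,
      P `<=` pl_interior n X & collapses X P].

(* [h] is identified with I^n, the attaching region being the pair of opposite
   faces on which the [i]-th coordinate is 0 or 1. *)
Definition one_handle_attached n N (B h : set 'rV[R]_N) : Prop :=
  exists (i : 'I_n) (f : 'rV[R]_N -> 'rV[R]_n),
    [/\ pl_homeo h (cube n) f,
        h `&` B = [set x | h x /\ (f x ord0 i = 0 \/ f x ord0 i = 1)] &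
        h `&` B `<=` pl_boundary n B].

Definition one_handlebody n g N (X : set 'rV[R]_N) : Prop :=
  pl_manifold n X /\
  exists (B : set 'rV[R]_N) (h : 'I_g -> set 'rV[R]_N),
    [/\ pl_ball n B, forall a, one_handle_attached n B (h a),
        forall a b, a != b -> h a `&` h b = set0 &
        X = B `|` \bigcup_a h a].

Record multisection n k N (M : set 'rV[R]_N) (H : 'I_k.+1 -> set 'rV[R]_N) :
    Prop := Multisection {
  multisection_dim : n = (2 * k)%N \/ n = (2 * k + 1)%N;
  multisection_sub : forall i, H i `<=` M;
  multisection_handlebody : forall i, exists g, one_handlebody n g (H i);
  multisection_disjoint : forall i j, i != j ->
    pl_interior n (H i) `&` pl_interior n (H j) = set0;
  multisection_cover : M = \bigcup_i H i;
  multisection_intersection : forall I : {set 'I_k.+1}, (0 < #|I| <= k)%N ->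
    let HI := \bigcap_(i in [set` I]) H i in
    let d := (n - #|I| + 1)%N in
    [/\ pl_manifold d HI, nonempty_connected HI &
      exists2 P, spine d HI P &
        polyhedron_dim P
          (if (n == 2 * k)%N && (#|I| == k) then #|I| - 1 else #|I|)%N];
  multisection_central :
    pl_closed_manifold (n - k) (\bigcap_i H i) /\
    nonempty_connected (\bigcap_i H i)
}.

Definition intersection_union k N (H : 'I_k.+1 -> set 'rV[R]_N) (r : nat) :
    set 'rV[R]_N :=
  \bigcup_(I in [set I : {set 'I_k.+1} | #|I| = r])
    \bigcap_(i in [set` I]) H i.

Definition spheroid m N (X : set 'rV[R]_N) (x : 'rV[R]_N)
    (f : 'rV[R]_m -> 'rV[R]_N) : Prop :=
  [/\ {within cube m, continuous f}, set_fun (cube m) X f &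
      forall t, cube_boundary t -> f t = x].

Definition homotopic m N (X : set 'rV[R]_N) (x : 'rV[R]_N)
    (f g : 'rV[R]_m -> 'rV[R]_N) : Prop :=
  exists F : R * 'rV[R]_m -> 'rV[R]_N,
    [/\ {within `[0%R, 1%R] `*` cube m, continuous F},
        forall t, cube m t -> F (0, t) = f t /\ F (1, t) = g t &
        forall s, 0 <= s <= 1 -> spheroid X x (fun t => F (s, t))].

Definition homotopy_class m N (X : set 'rV[R]_N) (x : 'rV[R]_N)
    (f : 'rV[R]_m -> 'rV[R]_N) : set ('rV[R]_m -> 'rV[R]_N) :=
  [set g | spheroid X x g /\ homotopic X x f g].

(* pi_m(X, x); for m = 0 the boundary of the cube is empty, and this is the set
   of path components of X. *)
Definition homotopy_group m N (X : set 'rV[R]_N) (x : 'rV[R]_N) :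
    set (set ('rV[R]_m -> 'rV[R]_N)) :=
  [set homotopy_class X x f | f in spheroid (m := m) X x].
Arguments homotopy_group m [N] X x.

Definition set_coord m (i : 'I_m) (c : R) (t : 'rV[R]_m) : 'rV[R]_m :=
  \row_l (if l == i then c else t ord0 l).

Definition concat m N (i : 'I_m) (f g : 'rV[R]_m -> 'rV[R]_N) :
    'rV[R]_m -> 'rV[R]_N :=
  fun t => if t ord0 i <= 2^-1 then f (set_coord i (2 * t ord0 i) t)
           else g (set_coord i (2 * t ord0 i - 1) t).

Definition homotopy_mul m N (i : 'I_m) (X : set 'rV[R]_N) (x : 'rV[R]_N)
    (A B : set ('rV[R]_m -> 'rV[R]_N)) : set ('rV[R]_m -> 'rV[R]_N) :=
  [set h | exists f g,
     [/\ A f, B g & homotopy_class X x (concat i f g) h]].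

(* The map induced by an inclusion of a subspace into M. *)
Definition homotopy_incl m N (M : set 'rV[R]_N) (x : 'rV[R]_N)
    (A : set ('rV[R]_m -> 'rV[R]_N)) : set ('rV[R]_m -> 'rV[R]_N) :=
  [set g | exists2 f, A f & homotopy_class M x f g].

(* Concatenation in any one coordinate gives the group law of pi_m (the same
   one for all coordinates when m >= 2); vacuous for m = 0. *)
Definition homotopy_morphism m N (X M : set 'rV[R]_N) (x : 'rV[R]_N) : Prop :=
  set_fun (homotopy_group m X x) (homotopy_group m M x)
          (homotopy_incl M x) /\
  forall (i : 'I_m) A B,
    homotopy_group m X x A -> homotopy_group m X x B ->
    homotopy_incl M x (homotopy_mul i X x A B) =
    homotopy_mul i M x (homotopy_incl M x A) (homotopy_incl M x B).

Definition homotopy_onto m N (X M : set 'rV[R]_N) : Prop :=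
  forall x, X x -> homotopy_morphism m X M x /\
    set_surj (homotopy_group m X x) (homotopy_group m M x)
             (homotopy_incl M x).

Definition homotopy_iso m N (X M : set 'rV[R]_N) : Prop :=
  forall x, X x -> homotopy_morphism m X M x /\
    set_bij (homotopy_group m X x) (homotopy_group m M x)
            (homotopy_incl M x).

End PLMultisections.

(* Main.v *)
(* Write I for a set of r < k handlebodies and Q for their intersection, a manifold of
   dimension d = n - r + 1 that collapses to a spine P of dimension r.  The union of the
   r-fold intersections is obtained from the union of the (r+1)-fold ones by gluing each Q
   along its boundary, so it suffices to push a map of a cube of dimension
   m <= d - r - 1 = n - 2r into Q to the boundary of Q, keeping the preimage of the boundary
   fixed, and to iterate over r = 1, ..., k - j - 1.

   Regular neighborhood theory is not needed for this.  Attach an exterior open collar to Q.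
   First move the boundary of Q into the collar; then move the map off P by general
   position; then run through the elementary collapses from Q to P backwards: a map that
   avoids Y is moved off X, when X collapses to Y, by flowing in the direction opposite to
   the collapse, cell after cell of a subdivision that is affine in charts.  In the end the
   map avoids Q, and projecting the collar to the boundary gives the required homotopy.

   That the boundary of Q is its intersection with the other handlebodies follows, by
   induction on r, from PL invariance of domain and of dimension. *)
Require Import Defs.
From mathcomp Require Import all_boot all_order all_algebra.
From mathcomp Require Import all_classical all_reals all_analysis.
From mathcomp Require Import ring lra zify.
Import Order.TTheory GRing.Theory Num.Theory.
Import numFieldNormedType.Exports.

Set Implicit Arguments.
Unset Strict Implicit.
Unset Printing Implicit Defensive.

Local Open Scope classical_set_scope.
Local Open Scope ring_scope.


(** * Continuity on subsets *)

Section ContOn.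
Variable R : realType.
Implicit Types U V W : normedModType R.

(** The range of degrees is a dimension count: missing a spine of dimension r in the d-manifold Q
    with an m-cube needs r + m < d, and d = n - r + 1 turns this into 2r + m <= n, which is tightest
    at the last stage r = k - j - 1. Surjectivity in degree m compresses m-cubes; injectivity
    compresses homotopies, which are (m+1)-cubes, and this costs one degree. One obstacle is that
    points already in the boundary of Q must end where they began, although a spine gives no control
    near them. In the collar they are lifted to a positive height, at least eta by compactness; all
    later pushes happen in charts from which the heights from eta on have been removed, so the
    lifted points stand still, and the projection returns them to their places. The other obstacle
    is that the cells of a collapse have any dimension and are bent in the charts of Q. Cutting them
    by finitely many hyperplanes makes each piece affine in one chart, where translations along the
    image of the free direction remove it. Polyhedra and PL maps are therefore handled through signs
    of affine functionals rather than triangulations. *)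

Definition cont_on V W (A : set V) (f : V -> W) : Prop :=
  forall x, A x -> forall e : R, 0 < e ->
  exists2 d : R, 0 < d & forall y, A y -> `|y - x| < d -> `|f y - f x| < e.

Lemma cont_onP V W (A : set V) (f : V -> W) :
  cont_on A f <-> {within A, continuous f}.
Proof.
split=> [cf|/subspace_continuousP cf].
  apply/subspace_continuousP => x Ax; apply/cvgrPdist_lt => e e0.
  have [d d0 h] := cf x Ax e e0.
  rewrite near_withinE; apply/nbhs_ballP; exists d => //= y.
  by rewrite -ball_normE /= distrC => yx Ay; rewrite distrC; apply: h.
move=> x Ax e e0; have /cvgrPdist_lt/(_ e e0) := cf x Ax.
rewrite near_withinE => /nbhs_ballP[d /= d0 h]; exists d => // y Ay yx.
by rewrite distrC; apply: h => //; rewrite -ball_normE /= distrC.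
Qed.

Lemma cont_on_sub V W (A B : set V) (f : V -> W) :
  B `<=` A -> cont_on A f -> cont_on B f.
Proof.
move=> BA cf x Bx e e0; have [d d0 h] := cf x (BA _ Bx) e e0.
by exists d => // y /BA; exact: h.
Qed.

Lemma cont_on_eq V W (A : set V) (f g : V -> W) :
  (forall x, A x -> f x = g x) -> cont_on A f -> cont_on A g.
Proof.
move=> fg cf x Ax e e0; have [d d0 h] := cf x Ax e e0.
by exists d => // y Ay yx; rewrite -!fg//; exact: h.
Qed.

Lemma cont_on_comp U V W (A : set U) (B : set V) (f : U -> V) (g : V -> W) :
  (forall x, A x -> B (f x)) -> cont_on A f -> cont_on B g ->
  cont_on A (fun x => g (f x)).
Proof.
move=> AB cf cg x Ax e e0; have [d d0 h] := cg _ (AB _ Ax) e e0.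
have [d' d'0 h'] := cf x Ax d d0; exists d' => // y Ay yx.
by apply: h; [exact: AB|exact: h'].
Qed.

Lemma cont_on_lip V W (A : set V) (f : V -> W) (L : R) :
  (forall x y, A x -> A y -> `|f x - f y| <= L * `|x - y|) -> cont_on A f.
Proof.
move=> lf x Ax e e0; have L0 : 0 < `|L| + 1 by have := normr_ge0 L; lra.
exists (e / (`|L| + 1)); first by rewrite divr_gt0.
move=> y Ay yx; apply: (le_lt_trans (lf _ _ Ay Ax)).
apply: (@le_lt_trans _ _ ((`|L| + 1) * `|y - x|)).
  by rewrite ler_wpM2r//; have := ler_norm L; lra.
by rewrite mulrC -ltr_pdivlMr.
Qed.

Lemma cont_on_cst V W (A : set V) (c : W) : cont_on A (fun=> c).
Proof. by move=> x Ax e e0; exists 1 => // y _ _; rewrite subrr normr0. Qed.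

Lemma cont_on_id V (A : set V) : cont_on A (fun x => x).
Proof. by move=> x Ax e e0; exists e. Qed.

Lemma cont_on_add V W (A : set V) (f g : V -> W) :
  cont_on A f -> cont_on A g -> cont_on A (fun x => f x + g x).
Proof.
move=> cf cg x Ax e e0.
have e20 : 0 < e / 2 by rewrite divr_gt0.
have [d d0 h] := cf x Ax _ e20; have [d' d'0 h'] := cg x Ax _ e20.
exists (Num.min d d'); first by rewrite lt_min d0.
move=> y Ay; rewrite lt_min => /andP[y1 y2].
rewrite opprD addrACA (le_lt_trans (ler_normD _ _))//.
by have := h y Ay y1; have := h' y Ay y2; lra.
Qed.

Lemma cont_on_opp V W (A : set V) (f : V -> W) :
  cont_on A f -> cont_on A (fun x => - f x).
Proof.
move=> cf x Ax e e0; have [d d0 h] := cf x Ax e e0.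
by exists d => // y Ay yx; rewrite -opprD normrN; exact: h.
Qed.

Lemma cont_on_sub_fun V W (A : set V) (f g : V -> W) :
  cont_on A f -> cont_on A g -> cont_on A (fun x => f x - g x).
Proof. by move=> cf cg; apply: cont_on_add => //; apply: cont_on_opp. Qed.

Lemma cont_on_scale V W (A : set V) (a : V -> R) (f : V -> W) :
  cont_on A (a : V -> R^o) -> cont_on A f -> cont_on A (fun x => a x *: f x).
Proof.
move=> ca cf x Ax e e0.
set M := 1 + `|a x| + `|f x|.
have M0 : 0 < M by rewrite /M; have := normr_ge0 (a x); have := normr_ge0 (f x); lra.
have eM : 0 < Num.min 1 (e / (2 * M)) by rewrite lt_min ltr01 divr_gt0// mulr_gt0.
have [d d0 h] := cf x Ax _ eM; have [d' d'0 h'] := ca x Ax _ eM.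
exists (Num.min d d'); first by rewrite lt_min d0.
move=> y Ay; rewrite lt_min => /andP[y1 y2].
have {h} := h y Ay y1; have {h'} := h' y Ay y2.
rewrite !lt_min => /andP[a1 a2] /andP[f1 f2].
have -> : a y *: f y - a x *: f x = a y *: (f y - f x) + (a y - a x) *: f x.
  by rewrite scalerBr scalerBl addrA subrK.
rewrite (le_lt_trans (ler_normD _ _))// !normrZ.
have ay : `|a y| <= M.
  have -> : a y = a x + (a y - a x) by lra.
  rewrite (le_trans (ler_normD _ _))// /M.
  have : `|a y - a x| < 1 by [].
  by have := normr_ge0 (f x); lra.
have fxM : `|f x| < M by rewrite /M; have := normr_ge0 (a x); lra.
have E : e = M * (e / (2 * M)) + (e / (2 * M)) * M by field; rewrite gt_eqF.
have a2' : `|a y - a x| < e / (2 * M) by [].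
rewrite [ltRHS]E; apply: ler_ltD.
  by rewrite ler_pM// ltW.
have [->|fx0] := eqVneq (`|f x|) 0.
  by rewrite mulr0 mulr_gt0// divr_gt0// mulr_gt0.
by rewrite ltr_pM.
Qed.

Lemma cont_on_pair U V W (A : set U) (f : U -> V) (g : U -> W) :
  cont_on A f -> cont_on A g -> cont_on A (fun x => (f x, g x)).
Proof.
move=> cf cg x Ax e e0.
have [d d0 h] := cf x Ax _ e0; have [d' d'0 h'] := cg x Ax _ e0.
exists (Num.min d d'); first by rewrite lt_min d0.
move=> y Ay; rewrite lt_min => /andP[y1 y2].
by rewrite prod_normE gt_max/= h// h'.
Qed.

Lemma norm_fst U V (x : U * V) : `|x.1| <= `|x|.
Proof. by rewrite prod_normE le_max lexx. Qed.

Lemma norm_snd U V (x : U * V) : `|x.2| <= `|x|.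
Proof. by rewrite prod_normE le_max lexx orbT. Qed.

Lemma cont_on_fst U V (A : set (U * V)) : cont_on A (fun x => x.1).
Proof.
apply: (@cont_on_lip _ _ _ _ 1) => x y _ _; rewrite mul1r.
exact: (norm_fst (x - y)).
Qed.

Lemma cont_on_snd U V (A : set (U * V)) : cont_on A (fun x => x.2).
Proof.
apply: (@cont_on_lip _ _ _ _ 1) => x y _ _; rewrite mul1r.
exact: (norm_snd (x - y)).
Qed.

Lemma cont_on_norm U V (A : set U) (f : U -> V) :
  cont_on A f -> cont_on A (fun x => `|f x| : R^o).
Proof.
move=> cf x Ax e e0; have [d d0 h] := cf x Ax e e0; exists d => // y Ay yx.
exact: (le_lt_trans (ler_dist_dist _ _) (h y Ay yx)).
Qed.

Lemma cont_on_realP U (A : set U) (f : U -> R) :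
  cont_on A (f : U -> R^o) <-> forall x, A x -> forall e : R, 0 < e ->
    exists2 d : R, 0 < d &
      forall y, A y -> `|y - x| < d -> f x - e < f y < f x + e.
Proof.
split=> cf x Ax e e0; have [d d0 h] := cf x Ax e e0; exists d => // y Ay yx.
  have : `|f y - f x : R| < e by exact: h.
  by rewrite ltr_norml => /andP[? ?]; apply/andP; split; lra.
have /andP[? ?] := h y Ay yx; suff : `|f y - f x : R| < e by [].
by rewrite ltr_norml; apply/andP; split; lra.
Qed.

Lemma cont_on_max U (A : set U) (f g : U -> R) :
  cont_on A (f : U -> R^o) -> cont_on A (g : U -> R^o) ->
  cont_on A (fun x => Num.max (f x) (g x) : R^o).
Proof.
move=> /cont_on_realP cf /cont_on_realP cg; apply/cont_on_realP => x Ax e e0.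
have [d d0 h] := cf x Ax _ e0; have [d' d'0 h'] := cg x Ax _ e0.
exists (Num.min d d'); first by rewrite lt_min d0.
move=> y Ay; rewrite lt_min => /andP[y1 y2].
have /andP[? ?] := h y Ay y1; have /andP[? ?] := h' y Ay y2.
by rewrite /Num.max; case: (ltP (f y) (g y)) => ?; case: (ltP (f x) (g x)) => ?;
  apply/andP; split; lra.
Qed.

Lemma cont_on_min U (A : set U) (f g : U -> R) :
  cont_on A (f : U -> R^o) -> cont_on A (g : U -> R^o) ->
  cont_on A (fun x => Num.min (f x) (g x) : R^o).
Proof.
move=> cf cg; apply: (@cont_on_eq _ _ _ (fun x => - Num.max (- f x) (- g x))).
  by move=> x _; rewrite oppr_max !opprK.
by apply: cont_on_opp; apply: cont_on_max; apply: cont_on_opp.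
Qed.

(** Closedness relative to [X]. Only the trace of [A] on [X] matters, so preimages may be taken
    under maps that are meaningful on [X] alone. *)
Definition rclosed V (X A : set V) : Prop :=
  forall x, X x -> ~ A x ->
  exists2 d : R, 0 < d & forall y, X y -> `|y - x| < d -> ~ A y.

Definition ropen V (X A : set V) : Prop :=
  forall x, A x ->
  exists2 d : R, 0 < d & forall y, X y -> `|y - x| < d -> A y.

Lemma rclosedU V (X A B : set V) :
  rclosed X A -> rclosed X B -> rclosed X (A `|` B).
Proof.
move=> cA cB x Xx /not_orP[nA nB].
have [d d0 h] := cA x Xx nA; have [d' d'0 h'] := cB x Xx nB.
exists (Num.min d d'); first by rewrite lt_min d0.
by move=> y Xy; rewrite lt_min => /andP[y1 y2] [|]; [exact: h|exact: h'].
Qed.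

Lemma closed_rclosed V (X A : set V) : closed A -> rclosed X A.
Proof.
move=> cA x Xx nA.
have : (~` A) x by [].
have oA : open (~` A) by rewrite openC.
rewrite -[X in X x]/(~` A) => {}nA.
have /nbhs_ballP[d /= d0 h] := open_nbhs_nbhs (conj oA nA).
exists d => // y Xy yx; apply: (h y).
by rewrite -ball_normE /= distrC.
Qed.

Lemma rclosed_closed V (A : set V) : rclosed setT A -> closed A.
Proof.
move=> rA x clx; apply: contrapT => nA.
have [d d0 h] := rA x I nA.
have /clx[y [Ay yb]] : nbhs x (ball x d) by exact: nbhsx_ballx.
apply: (h y I) => //; move: yb.
by rewrite -ball_normE /= distrC.
Qed.

Lemma rclosed_preimage U V (X : set U) (Y B : set V) (f : U -> V) :
  cont_on X f -> (forall x, X x -> Y (f x)) -> rclosed Y B ->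
  rclosed X (fun x => B (f x)).
Proof.
move=> cf XY cB x Xx nB; have [d d0 h] := cB _ (XY _ Xx) nB.
have [d' d'0 h'] := cf x Xx d d0; exists d' => // y Xy yx.
by apply: h; [exact: XY|exact: h'].
Qed.

Lemma rclosed_ge V (X : set V) (f : V -> R) (c : R) :
  cont_on X (f : V -> R^o) -> rclosed X (fun x => c <= f x).
Proof.
move=> /cont_on_realP cf x Xx /negP; rewrite -ltNge => fc.
have e0 : 0 < c - f x by lra.
have [d d0 h] := cf x Xx _ e0; exists d => // y Xy yx; apply/negP; rewrite -ltNge.
by have /andP[? ?] := h y Xy yx; lra.
Qed.

Lemma rclosed_le V (X : set V) (f : V -> R) (c : R) :
  cont_on X (f : V -> R^o) -> rclosed X (fun x => f x <= c).
Proof.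
move=> /cont_on_realP cf x Xx /negP; rewrite -ltNge => fc.
have e0 : 0 < f x - c by lra.
have [d d0 h] := cf x Xx _ e0; exists d => // y Xy yx; apply/negP; rewrite -ltNge.
by have /andP[? ?] := h y Xy yx; lra.
Qed.

Lemma cont_on_glue V W (X A B : set V) (f : V -> W) :
  (forall x, X x -> A x \/ B x) -> rclosed X A -> rclosed X B ->
  cont_on (X `&` A) f -> cont_on (X `&` B) f -> cont_on X f.
Proof.
move=> XAB cA cB fA fB x Xx e e0.
have [d d0 h] : exists2 d : R, 0 < d &
    forall y, X y -> A y -> `|y - x| < d -> `|f y - f x| < e.
  have [Ax|nA] := pselect (A x).
    by have [d d0 h] := fA x (conj Xx Ax) e e0; exists d => // y Xy Ay; apply: h.
  by have [d d0 h] := cA x Xx nA; exists d => // y Xy Ay /h-/(_ Xy).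
have [d' d'0 h'] : exists2 d : R, 0 < d &
    forall y, X y -> B y -> `|y - x| < d -> `|f y - f x| < e.
  have [Bx|nB] := pselect (B x).
    by have [d' d'0 h'] := fB x (conj Xx Bx) e e0; exists d' => // y Xy By; apply: h'.
  by have [d' d'0 h'] := cB x Xx nB; exists d' => // y Xy By /h'-/(_ Xy).
exists (Num.min d d'); first by rewrite lt_min d0.
move=> y Xy; rewrite lt_min => /andP[y1 y2].
by have [Ay|By] := XAB y Xy; [exact: h|exact: h'].
Qed.

Lemma cont_on_local V W (X : set V) (f : V -> W) :
  (forall x, X x -> exists2 A, cont_on A f &
    A x /\ exists2 r : R, 0 < r & forall y, X y -> `|y - x| < r -> A y) -> cont_on X f.
Proof.
move=> loc x Xx e e0; have [A cA [Ax [r r0 rA]]] := loc x Xx.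
have [d d0 h] := cA x Ax e e0; exists (Num.min d r); first by rewrite lt_min d0.
by move=> y Xy; rewrite lt_min => /andP[y1 y2]; apply: h => //; apply: rA.
Qed.

(** Stands in for finite subcovers. The sets [S] such that [P] holds of [K] minus [S] form a filter,
    by the hereditary and union hypotheses; if [P K] failed it would be proper, and the local
    hypothesis at a cluster point in [K] would contradict clustering. *)
Lemma compact_ind V (K : set V) (P : set V -> Prop) :
  compact K -> P set0 -> (forall A B, B `<=` A -> P A -> P B) ->
  (forall A B, P A -> P B -> P (A `|` B)) ->
  (forall x, K x -> exists2 d : R, 0 < d & P [set y | K y /\ `|y - x| < d]) ->
  P K.
Proof.
move=> cK P0 Psub PU loc; apply: contrapT => nPK.
pose F : set (set V) := [set S | P (K `\` S)].
have FF : ProperFilter F.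
  apply: Build_ProperFilter_ex => [S FS|].
    apply: contrapT => nS; apply: nPK; apply: Psub FS => x Kx; split=> // Sx.
    by apply: nS; exists x.
  split.
  - by rewrite /F/= setDT.
  - move=> A B; rewrite /F/= => FA FB; apply: Psub (PU _ _ FA FB) => x [Kx nAB].
    by have [Ax|nA] := pselect (A x); [right; split=> // Bx; apply: nAB; split|left; split].
  - move=> A B AB; rewrite /F/=; apply: Psub => x [Kx nB]; split=> // Ax.
    by apply: nB; apply: AB.
have FK : F K by rewrite /F/= setDv.
have [x [Kx cl]] := cK F FF FK.
have [d d0 Pd] := loc x Kx.
have Fd : F (~` [set y | K y /\ `|y - x| < d]).
  by apply: Psub Pd => y [Ky /contrapT].
have [y [[ny Ky] /= yb]] := cl _ _ (filterI Fd FK) (nbhsx_ballx x _ d0).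
by apply: ny; rewrite -ball_normE /= distrC in yb.
Qed.

End ContOn.

(** * Compactness and distances *)

Section Compactness.
Variable R : realType.
Implicit Types U V W : normedModType R.

Lemma compact_image V W (K : set V) (f : V -> W) :
  cont_on K f -> compact K -> compact [set f x | x in K].
Proof. by move=> /cont_onP; exact: continuous_compact. Qed.

Lemma compact_rclosed V (K A : set V) :
  compact K -> rclosed K A -> compact (K `&` A).
Proof.
move=> cK cA; have clK : closed K by apply: compact_closed.
apply: (@subclosed_compact _ _ K) => //.
apply: rclosed_closed => x _ nKA.
have [Kx|nK] := pselect (K x).
  have nA : ~ A x by move=> Ax; apply: nKA.
  have [d d0 h] := cA x Kx nA; exists d => // y _ yx [Ky Ay].
  exact: (h y Ky yx Ay).
have [d d0 h] := @closed_rclosed _ _ setT K clK x I nK.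
by exists d => // y _ yx [Ky _]; exact: (h y I yx Ky).
Qed.

Lemma compact_is_rclosed V (X K : set V) : compact K -> rclosed X K.
Proof. by move=> cK; apply: closed_rclosed; apply: compact_closed. Qed.

Lemma compact_unif_cont V W (K : set V) (f : V -> W) :
  compact K -> cont_on K f -> forall e : R, 0 < e ->
  exists2 d : R, 0 < d &
    forall x y, K x -> K y -> `|y - x| < d -> `|f y - f x| < e.
Proof.
move=> cK cf e e0.
pose P (A : set V) := exists2 d : R, 0 < d &
    forall x y, A x -> K y -> `|y - x| < d -> `|f y - f x| < e.
suff [d d0 h] : P K by exists d => // x y Kx; exact: h.
apply: (compact_ind cK).
- by exists 1.
- by move=> A B BA [d d0 h]; exists d => // x y /BA; exact: h.
- move=> A B [d d0 h] [d' d'0 h']; exists (Num.min d d'); first by rewrite lt_min d0.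
  by move=> x y [Ax|Bx] Ky; rewrite lt_min => /andP[y1 y2]; [exact: h|exact: h'].
- move=> x Kx; have e2 : 0 < e / 2 by rewrite divr_gt0.
  have [d d0 h] := cf x Kx _ e2.
  have d2 : 0 < d / 2 by rewrite divr_gt0.
  exists (d / 2) => //; exists (d / 2) => // z y [Kz zx] Ky yz.
  have yx : `|y - x| < d.
    have -> : y - x = (y - z) + (z - x) by rewrite addrA subrK.
    by rewrite (le_lt_trans (ler_normD _ _))//; lra.
  have zx' : `|z - x| < d by lra.
  have -> : f y - f z = (f y - f x) - (f z - f x) by rewrite opprB addrA subrK.
  rewrite (le_lt_trans (ler_normB _ _))//.
  by have := h y Ky yx; have := h z Kz zx'; lra.
Qed.

Lemma compact_cont_bounded V W (K : set V) (f : V -> W) :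
  compact K -> cont_on K f -> exists2 B : R, 0 < B & forall x, K x -> `|f x| <= B.
Proof.
move=> cK cf.
pose P (A : set V) := exists2 B : R, 0 < B & forall x, A x -> `|f x| <= B.
apply: (compact_ind (P := P) cK).
- by exists 1.
- by move=> A B BA [d d0 h]; exists d => // x /BA; exact: h.
- move=> A B [d d0 h] [d' d'0 h']; exists (Num.max d d'); first by rewrite lt_max d0.
  by move=> x [Ax|Bx]; rewrite le_max; [rewrite h|rewrite h' ?orbT].
- move=> x Kx; have [d d0 h] := cf x Kx 1 ltr01.
  exists d => //; exists (1 + `|f x|) => [|y [Ky yx]].
    by have := normr_ge0 (f x); lra.
  have -> : f y = (f y - f x) + f x by rewrite subrK.
  by rewrite (le_trans (ler_normD _ _))//; have := h y Ky yx; lra.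
Qed.

(** The uniform margin of [K] in [G], from which the radii of later pushes are taken. *)
Lemma compact_ropen_gap V (W G K : set V) :
  compact K -> K `<=` G -> ropen W G ->
  exists2 d : R, 0 < d & forall x y, K x -> W y -> `|y - x| < d -> G y.
Proof.
move=> cK KG oG.
pose P (A : set V) := exists2 d : R, 0 < d &
  forall x y, A x -> W y -> `|y - x| < d -> G y.
apply: (compact_ind (P := P) cK).
- by exists 1.
- by move=> A B BA [d d0 h]; exists d => // x y /BA; exact: h.
- move=> A B [d d0 h] [d' d'0 h']; exists (Num.min d d'); first by rewrite lt_min d0.
  by move=> x y [Ax|Bx] Wy; rewrite lt_min => /andP[y1 y2]; [exact: h y1|exact: h' y2].
- move=> x Kx; have [d d0 h] := oG x (KG _ Kx).
  have d2 : 0 < d / 2 by rewrite divr_gt0.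
  exists (d / 2) => //; exists (d / 2) => // z y [Kz zx] Wy yz.
  apply: h => //.
  have -> : y - x = (y - z) + (z - x) by rewrite addrA subrK.
  by rewrite (le_lt_trans (ler_normD _ _))//; lra.
Qed.

Lemma compact_pos_min V (K : set V) (f : V -> R) :
  compact K -> cont_on K (f : V -> R^o) -> (forall x, K x -> 0 < f x) ->
  exists2 d : R, 0 < d & forall x, K x -> d <= f x.
Proof.
move=> cK /cont_on_realP cf f0.
pose P (A : set V) := exists2 d : R, 0 < d & forall x, A x -> d <= f x.
apply: (compact_ind (P := P) cK).
- by exists 1.
- by move=> A B BA [d d0 h]; exists d => // x /BA; exact: h.
- move=> A B [d d0 h] [d' d'0 h']; exists (Num.min d d'); first by rewrite lt_min d0.
  by move=> x [Ax|Bx]; rewrite ge_min; [rewrite h|rewrite h' ?orbT].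
- move=> x Kx; have e0 : 0 < f x / 2 by rewrite divr_gt0// f0.
  have [d d0 h] := cf x Kx _ e0; exists d => //; exists (f x / 2) => // y [Ky yx].
  by have /andP[? ?] := h y Ky yx; lra.
Qed.

Lemma norm_rVP n (x : 'rV[R]_n) (e : R) :
  0 <= e -> (`|x| <= e <-> forall i, `|x ord0 i| <= e).
Proof.
move=> e0; rewrite [`|x|]mx_normrE; split=> [/bigmax_leP[_ h] i|h].
  exact: (h (ord0, i)).
by apply/bigmax_leP; split=> // -[i j] _ /=; rewrite (ord1 i).
Qed.

Lemma norm_rV_coord n (x : 'rV[R]_n) i : `|x ord0 i| <= `|x|.
Proof. by have /norm_rVP := lexx `|x|; apply. Qed.

Lemma norm_rV_lt n (x : 'rV[R]_n) (e : R) :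
  0 < e -> (`|x| < e <-> forall i, `|x ord0 i| < e).
Proof.
move=> e0; rewrite [`|x|]mx_normrE; split=> [/bigmax_ltP[_ h] i|h].
  exact: (h (ord0, i)).
by apply/bigmax_ltP; split=> // -[i j] _ /=; rewrite (ord1 i).
Qed.

Lemma cont_on_coord n V (A : set V) (f : V -> 'rV[R]_n) i :
  cont_on A f -> cont_on A (fun x => f x ord0 i : R^o).
Proof.
move=> cf x Ax e e0; have [d d0 h] := cf x Ax e e0; exists d => // y Ay yx.
have := norm_rV_coord (f y - f x) i; rewrite !mxE => h1.
exact: (le_lt_trans h1 (h y Ay yx)).
Qed.

Lemma fin_min_pos (I : finType) (P : I -> R -> Prop) :
  (forall i, exists2 d : R, 0 < d & P i d) ->
  (forall i d d', 0 < d' -> d' <= d -> P i d -> P i d') ->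
  exists2 d : R, 0 < d & forall i, P i d.
Proof.
move=> ex mono; have [|d hd] := @choice _ _ (fun i d => 0 < d /\ P i d).
  by move=> i; have [d] := ex i; exists d.
exists (\big[Num.min/1]_i d i).
  by apply/bigmin_gtP; split=> // i _; exact: (hd i).1.
move=> i; apply: (mono i (d i)); last exact: (hd i).2.
  by apply/bigmin_gtP; split=> // j _; exact: (hd j).1.
exact: bigmin_le_cond.
Qed.

Lemma cont_on_rV n V (A : set V) (f : V -> 'rV[R]_n) :
  (forall i, cont_on A (fun x => f x ord0 i : R^o)) -> cont_on A f.
Proof.
move=> cf x Ax e e0.
have [d d0 h] : exists2 d : R, 0 < d & forall i, forall y, A y -> `|y - x| < d ->
    `|(f y ord0 i : R) - f x ord0 i| < e.
  apply: (@fin_min_pos _ (fun i d => forall y, A y -> `|y - x| < d ->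
    `|(f y ord0 i : R) - f x ord0 i| < e)).
    by move=> i; have [d d0 h] := cf i x Ax e e0; exists d.
  by move=> i d d' d'0 d'd h y Ay yx; apply: h => //; apply: lt_le_trans d'd.
exists d => // y Ay yx; apply/norm_rV_lt => // i; rewrite !mxE.
exact: h.
Qed.

(** Meaningful for nonempty [K] only. *)
Definition dist V (K : set V) (x : V) : R := inf [set `|x - k| | k in K].

Lemma dist_has_inf V (K : set V) (x : V) :
  K !=set0 -> has_inf [set `|x - k| | k in K].
Proof.
move=> [k Kk]; split; first by exists `|x - k|, k.
by exists 0 => _ [k' _ <-].
Qed.

Lemma dist_le V (K : set V) (x k : V) : K k -> dist K x <= `|x - k|.
Proof.
move=> Kk; apply: ge_inf; last by exists k.
by exists 0 => _ [k' _ <-].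
Qed.

Lemma dist_ge0 V (K : set V) (x : V) : K !=set0 -> 0 <= dist K x.
Proof.
move=> [k Kk]; apply: lb_le_inf; first by exists `|x - k|, k.
by move=> _ [k' _ <-].
Qed.

Lemma dist_lt V (K : set V) (x : V) (e : R) :
  K !=set0 -> dist K x < e -> exists2 k, K k & `|x - k| < e.
Proof.
move=> K0 xe; have e0 : 0 < e - dist K x by lra.
have [_ [k Kk <-]] := inf_adherent e0 (dist_has_inf x K0).
by rewrite -/(dist K x) => h; exists k => //; lra.
Qed.

Lemma dist_lip V (K : set V) (x y : V) :
  K !=set0 -> `|dist K x - dist K y| <= `|x - y|.
Proof.
move=> K0.
have key a b : dist K a <= dist K b + `|a - b|.
  apply/ler_addgt0Pr => e e0.
  have [k Kk bk] : exists2 k, K k & `|b - k| < dist K b + e.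
    by apply: dist_lt => //; lra.
  rewrite (le_trans (dist_le _ Kk))//.
  have -> : a - k = (a - b) + (b - k) by rewrite addrA subrK.
  by rewrite (le_trans (ler_normD _ _))//; lra.
rewrite ler_norml; have := key x y; have := key y x; rewrite (distrC y x).
by move=> ? ?; apply/andP; split; lra.
Qed.

Lemma dist0 V (K : set V) (x : V) : K x -> dist K x = 0.
Proof.
move=> Kx; apply/eqP; rewrite eq_le dist_ge0; last by exists x.
by rewrite andbT; have := dist_le x Kx; rewrite subrr normr0.
Qed.

End Compactness.

(** * Homotopies and charts *)

Section Homotopies.
Variable R : realType.
Implicit Types U V W : normedModType R.

(** [Inv] constrains the track of each point; it expresses at once that a homotopy stays in a set
    and that it is stationary on a part of [D]. *)
Definition homot U V (D : set U) (Inv : U -> V -> Prop) (f g : U -> V) : Prop :=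
  exists F : R * U -> V,
    [/\ cont_on [set p : R * U | 0 <= p.1 <= 1 /\ D p.2] F,
        forall x, D x -> F (0, x) = f x,
        forall x, D x -> F (1, x) = g x &
        forall t x, 0 <= t <= 1 -> D x -> Inv x (F (t, x))].

Lemma homot_refl U V (D : set U) (Inv : U -> V -> Prop) f :
  cont_on D f -> (forall x, D x -> Inv x (f x)) -> homot D Inv f f.
Proof.
move=> cf If; exists (fun p => f p.2); split=> // [|t x _ Dx]; last exact: If.
apply: (@cont_on_comp _ _ _ _ _ D) => [p []//||//].
exact: cont_on_snd.
Qed.

Lemma homot_weak U V (D : set U) (Inv Inv' : U -> V -> Prop) f g :
  (forall x v, D x -> Inv x v -> Inv' x v) -> homot D Inv f g -> homot D Inv' f g.
Proof.
move=> II [F [cF F0 F1 IF]]; exists F; split=> // t x t01 Dx.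
by apply: II => //; exact: IF.
Qed.

Lemma homot_end U V (D : set U) (Inv : U -> V -> Prop) f g :
  homot D Inv f g -> forall x, D x -> Inv x (g x).
Proof.
move=> [F [_ _ F1 IF]] x Dx; rewrite -F1//; apply: IF => //.
by rewrite ler01 lexx.
Qed.

Lemma homot_cont U V (D : set U) (Inv : U -> V -> Prop) f g :
  homot D Inv f g -> cont_on D g.
Proof.
move=> [F [cF _ F1 _]]; apply: (cont_on_eq F1).
have cp : cont_on D (fun x => (1, x) : R * U).
  by apply: cont_on_pair; [exact: cont_on_cst|exact: cont_on_id].
apply: (cont_on_comp _ cp cF).
by move=> x Dx /=; rewrite ler01 lexx.
Qed.

Lemma homot_trans U V (D : set U) (Inv : U -> V -> Prop) f g h :
  homot D Inv f g -> homot D Inv g h -> homot D Inv f h.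
Proof.
move=> [F [cF F0 F1 IF]] [G [cG G0 G1 IG]].
exists (fun p => if p.1 <= 2^-1 then F (2 * p.1, p.2) else G (2 * p.1 - 1, p.2)).
have cfst (A : set (R * U)) : cont_on A (fun p => p.1 : R^o) by exact: cont_on_fst.
split=> /=.
- have := @cont_on_glue _ _ _ [set p : R * U | 0 <= p.1 <= 1 /\ D p.2]
    [set p : R * U | p.1 <= 2^-1] [set p : R * U | 2^-1 <= p.1]
    (fun p => if p.1 <= 2^-1 then F (2 * p.1, p.2) else G (2 * p.1 - 1, p.2)).
  apply.
  + by move=> p _ /=; case: (lerP p.1 2^-1) => [|/ltW]; [left|right].
  + by apply: (@rclosed_le _ _ _ (fun p => p.1)).
  + by apply: (@rclosed_ge _ _ _ (fun p => p.1)).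
  + apply: (@cont_on_eq _ _ _ _ (fun p : R * U => F (2 * p.1, p.2))).
      by move=> p [_ /= ->].
    apply: (cont_on_comp _ _ cF).
      by move=> p [[/andP[? ?] ?] /= ?]; split => //=; apply/andP; split; lra.
    apply: cont_on_pair; last exact: cont_on_snd.
    by apply: (cont_on_scale (a := fun=> 2)); [exact: cont_on_cst|exact: cfst].
  + apply: (@cont_on_eq _ _ _ _ (fun p : R * U => G (2 * p.1 - 1, p.2))).
      move=> p [[_ Dp] /= hp]; case: ifP => // hp'.
      have -> : p.1 = 2^-1 by apply/eqP; rewrite eq_le hp' hp.
      by rewrite divff// subrr G0// F1.
    apply: (cont_on_comp _ _ cG).
      by move=> p [[/andP[? ?] ?] /= ?]; split => //=; apply/andP; split; lra.
    apply: cont_on_pair; last exact: cont_on_snd.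
    apply: (@cont_on_add _ _ R^o); last exact: cont_on_cst.
    by apply: (cont_on_scale (a := fun=> 2)); [exact: cont_on_cst|exact: cfst].
- by move=> x Dx; rewrite ifT ?mulr0 ?F0// invr_ge0.
- move=> x Dx; rewrite ifF; last by apply/negbTE; rewrite -ltNge invf_lt1// ltr1n.
  by rewrite mulr1 (_ : 2 - 1 = 1) ?G1//; lra.
- move=> t x /andP[t0 t1] Dx; case: ifP => ht.
    by apply: IF => //; apply/andP; split; lra.
  move/negbT: ht; rewrite -ltNge => ht.
  by apply: IG => //; apply/andP; split; lra.
Qed.

Lemma homot_post U V V' (D : set U) (Inv : U -> V -> Prop) (Inv' : U -> V' -> Prop)
    f g (h : V -> V') (B : set V) :
  cont_on B h -> (forall x v, D x -> Inv x v -> B v) ->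
  (forall x v, D x -> Inv x v -> Inv' x (h v)) ->
  homot D Inv f g -> homot D Inv' (fun x => h (f x)) (fun x => h (g x)).
Proof.
move=> ch IB II [F [cF F0 F1 IF]]; exists (fun p => h (F p)); split.
- apply: (cont_on_comp _ cF ch) => -[t x] [/= t01 Dx].
  by apply: (IB x) => //; exact: IF.
- by move=> x Dx; rewrite F0.
- by move=> x Dx; rewrite F1.
- by move=> t x t01 Dx; apply: II => //; exact: IF.
Qed.

(** The homeomorphism is only topological here. [G] is open in the whole space, so small pushes in
    every direction are possible; [W] will be a manifold with its collar attached. *)
Record chart V d (W O : set V) (G : set 'rV[R]_d) (kap : V -> 'rV[R]_d)
    (lam : 'rV[R]_d -> V) : Prop := Chart {
  chart_sub : O `<=` W;
  chart_open : ropen W O;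
  chart_im_open : ropen setT G;
  chart_im : forall p, O p -> G (kap p);
  chart_inv : forall z, G z -> O (lam z);
  chartK : forall p, O p -> lam (kap p) = p;
  chart_invK : forall z, G z -> kap (lam z) = z;
  chart_cont : cont_on O kap;
  chart_inv_cont : cont_on G lam
}.

(** Cutting a closed set out of a chart guarantees that a push in the chart never enters that set.
    It is used for what was cleared before and for the high part of the collar. *)
Lemma chart_restrict V d (W O B : set V) G (kap : V -> 'rV[R]_d) lam :
  chart W O G kap lam -> rclosed W B ->
  chart W (O `&` ~` B) (G `&` [set z | ~ B (lam z)]) kap lam.
Proof.
move=> [OW rO rG kG lO lk kl ck cl] cB; split.
- by move=> p [/OW].
- move=> p [Op nB]; have [d1 d10 h] := rO p Op.
  have [d2 d20 h'] := cB p (OW _ Op) nB.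
  exists (Num.min d1 d2); first by rewrite lt_min d10.
  by move=> y Wy; rewrite lt_min => /andP[y1 y2]; split; [exact: h|exact: h'].
- move=> z [Gz nB]; have [d1 d10 h] := rG z Gz.
  have [d2 d20 h'] := cB _ (OW _ (lO _ Gz)) nB.
  have [d3 d30 h''] := cl z Gz _ d20.
  exists (Num.min d1 d3); first by rewrite lt_min d10.
  move=> y _; rewrite lt_min => /andP[y1 y2]; have Gy := h y I y1.
  split=> //; apply: h'; first by apply: OW; exact: lO.
  exact: h''.
- by move=> p [Op nB]; split; [exact: kG|rewrite /= lk].
- by move=> z [Gz nB]; split; [exact: lO|].
- by move=> p [Op _]; exact: lk.
- by move=> z [Gz _]; exact: kl.
- by apply: cont_on_sub ck => p [].
- by apply: cont_on_sub cl => p [].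
Qed.

(** The track of [f x] under a push supported in [O]: frozen when it starts outside [O], confined to
    [O] otherwise. *)
Definition push_inv U V (W O : set V) (f : U -> V) (x : U) (v : V) : Prop :=
  [/\ W v, ~ O (f x) -> v = f x & O (f x) -> O v].

(** Straight-line push in the chart. Continuity at a point whose image is outside [O] holds because
    nothing moves off the image of [S] under [lam], which is compact and therefore closed. *)
Lemma chart_push U V d (D : set U) (W O : set V) G (kap : V -> 'rV[R]_d) lam
    (S : set 'rV[R]_d) (f : U -> V) (Dl : U -> 'rV[R]_d) :
  chart W O G kap lam -> compact S -> S `<=` G ->
  cont_on D f -> (forall x, D x -> W (f x)) ->
  cont_on (D `&` (fun x => O (f x))) Dl ->
  (forall x, D x -> O (f x) -> Dl x <> 0 -> S (kap (f x))) ->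
  (forall x, D x -> O (f x) -> forall c, 0 <= c <= 1 -> G (kap (f x) + c *: Dl x)) ->
  exists g, [/\ homot D (fun x v => push_inv W O f x v /\
        (O (f x) -> exists2 c, 0 <= c <= 1 & kap v = kap (f x) + c *: Dl x)) f g,
     forall x, D x -> O (f x) -> O (g x) /\ kap (g x) = kap (f x) + Dl x &
     forall x, D x -> ~ O (f x) -> g x = f x].
Proof.
move=> ch cS SG cf Wf cD DS DG.
pose F (p : R * U) := if `[< O (f p.2) >] then lam (kap (f p.2) + p.1 *: Dl p.2)
                      else f p.2.
have FO t x : O (f x) -> F (t, x) = lam (kap (f x) + t *: Dl x).
  by move=> Of; rewrite /F/=; case: asboolP.
have FnO t x : ~ O (f x) -> F (t, x) = f x by rewrite /F/=; case: asboolP.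
exists (fun x => F (1, x)); split; last 2 first.
- move=> x Dx Of; rewrite FO// scale1r.
  have Gx : G (kap (f x) + Dl x) by rewrite -(scale1r (Dl x)); apply: DG; rewrite ?ler01 ?lexx.
  by split; [exact: (chart_inv ch)|exact: (chart_invK ch)].
- by move=> x Dx nO; rewrite FnO.
exists F; split=> //; last first.
- move=> t x t01 Dx; have [Of|nO] := pselect (O (f x)).
    rewrite FO//; have Gx := DG x Dx Of t t01; have Ol := chart_inv ch Gx.
    split; first by split=> //; exact: (chart_sub ch).
    by move=> _; exists t => //; exact: (chart_invK ch).
  by rewrite FnO//; split=> //; split=> //; exact: Wf.
- move=> x Dx; have [Of|nO] := pselect (O (f x)); last by rewrite FnO.
  by rewrite FO// scale0r addr0 (chartK ch).
have csnd (A : set (R * U)) : cont_on A snd by exact: cont_on_snd.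
have cfs : cont_on [set p : R * U | 0 <= p.1 <= 1 /\ D p.2] (fun p => f p.2).
  by apply: (@cont_on_comp _ _ _ _ _ D snd f) => // p [].
apply: cont_on_local => -[t x] [/= t01 Dx].
have [Of|nO] := pselect (O (f x)).
  pose A := [set p : R * U | [/\ 0 <= p.1 <= 1, D p.2 & O (f p.2)]].
  have cfA : cont_on A (fun p => f p.2) by apply: cont_on_sub cfs => p [].
  exists A.
    apply: (@cont_on_eq _ _ _ _ (fun p : R * U => lam (kap (f p.2) + p.1 *: Dl p.2))).
      by move=> [s y] [/= _ _ Oy]; rewrite FO.
    apply: (cont_on_comp (B := G)) (chart_inv_cont ch).
      by move=> [s y] [/= s01 Dy Oy]; exact: DG.
    apply: cont_on_add.
      by apply: (cont_on_comp (B := O)) cfA (chart_cont ch) => p [].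
    apply: cont_on_scale; first exact: cont_on_fst.
    by apply: (cont_on_comp (B := D `&` (fun x => O (f x)))) (csnd A) cD => p [].
  split=> //.
  have [r r0 hr] := chart_open ch Of.
  have [d0 d00 h] := cf x Dx r r0.
  exists d0 => // -[s y] [/= s01 Dy] yx; split=> //=.
  apply: hr; first exact: Wf.
  by apply: h => //; apply: le_lt_trans yx; exact: (norm_snd ((s, y) - (t, x))).
pose L := [set lam z | z in S].
have cL : compact L.
  by apply: compact_image cS; apply: cont_on_sub (chart_inv_cont ch).
pose A := [set p : R * U | [/\ 0 <= p.1 <= 1, D p.2 & ~ L (f p.2)]].
exists A.
  apply: (@cont_on_eq _ _ _ _ (fun p : R * U => f p.2)).
    move=> [s y] [/= _ Dy nL]; have [Oy|nOy] := pselect (O (f y)); last by rewrite FnO.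
    rewrite FO//; have [->|/eqP D0] := eqVneq (Dl y) 0.
      by rewrite scaler0 addr0 (chartK ch).
    exfalso; apply: nL; exists (kap (f y)); first exact: DS.
    exact: (chartK ch).
  by apply: cont_on_sub cfs => p [].
have nLx : ~ L (f x).
  by move=> [z Sz zx]; apply: nO; rewrite -zx; apply: (chart_inv ch); exact: SG.
split=> //.
have [r r0 hr] := compact_is_rclosed cL (Wf x Dx) nLx.
have [d0 d00 h] := cf x Dx r r0.
exists d0 => // -[s y] [/= s01 Dy] yx; split=> //=.
apply: hr; first exact: Wf.
by apply: h => //; apply: le_lt_trans yx; exact: (norm_snd ((s, y) - (t, x))).
Qed.

(** A cut-off of slope [1 / dl] around [K]. Since [dl] is half of the margin of [K] in [G], a point
    of the support may still be moved by less than [dl] inside [G]. *)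
Lemma lip_bump d (K G : set 'rV[R]_d) :
  compact K -> K !=set0 -> K `<=` G -> ropen setT G ->
  exists (dl : R) (phi : 'rV[R]_d -> R) (S : set 'rV[R]_d),
    [/\ [/\ 0 < dl, compact S & S `<=` G],
        forall z, 0 <= phi z <= 1,
        forall x y, `|phi x - phi y| <= dl^-1 * `|x - y|,
        forall z, K z -> phi z = 1 &
        forall z, phi z <> 0 -> S z /\ forall z', `|z' - z| < dl -> G z'].
Proof.
move=> cK K0 KG oG; have [e e0 he] := compact_ropen_gap cK KG oG.
pose dl := e / 2; have dl0 : 0 < dl by rewrite divr_gt0.
have dle : dl + dl = e by rewrite /dl; lra.
pose S := [set z | dist K z <= dl].
have near z : dist K z < e -> exists2 k, K k & `|z - k| < e by exact: dist_lt.
exists dl, (fun z => Num.max 0 (1 - dist K z / dl)), S; split.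
- split=> //; last first.
    move=> z Sz; have [|k Kk zk] := near z; first by rewrite /S/= in Sz; lra.
    exact: he zk.
  have [B B0 hB] := compact_cont_bounded cK (@cont_on_id _ _ K).
  apply: bounded_closed_compact.
    exists (B + e); split; first exact: num_real.
    move=> r rB z Sz; have [|k Kk zk] := near z; first by rewrite /S/= in Sz; lra.
    rewrite /= -[z](subrK k).
    by rewrite (le_trans (ler_normD _ _))//; have := hB k Kk; lra.
  apply: rclosed_closed; apply: rclosed_le.
  apply: (@cont_on_lip _ _ _ _ _ 1) => x y _ _; rewrite mul1r.
  exact: dist_lip.
- move=> z; rewrite le_max lexx /= ge_max ler01 /=.
  by have := dist_ge0 z K0 => ?; rewrite gerBl divr_ge0// ltW.
- move=> x y.
  have h : `|(1 - dist K x / dl) - (1 - dist K y / dl)| <= dl^-1 * `|x - y|.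
    have -> : 1 - dist K x / dl - (1 - dist K y / dl) = dl^-1 * (dist K y - dist K x).
      by ring.
    rewrite normrM (gtr0_norm (x:=dl^-1)) ?invr_gt0//.
    by rewrite ler_wpM2l ?invr_ge0 ?(ltW dl0)// distrC dist_lip.
  apply: le_trans h; set a := 1 - _; set b := 1 - _.
  have h1 := ler_norm (a - b); have h2 := ler_norm (b - a); rewrite distrC in h2.
  by rewrite ler_norml; case: (leP 0 a) => ?; case: (leP 0 b) => ?; apply/andP; split;
    have := normr_ge0 (a - b); lra.
- by move=> z Kz; rewrite (dist0 Kz) mul0r subr0; apply/max_idPr.
- move=> z; case: leP => // h /eqP h0.
  have {}h : dist K z < dl.
    have : 0 < 1 - dist K z / dl by rewrite lt_neqAle eq_sym h0 h.
    by rewrite subr_gt0 ltr_pdivrMr// mul1r.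
  split; first exact: ltW.
  move=> z' z'z; have [k Kk zk] := dist_lt K0 h.
  apply: (he k) => //.
  have -> : z' - k = (z' - z) + (z - k) by rewrite addrA subrK.
  by rewrite (le_lt_trans (ler_normD _ _))//; lra.
Qed.

End Homotopies.

(** * Moving maps off a cell *)

Section ClearCollapse.
Variable R : realType.
Implicit Types U V W : normedModType R.

Lemma push_inv_trans U V (D : set U) (W O : set V) f g h :
  homot D (push_inv W O f) f g -> homot D (push_inv W O g) g h ->
  homot D (push_inv W O f) f h.
Proof.
move=> fg gh; apply: (homot_trans fg (homot_weak _ gh)) => x v Dx [Wv nO Oo].
have [Wg nOg Og] := homot_end fg Dx.
split=> // [nOf|/Og]; last exact: Oo.
by rewrite nO ?nOg.
Qed.

(** The bump function [phi] is Lipschitz, so the push [z |-> z + (e * phi z) *: w] is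
    increasing on the lines parallel to [w] and fixes the complement of [G]: nothing
    enters [A]. *)
Lemma clear_step U V d (D : set U) (W O : set V) G (kap : V -> 'rV[R]_d) lam
    (A K : set 'rV[R]_d) (w : 'rV[R]_d) :
  chart W O G kap lam -> A `<=` G -> w != 0 ->
  (forall a s, A a -> 0 < s ->
     A (a - s *: w) \/ exists2 s', 0 < s' <= s & ~ G (a - s' *: w)) ->
  compact K -> K !=set0 -> K `<=` A ->
  exists2 e : R, 0 < e & forall f : U -> V,
    cont_on D f -> (forall x, D x -> W (f x)) ->
    (forall x, D x -> O (f x) -> A (kap (f x)) -> K (kap (f x))) ->
    exists g, homot D (push_inv W O f) f g /\
      forall x, D x -> O (g x) -> A (kap (g x)) ->
        [/\ O (f x), K (kap (f x)) & kap (g x) = kap (f x) + e *: w].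
Proof.
move=> ch AG w0 C2 cK K0 KA.
have KG : K `<=` G by move=> z /KA/AG.
have [dl [phi [S [[dl0 cS SG] phi01 lphi phi1 phiS]]]] :=
  lip_bump cK K0 KG (chart_im_open ch).
have nw0 : 0 < `|w| by rewrite normr_gt0.
(* The largest displacement is then [dl / 2]: it stays below the margin [dl], and the displacement
   varies with Lipschitz constant 1/2, less than 1. *)
pose e := dl / (2 * `|w|); have e0 : 0 < e by rewrite divr_gt0// mulr_gt0.
have ew : e * `|w| = dl / 2.
  by rewrite /e invfM mulrA -mulrA mulVf ?mulr1 ?gt_eqF.
exists e => // f cf Wf AK.
pose Dl x := (e * phi (kap (f x))) *: w.
have cphi (B : set 'rV[R]_d) : cont_on B (phi : _ -> R^o).
  by apply: (@cont_on_lip _ _ _ _ _ dl^-1) => x y _ _; exact: lphi.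
have cDl : cont_on (D `&` (fun x => O (f x))) Dl.
  apply: (cont_on_scale (a := fun x => e * phi (kap (f x)))); last exact: cont_on_cst.
  apply: (cont_on_scale (W := R^o) (a := fun=> e)); first exact: cont_on_cst.
  apply: (cont_on_comp (B := setT)) (cphi _) => //.
  apply: (cont_on_comp (B := O)) (chart_cont ch); first by move=> x [].
  by apply: cont_on_sub cf => x [].
have [||g [hg gO gnO]] := chart_push ch cS SG cf Wf cDl.
- move=> x Dx Ox Dl0; apply: (phiS _ _).1 => phi0; apply: Dl0.
  by rewrite /Dl phi0 mulr0 scale0r.
- move=> x Dx Ox c /andP[c0 c1].
  have [phi0|/eqP phi0] := eqVneq (phi (kap (f x))) 0.
    by rewrite /Dl phi0 mulr0 scale0r scaler0 addr0; exact: (chart_im ch).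
  apply: (phiS _ phi0).2; rewrite addrAC subrr add0r /Dl scalerA normrZ.
  have /andP[p0 p1] := phi01 (kap (f x)).
  rewrite ger0_norm; last by rewrite !mulr_ge0// ltW.
  have : c * phi (kap (f x)) <= 1 by rewrite mulr_ile1.
  rewrite (_ : c * _ * _ = c * phi (kap (f x)) * (e * `|w|)); last by ring.
  rewrite ew => h; apply: (@le_lt_trans _ _ (1 * (dl / 2))); last by lra.
  by rewrite ler_wpM2r// divr_ge0// ltW.
exists g; split; first by apply: homot_weak hg => x v Dx [].
move=> x Dx Og Ag.
have Of : O (f x).
  by apply: contrapT => nOf; move: Og; rewrite gnO.
have [_ kg] := gO x Dx Of.
set X := kap (f x) in kg *; have GX : G X by exact: (chart_im ch).
have /andP[p0 p1] := phi01 X.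
suff AX : A X by split=> //; [exact: AK|rewrite kg /Dl phi1 ?mulr1//; exact: AK].
have [px0|/eqP px0] := eqVneq (phi X) 0.
  by move: Ag; rewrite kg /Dl -/X px0 mulr0 scale0r addr0.
have sp : 0 < e * phi X by rewrite mulr_gt0// lt_neqAle eq_sym p0 andbT; exact/eqP.
have [|[s' /andP[s'0 s's] nG]] := C2 _ (e * phi X) Ag sp.
  by rewrite kg /Dl -/X addrK.
(* Going back from the end point, [G] is left at [z], where [phi] vanishes. The Lipschitz bound
   between [X] and [z] makes [e * phi X] at most half of [e * phi X - s'], which is impossible. *)
exfalso; move: nG; rewrite kg /Dl -/X -addrA -scalerBl.
set z := X + _ => nG.
have pz : phi z = 0 by apply: contrapT => /phiS[/SG].
have := lphi X z; rewrite pz subr0 opprD addrA subrr sub0r normrN normrZ.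
rewrite (ger0_norm p0) ger0_norm ?subr_ge0// => h.
have {}h : e * phi X <= (e * phi X - s') / 2.
  have -> : (e * phi X - s') / 2 = e * (dl^-1 * ((e * phi X - s') * `|w|)).
    rewrite (_ : e * (dl^-1 * _) = (e * phi X - s') * dl^-1 * (e * `|w|)); last by ring.
    by rewrite ew; field; rewrite gt_eqF.
  by rewrite ler_pM2l.
lra.
Qed.

(** A point still in [A] after [N] steps has been translated by [N * e] times [w] from a point of
    [K] to a point of [K]; this is impossible once [N * e * |w|] exceeds twice a bound of [K].
    Stability of [K] under forward translation within [A] lets the step be repeated. *)
Lemma clear_collapse U V d (D : set U) (W O : set V) G (kap : V -> 'rV[R]_d) lam
    (A K : set 'rV[R]_d) (w : 'rV[R]_d) (f : U -> V) :
  chart W O G kap lam -> A `<=` G -> w != 0 ->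
  (forall a s, A a -> 0 < s ->
     A (a - s *: w) \/ exists2 s', 0 < s' <= s & ~ G (a - s' *: w)) ->
  compact K -> K `<=` A ->
  (forall z s, K z -> 0 <= s -> A (z + s *: w) -> K (z + s *: w)) ->
  cont_on D f -> (forall x, D x -> W (f x)) ->
  (forall x, D x -> O (f x) -> A (kap (f x)) -> K (kap (f x))) ->
  exists g, homot D (push_inv W O f) f g /\
    forall x, D x -> O (g x) -> ~ A (kap (g x)).
Proof.
move=> ch AG w0 C2 cK KA KF cf Wf AK.
have If g : (forall x, D x -> W (g x)) -> forall x, D x -> push_inv W O g x (g x).
  by move=> Wg x Dx; split=> //; exact: Wg.
have [/set0P K0|] := boolP (K != set0); last first.
  rewrite negbK => /eqP K0; exists f; split; first by apply: homot_refl => //; exact: If.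
  by move=> x Dx Of Af; have := AK x Dx Of Af; rewrite K0.
have [e e0 step] := @clear_step U V d D W O G kap lam A K w ch AG w0 C2 cK K0 KA.
have [B B0 hB] := compact_cont_bounded cK (@cont_on_id _ _ K).
have iter N : exists g, homot D (push_inv W O f) f g /\
    forall x, D x -> O (g x) -> A (kap (g x)) ->
      K (kap (g x)) /\ exists2 z, K z & kap (g x) = z + (N%:R * e) *: w.
  elim: N => [|N [g [hg Kg]]].
    exists f; split; first by apply: homot_refl => //; exact: If.
    move=> x Dx Of Af; split; first exact: AK.
    by exists (kap (f x)); [exact: AK|rewrite mul0r scale0r addr0].
  have cg := homot_cont hg.
  have Wg x : D x -> W (g x) by move=> /(homot_end hg)[].
  have [|g' [hg' Kg']] := step g cg Wg; first by move=> x Dx Og /(Kg x Dx Og)[].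
  exists g'; split; first exact: push_inv_trans hg hg'.
  move=> x Dx Og' Ag'; have [Og Kgx kg'] := Kg' x Dx Og' Ag'.
  have [_ [z Kz gz]] := Kg x Dx Og (KA _ Kgx).
  split; first by rewrite kg'; apply: KF => //; [exact: ltW|rewrite -kg'].
  exists z => //; rewrite kg' gz -addrA -scalerDl -natr1.
  by rewrite mulrDl mul1r.
have nw0 : 0 < `|w| by rewrite normr_gt0.
pose N := Num.bound (2 * B / (e * `|w|)).
have hN : 2 * B < N%:R * e * `|w|.
  have : 2 * B / (e * `|w|) < N%:R.
    by apply: archi_boundP; rewrite divr_ge0// mulr_ge0// ltW.
  by rewrite ltr_pdivrMr ?mulr_gt0// mulrA.
have [g [hg Kg]] := iter N.
exists g; split=> // x Dx Og Ag.
have [Kgx [z Kz gz]] := Kg x Dx Og Ag.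
have : `|(N%:R * e) *: w| <= 2 * B.
  have -> : (N%:R * e) *: w = kap (g x) - z by rewrite gz addrAC subrr add0r.
  by rewrite (le_trans (ler_normB _ _))//; have := hB _ Kgx; have := hB _ Kz; lra.
rewrite normrZ ger0_norm; last by rewrite mulr_ge0// ltW.
lra.
Qed.

End ClearCollapse.

(** * General position by Lipschitz approximation *)

Section GeneralPosition.
Variable R : realType.
Implicit Types U V W : normedModType R.

(** The Lipschitz envelope, the infimum over [y] of [g y + L * |x - y|], lies below [g]. With
    [L = 2 * B / d], where [B] bounds [g] and [d] is a modulus of continuity for [e], points [y] at
    distance at least [d] cannot pull it below [g x], and nearer ones pull it down by at most
    [e]. *)
Lemma lipschitz_approx U (D : set U) (g : U -> R) (e : R) :
  compact D -> cont_on D (g : U -> R^o) -> 0 < e ->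
  exists (p : U -> R) (L : R), [/\ 0 < L,
    forall x, D x -> `|p x - g x| <= e &
    forall x y, `|p x - p y| <= L * `|x - y|].
Proof.
move=> cD cg e0.
have [/set0P D0|] := boolP (D != set0); last first.
  rewrite negbK => /eqP D0; exists (fun=> 0), 1; split=> //.
    by move=> x; rewrite D0.
  by move=> x y; rewrite subrr normr0 mul1r.
have [B B0 hB] := compact_cont_bounded cD cg.
have {}hB x : D x -> - B <= g x <= B.
  by move=> Dx; rewrite -ler_norml; exact: hB.
have [d d0 hd] := compact_unif_cont cD cg e0.
have {}hd x y : D x -> D y -> `|y - x| < d -> g x - e < g y < g x + e.
  move=> Dx Dy yx; have : `|g y - g x : R| < e by exact: hd.
  by rewrite ltr_norml => /andP[? ?]; apply/andP; split; lra.
pose L := 2 * B / d; have L0 : 0 < L by rewrite divr_gt0// mulr_gt0.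
pose E x := [set g y + L * `|x - y| | y in D].
have hE x : has_inf (E x).
  have [y Dy] := D0; split; first by exists (g y + L * `|x - y|), y.
  exists (- B) => _ [z Dz <-]; have /andP[? _] := hB z Dz.
  have : 0 <= L * `|x - z| by rewrite mulr_ge0// ltW.
  by lra.
pose p x := inf (E x).
have p_le x y : D y -> p x <= g y + L * `|x - y|.
  by move=> Dy; apply: ge_inf; [exact: (hE x).2|exists y].
exists p, L; split=> //.
- move=> x Dx; have := p_le x x Dx; rewrite subrr normr0 mulr0 addr0 => px.
  suff : g x - e <= p x by rewrite ler_norml => ?; apply/andP; split; lra.
  apply: lb_le_inf; first exact: (hE x).1.
  move=> _ [y Dy <-]; have [yx|yx] := ltP `|y - x| d.
    have /andP[? _] := hd x y Dx Dy yx.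
    have : 0 <= L * `|x - y| by rewrite mulr_ge0// ltW.
    by lra.
  have /andP[? _] := hB y Dy; have /andP[_ ?] := hB x Dx.
  have : 2 * B <= L * `|x - y|.
    rewrite distrC; apply: (@le_trans _ _ (L * d)); last by rewrite ler_pM2l.
    by rewrite /L divfK// gt_eqF.
  by lra.
- have key x y : p x <= p y + L * `|x - y|.
    apply/ler_addgt0Pr => t t0.
    have [_ [z Dz <-] hz] := inf_adherent t0 (hE y).
    apply: (le_trans (p_le x z Dz)); rewrite -/(p y) in hz.
    have : L * `|x - z| <= L * `|x - y| + L * `|y - z|.
      rewrite -mulrDr ler_pM2l//.
      have -> : x - z = (x - y) + (y - z) by rewrite addrA subrK.
      exact: ler_normD.
    by lra.
  move=> x y; rewrite ler_norml; have := key x y; have := key y x.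
  by rewrite (distrC y x) => ? ?; apply/andP; split; lra.
Qed.

Lemma lipschitz_approx_rV U d (D : set U) (g : U -> 'rV[R]_d) (e : R) :
  compact D -> cont_on D g -> 0 < e ->
  exists (p : U -> 'rV[R]_d) (L : R), [/\ 0 < L,
    forall x, D x -> `|p x - g x| <= e &
    forall x y, `|p x - p y| <= L * `|x - y|].
Proof.
move=> cD cg e0.
have [|p hp] := @choice _ _ (fun (i : 'I_d) (p : U -> R) => exists L : R, [/\ 0 < L,
    forall x, D x -> `|p x - g x ord0 i| <= e &
    forall x y, `|p x - p y| <= L * `|x - y|]).
  by move=> i; apply: lipschitz_approx => //; exact: cont_on_coord.
have [|L hL] := @choice _ _ (fun (i : 'I_d) (L : R) => [/\ 0 < L,
    forall x, D x -> `|p i x - g x ord0 i| <= e &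
    forall x y, `|p i x - p i y| <= L * `|x - y|]).
  exact: hp.
exists (fun x => \row_i p i x), (1 + \sum_i L i).
have L0 i : 0 <= L i by have [/ltW] := hL i.
have sL : 0 <= \sum_i L i by rewrite sumr_ge0.
split; first lra.
- move=> x Dx; apply/norm_rVP => [|i]; first exact: ltW.
  by rewrite !mxE; have [_ + _] := hL i; apply.
- move=> x y; apply/norm_rVP => [|i]; first by rewrite mulr_ge0//; lra.
  rewrite !mxE; have [_ _ h] := hL i; apply: (le_trans (h x y)).
  rewrite ler_wpM2r// (bigD1 i)//=.
  have : 0 <= \sum_(j | j != i) L j by rewrite sumr_ge0.
  lra.
Qed.

(** Counting: cut the [a]-cube into boxes whose images are too small to contain two
    points of a grid in the ball; there are fewer boxes than grid points. *)
Lemma lipschitz_no_ball a d (X : set 'rV[R]_a) (g : 'rV[R]_a -> 'rV[R]_d) (L e : R) :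
  (a < d)%N -> X `<=` @cube R a -> 0 < e -> 0 < L ->
  (forall x y, X x -> X y -> `|g x - g y| <= L * `|x - y|) ->
  exists2 u : 'rV[R]_d, `|u| <= e & forall x, X x -> g x <> u.
Proof.
move=> ad Xc e0 L0 lg; apply: contrapT => no.
have {no} sur (u : 'rV[R]_d) : `|u| <= e -> exists2 x, X x & g x = u.
  move=> ue; apply: contrapT => nx; apply: no; exists u => // x Xx gx.
  by apply: nx; exists x.
(* The constants solve the count: points in one box of side [1 / J] have images at distance at most
   [L / J], less than the grid spacing [e / K], while [(J + 1) ^ a <= (c + 1) ^ a * (K + 1) ^ a = K
   * (K + 1) ^ a < (K + 1) ^ d]. *)
pose c := (Num.bound (L / e)).+1.
have hc : L / e < c%:R.
  have : L / e < (Num.bound (L / e))%:R by apply: archi_boundP; rewrite divr_ge0// ltW.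
  by rewrite /c -natr1; lra.
pose K := (c.+1 ^ a)%N.
have K0 : (0 < K)%N by rewrite expn_gt0.
pose J := (c * K.+1)%N.
have J0 : (0 < J)%N by rewrite muln_gt0.
pose pt (v : {ffun 'I_d -> 'I_K.+1}) : 'rV[R]_d := \row_i ((v i)%:R * (e / K%:R)).
have K0R : 0 < K%:R :> R by rewrite ltr0n.
have pte v : `|pt v| <= e.
  apply/norm_rVP => [|i]; first exact: ltW.
  rewrite mxE ger0_norm; last by rewrite mulr_ge0// divr_ge0// ltW.
  rewrite mulrCA ger_pMr// ler_pdivrMr// mul1r ler_nat.
  by rewrite -ltnS.
have [x hx] := @choice _ _ (fun v x => X x /\ g x = pt v)
  (fun v => let: ex_intro2 x Xx gx := sur _ (pte v) in ex_intro _ x (conj Xx gx)).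
have J0R : 0 < J%:R :> R by rewrite ltr0n.
pose fl (t : R) : nat := Num.truncn (t * J%:R).
have flP t : 0 <= t <= 1 -> (fl t)%:R <= t * J%:R < (fl t).+1%:R.
  by move=> /andP[t0 t1]; apply: truncn_itv; rewrite mulr_ge0// ltW.
have flJ t : 0 <= t <= 1 -> (fl t < J.+1)%N.
  move=> t01; have /andP[h _] := flP t t01; case/andP: t01 => t0 t1.
  rewrite ltnS -(ler_nat R); apply: (le_trans h); rewrite ger_pMl//.
have Xx v i : 0 <= x v ord0 i <= 1 by exact: (Xc _ (hx v).1).
pose bx (v : {ffun 'I_d -> 'I_K.+1}) : {ffun 'I_a -> 'I_J.+1} :=
  [ffun i => inord (fl (x v ord0 i))].
have bx_inj : injective bx.
  move=> v v' /ffunP vv; apply/ffunP => i.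
  have xx : `|x v - x v'| <= J%:R^-1.
    apply/norm_rVP => [|l]; first by rewrite invr_ge0 ltW.
    have := vv l; rewrite !ffunE => /(congr1 (@nat_of_ord _)); rewrite !inordK ?flJ// => fe.
    have /andP[h1 h2] := flP _ (Xx v l); have /andP[h3 h4] := flP _ (Xx v' l).
    rewrite fe -natr1 in h1 h2; rewrite -natr1 in h4.
    rewrite !mxE -(ler_pM2r J0R) mulVf ?gt_eqF// -{1}(gtr0_norm J0R) -normrM.
    by rewrite ler_norml; apply/andP; split; lra.
  have [X1 g1] := hx v; have [X2 g2] := hx v'.
  have := lg _ _ X1 X2; rewrite g1 g2 => h.
  have := norm_rV_coord (pt v - pt v') i; rewrite !mxE -mulrBl => h'.
  have {h h'} h : `|((v i)%:R - (v' i)%:R) * (e / K%:R)| <= L / J%:R.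
    by apply: (le_trans h'); apply: (le_trans h); rewrite ler_pM2l.
  have h1 : L / J%:R < e / K%:R.
    rewrite ltr_pdivrMr// mulrAC ltr_pdivlMr// /J natrM.
    have : L < c%:R * e by rewrite -ltr_pdivrMr.
    rewrite -natr1 => hL.
    have : L * K%:R < c%:R * e * K%:R by rewrite ltr_pM2r.
    have : 0 < c%:R * e by lra.
    lra.
  have eK : 0 < e / K%:R by rewrite divr_gt0.
  have {h h1} h : `|(v i)%:R - (v' i)%:R : R| < 1.
    have := le_lt_trans h h1; rewrite normrM (gtr0_norm eK).
    by rewrite -{2}(mul1r (e / K%:R)) ltr_pM2r.
  apply: val_inj; apply/eqP; rewrite eqn_leq -(ltnS (v i)) -(ltnS (v' i)).
  rewrite -!(ltr_nat R) -!natr1.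
  by move: h; rewrite ltr_norml => /andP[? ?]; apply/andP; split; lra.
have := leq_card _ bx_inj; rewrite !card_ffun !card_ord; apply/negP; rewrite -ltnNge.
apply: (@leq_ltn_trans (K * K.+1 ^ a)).
  have mono k s t : (s <= t -> s ^ k <= t ^ k)%N.
    by move=> st; elim: k => // k IH; rewrite !expnS leq_mul.
  by rewrite /K -expnMn mono// /J mulSn; lia.
by rewrite (@leq_trans (K.+1 ^ a.+1))// ?leq_pexp2l// expnS ltn_pmul2r// expn_gt0.
Qed.

End GeneralPosition.

Section ClearGeneralPosition.
Variable R : realType.
Implicit Types U V W : normedModType R.

Lemma norm_lsubmx a b (v : 'rV[R]_(a + b)) : `|lsubmx v| <= `|v|.
Proof.
apply/norm_rVP => // i; rewrite mxE; exact: norm_rV_coord.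
Qed.

Lemma norm_rsubmx a b (v : 'rV[R]_(a + b)) : `|rsubmx v| <= `|v|.
Proof.
apply/norm_rVP => // i; rewrite mxE; exact: norm_rV_coord.
Qed.

(** For a Lipschitz approximation [p] of the map read in the chart, [(c, x) |-> E c - p x] is
    Lipschitz from a part of an (r + m)-cube to dimension [d], hence misses some arbitrarily small
    [u]; then [p + u] misses [A]. A cut-off interpolates between [p + u] near the preimage of [A]
    and the given map elsewhere. *)
Lemma clear_general_position m r V d (D : set 'rV[R]_m) (W O : set V) G (kap : V -> 'rV[R]_d) lam
    (A : set 'rV[R]_d) (E : 'rV[R]_r -> 'rV[R]_d) (LE : R) (f : 'rV[R]_m -> V) :
  chart W O G kap lam -> compact D -> D `<=` @cube R m -> (r + m < d)%N ->
  0 <= LE -> (forall x y, `|E x - E y| <= LE * `|x - y|) ->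
  A `<=` [set E c | c in @cube R r] -> rclosed G A ->
  cont_on D f -> (forall x, D x -> W (f x)) ->
  rclosed D [set x | O (f x) /\ A (kap (f x))] ->
  exists g, homot D (push_inv W O f) f g /\
    forall x, D x -> O (g x) -> ~ A (kap (g x)).
Proof.
move=> ch cD Dc rmd LE0 lE AE cA cf Wf cC.
pose C := D `&` [set x | O (f x) /\ A (kap (f x))].
have cC' : compact C by exact: compact_rclosed.
have If : forall x, D x -> push_inv W O f x (f x).
  by move=> x Dx; split=> //; exact: Wf.
have [/set0P [x0 Cx0]|] := boolP (C != set0); last first.
  rewrite negbK => /eqP C0; exists f; split; first exact: homot_refl.
  move=> x Dx Ox Ax; suff : C x by rewrite C0.
  by split.
have ckf : cont_on (D `&` (fun x => O (f x))) (fun x => kap (f x)).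
  apply: (cont_on_comp (B := O)) (chart_cont ch); first by move=> x [].
  by apply: cont_on_sub cf => x [].
pose K := [set kap (f x) | x in C].
have cK : compact K.
  apply: compact_image cC'; apply: cont_on_sub ckf.
  by move=> x [Dx [Ox Ax]].
have K0 : K !=set0 by exists (kap (f x0)), x0.
have KG : K `<=` G.
  by move=> _ [x [Dx [Ox Ax]] <-]; exact: (chart_im ch).
have [dl [phi [S [[dl0 cS SG] phi01 lphi phi1 phiS]]]] :=
  lip_bump cK K0 KG (chart_im_open ch).
have cphi (B : set 'rV[R]_d) : cont_on B (phi : _ -> R^o).
  by apply: (@cont_on_lip _ _ _ _ _ dl^-1) => x y _ _; exact: lphi.
pose L := [set lam z | z in S].
have cL : compact L.
  by apply: compact_image cS; apply: cont_on_sub (chart_inv_cont ch).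
have LP p : O p -> (L p <-> S (kap p)).
  move=> Op; split=> [[z Sz <-]|Sp]; first by rewrite (chart_invK ch)//; exact: SG.
  by exists (kap p) => //; exact: (chartK ch).
have LO p : L p -> O p.
  by move=> [z Sz <-]; apply: (chart_inv ch); exact: SG.
pose D1 := D `&` [set x | L (f x)].
have cD1 : compact D1.
  apply: compact_rclosed => //.
  by apply: (rclosed_preimage (Y := setT)) cf _ _ => //; exact: compact_is_rclosed.
have D1O : D1 `<=` D `&` (fun x => O (f x)).
  by move=> x [Dx Lx]; split=> //; exact: LO.
have ck1 : cont_on D1 (fun x => kap (f x)) by apply: cont_on_sub ckf.
(* The images of these points keep a positive distance [be] from [A], since [phi] is 1 at the points
   of [A] that are hit. *)
pose D2 := D1 `&` [set x | phi (kap (f x)) <= 2^-1].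
have cphk : cont_on D1 (fun x => phi (kap (f x)) : R^o).
  by apply: (cont_on_comp (B := setT)) ck1 (cphi _).
have cD2 : compact D2 by apply: compact_rclosed => //; exact: rclosed_le.
pose K2 := [set kap (f x) | x in D2].
have cK2 : compact K2.
  by apply: compact_image cD2; apply: cont_on_sub ck1 => x [].
have phiA x : D x -> O (f x) -> A (kap (f x)) -> phi (kap (f x)) = 1.
  by move=> Dx Ox Ax; apply: phi1; exists x.
have K2nA : K2 `<=` [set z | G z /\ ~ A z].
  move=> _ [x [[Dx Lx] /= hx] <-]; have Ox := LO _ Lx.
  split; first exact: (chart_im ch).
  by move=> Ax; move: hx; rewrite phiA//; lra.
have oGA : ropen setT [set z | G z /\ ~ A z].
  move=> z [Gz nA]; have [e e0 he] := chart_im_open ch Gz.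
  have [e' e'0 he'] := cA z Gz nA.
  exists (Num.min e e'); first by rewrite lt_min e0.
  move=> y _; rewrite lt_min => /andP[y1 y2]; have Gy := he y I y1.
  by split => //; exact: he'.
have [be be0 hbe] := compact_ropen_gap cK2 K2nA oGA.
(* The displacement is at most [2 * al]: [al] for the approximation and [al] for [u]. This is below
   [dl], so the push stays in [G], and below [be], so the points of [D2] do not enter [A]. *)
pose al := Num.min dl be / 4.
have al0 : 0 < al by rewrite divr_gt0// lt_min dl0.
have ald : 4 * al <= dl by rewrite /al mulrC divfK// ge_min lexx.
have alb : 4 * al <= be by rewrite /al mulrC divfK// ge_min lexx orbT.
have [p [Lp [Lp0 pf lp]]] := lipschitz_approx_rV cD1 ck1 al0.
have [u ual hu] : exists2 u : 'rV[R]_d, `|u| <= al &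
    forall c x, cube c -> D1 x -> E c - p x <> u.
  pose X := [set v : 'rV[R]_(r + m) | cube (lsubmx v) /\ D1 (rsubmx v)].
  have [|||u u1 u2] := @lipschitz_no_ball R (r + m) d X
    (fun v => E (lsubmx v) - p (rsubmx v)) (LE + Lp) al rmd _ al0.
  - move=> v [cv [Dv _]] i; rewrite -[v]hsubmxK.
    case: (splitP i) => j ij.
      have -> : i = lshift m j by exact: val_inj.
      by rewrite row_mxEl; exact: cv.
    have -> : i = rshift r j by exact: val_inj.
    by rewrite row_mxEr; exact: (Dc _ Dv).
  - lra.
  - move=> x y _ _.
    have -> : E (lsubmx x) - p (rsubmx x) - (E (lsubmx y) - p (rsubmx y)) =
        (E (lsubmx x) - E (lsubmx y)) - (p (rsubmx x) - p (rsubmx y)).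
      by rewrite !opprB addrACA [in RHS]addrACA; congr (_ + _); rewrite addrC.
    rewrite (le_trans (ler_normB _ _))// mulrDl lerD//.
      apply: (le_trans (lE _ _)); rewrite ler_wpM2l//.
      by rewrite -linearB /=; exact: norm_lsubmx.
    apply: (le_trans (lp _ _)); rewrite ler_wpM2l ?(ltW Lp0)//.
    have -> : rsubmx x - rsubmx y = rsubmx (x - y) by rewrite linearB.
    exact: norm_rsubmx.
  exists u => // c x cc Dx.
  have := u2 (row_mx c x); rewrite row_mxKl row_mxKr; apply.
  by rewrite /X/= row_mxKl row_mxKr.
(* Equal to 1 once [phi] is at least 1/2, so that on the rest of [D1] the new map is exactly
   [p + u]. *)
pose psi z := Num.min 1 (2 * phi z).
have psi01 z : 0 <= psi z <= 1.
  have /andP[? ?] := phi01 z.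
  by rewrite /psi le_min ge_min lexx ler01 /= andbT mulr_ge0.
have psi0 z : psi z <> 0 -> phi z <> 0.
  by move=> h p0; apply: h; rewrite /psi p0 mulr0; apply/min_idPr.
pose Dl x := psi (kap (f x)) *: (p x - kap (f x) + u).
have cDl : cont_on (D `&` (fun x => O (f x))) Dl.
  apply: (cont_on_scale (a := fun x => psi (kap (f x)))).
    apply: cont_on_min; first exact: cont_on_cst.
    apply: (cont_on_scale (W := R^o) (a := fun=> 2)); first exact: cont_on_cst.
    by apply: (cont_on_comp (B := setT)) ckf (cphi _).
  apply: cont_on_add; last exact: cont_on_cst.
  apply: cont_on_sub_fun => //.
  by apply: (@cont_on_lip _ _ _ _ _ Lp) => x y _ _; exact: lp.
have small x : D1 x -> `|Dl x| <= 2 * al.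
  move=> Dx; rewrite normrZ; have /andP[q0 q1] := psi01 (kap (f x)).
  rewrite ger0_norm//; apply: (@le_trans _ _ (1 * (2 * al))); last by rewrite mul1r.
  rewrite ler_pM// (le_trans (ler_normD _ _))//.
  by have := pf x Dx; lra.
have D1P x : D x -> O (f x) -> psi (kap (f x)) <> 0 -> D1 x.
  by move=> Dx Ox /psi0/phiS[Sx _]; split => //; apply/LP.
have [||g [hg gO gnO]] := chart_push ch cS SG cf Wf cDl.
- move=> x Dx Ox Dl0; apply: (phiS _ _).1; apply: psi0 => p0; apply: Dl0.
  by rewrite /Dl p0 scale0r.
- move=> x Dx Ox c /andP[c0 c1].
  have [p0|/eqP p0] := eqVneq (psi (kap (f x))) 0.
    by rewrite /Dl p0 scale0r scaler0 addr0; exact: (chart_im ch).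
  apply: (phiS _ (psi0 _ p0)).2; rewrite addrAC subrr add0r normrZ ger0_norm//.
  have := small x (D1P x Dx Ox p0) => h.
  apply: (@le_lt_trans _ _ (1 * (2 * al))); last by lra.
  by rewrite ler_pM.
exists g; split; first by apply: homot_weak hg => x v Dx [].
move=> x Dx Og Ag.
have Of : O (f x).
  by apply: contrapT => nOf; move: Og; rewrite gnO.
have [_ kg] := gO x Dx Of.
have [p0|/eqP p0] := eqVneq (psi (kap (f x))) 0.
  have kgf : kap (g x) = kap (f x) by rewrite kg /Dl p0 scale0r addr0.
  move: p0; rewrite /psi phiA//; last by rewrite -kgf.
  by rewrite mulr1; case: leP => ? ?; lra.
have D1x := D1P x Dx Of p0.
have [h|h] := lerP (phi (kap (f x))) 2^-1.
  have /hbe : K2 (kap (f x)) by exists x.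
  move=> /(_ (kap (g x)) I)[|_]; last exact.
  rewrite kg addrAC subrr add0r.
  by apply: (le_lt_trans (small x D1x)); lra.
have p1 : psi (kap (f x)) = 1 by rewrite /psi; apply/min_idPl; lra.
have [c cc Ec] := AE _ Ag.
apply: (hu c x cc D1x); rewrite Ec kg /Dl p1 scale1r.
by rewrite [p x - _]addrC addrA addrA subrr add0r addrAC subrr add0r.
Qed.

End ClearGeneralPosition.

(** * Piecewise affine maps *)

Section Affine.
Variable R : realType.

Lemma small_multiple (V : normedModType R) (v : V) (r : R) : 0 < r ->
  exists2 s : R, 0 < s & `|s *: v| < r.
Proof.
move=> r0; have v0 : 0 < 1 + `|v| by rewrite ltr_pwDl.
exists (r / (1 + `|v|)); first by rewrite divr_gt0.
rewrite normrZ gtr0_norm ?divr_gt0// -mulrA gtr_pMr// mulrC ltr_pdivrMr// mul1r.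
by rewrite ltrDr.
Qed.

Definition afm n p := ('M[R]_(n, p) * 'rV[R]_p)%type.
Definition ev n p (a : afm n p) (x : 'rV[R]_n) : 'rV[R]_p := x *m a.1 + a.2.
Definition evl n (l : afm n 1) (x : 'rV[R]_n) : R := ev l x ord0 ord0.
Definition slope n (l : afm n 1) (v : 'rV[R]_n) : R := (v *m l.1) ord0 ord0.
Definition acomp n p q (a : afm n p) (b : afm p q) : afm n q :=
  (a.1 *m b.1, a.2 *m b.1 + b.2).
Definition coord_af n p (a : afm n p) (j : 'I_p) : afm n 1 := (col j a.1, col j a.2).
Definition coords n p (a : afm n p) : seq (afm n 1) := [seq coord_af a j | j <- enum 'I_p].

Lemma ev_acomp n p q (a : afm n p) (b : afm p q) x :
  ev (acomp a b) x = ev b (ev a x).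
Proof. by rewrite /ev/= mulmxDl mulmxA addrA. Qed.

Lemma evl_acomp n p (a : afm n p) (l : afm p 1) x :
  evl (acomp a l) x = evl l (ev a x).
Proof. by rewrite /evl ev_acomp. Qed.

Lemma evl_coord n p (a : afm n p) j x : evl (coord_af a j) x = ev a x ord0 j.
Proof.
rewrite /evl /ev /= !mxE; congr (_ + _); first by apply: eq_bigr => i _; rewrite !mxE.
Qed.

Lemma mem_coords n p (a : afm n p) j : coord_af a j \in coords a.
Proof. by apply: map_f; rewrite mem_enum. Qed.

Lemma ev_line n p (a : afm n p) x s v : ev a (x + s *: v) = ev a x + s *: (v *m a.1).
Proof. by rewrite /ev mulmxDl scalemxAl addrAC. Qed.

Lemma evl_line n (l : afm n 1) x s v : evl l (x + s *: v) = evl l x + s * slope l v.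
Proof. by rewrite /evl ev_line mxE [X in _ + X]mxE. Qed.

Lemma mulmx_lip n p (A : 'M[R]_(n, p)) :
  exists2 C : R, 0 <= C & forall x : 'rV[R]_n, `|x *m A| <= C * `|x|.
Proof.
exists (\sum_i \sum_j `|A i j|); first by rewrite !sumr_ge0// => i _; rewrite sumr_ge0.
move=> x; apply/norm_rVP => [|j].
  by rewrite mulr_ge0// sumr_ge0// => i _; rewrite sumr_ge0.
rewrite mxE (le_trans (ler_norm_sum _ _ _))// mulr_suml ler_sum// => i _.
rewrite normrM mulrC ler_pM//; last exact: norm_rV_coord.
by rewrite (bigD1 j)//= lerDl sumr_ge0.
Qed.

Lemma ev_lip n p (a : afm n p) :
  exists2 C : R, 0 <= C & forall x y, `|ev a x - ev a y| <= C * `|x - y|.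
Proof.
have [C C0 h] := mulmx_lip a.1; exists C => // x y.
by rewrite /ev opprD addrACA subrr addr0 -mulmxBl.
Qed.

Lemma ev_cont n p (a : afm n p) X : cont_on X (ev a).
Proof. by have [C _ h] := ev_lip a; apply: (@cont_on_lip _ _ _ _ _ C). Qed.

Lemma evl_cont n (l : afm n 1) X : cont_on X (evl l : _ -> R^o).
Proof. by apply: cont_on_coord; exact: ev_cont. Qed.

(** [y] is in the closed cell of [x]: the closure of the face of the hyperplane arrangement [L] that
    contains [x]. *)
Definition ccell n (L : seq (afm n 1)) (x y : 'rV[R]_n) : Prop :=
  forall l, l \in L ->
    (0 <= evl l x -> 0 <= evl l y) /\ (evl l x <= 0 -> evl l y <= 0).

(** Piecewise affine with respect to an arrangement instead of a triangulation. Enlarging [L]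
    preserves the property, so composites and preimages need no common subdivision. *)
Definition PLF n p (X : set 'rV[R]_n) (f : 'rV[R]_n -> 'rV[R]_p)
    (L : seq (afm n 1)) (A : seq (afm n p)) : Prop :=
  forall x, X x -> exists2 a, a \in A &
    forall y, X y -> ccell L x y -> f y = ev a y.

Definition polyh n (X : set 'rV[R]_n) (L : seq (afm n 1)) : Prop :=
  forall x y, X x -> ccell L x y -> X y.

Lemma ccell_refl n (L : seq (afm n 1)) x : ccell L x x.
Proof. by []. Qed.

Lemma ccell_sub n (L M : seq (afm n 1)) x y :
  {subset M <= L} -> ccell L x y -> ccell M x y.
Proof. by move=> ML h l /ML; exact: h. Qed.

Lemma ccell_eq0 n (L : seq (afm n 1)) x y l :
  ccell L x y -> l \in L -> evl l x = 0 -> evl l y = 0.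
Proof.
move=> h /h[h1 h2] lx; apply/eqP; rewrite eq_le h1 ?h2// lx//.
Qed.

(** Nonzero signs at [x] persist nearby, so [x] is in the closed cell of every point near it. Hence
    one affine piece serves at both points, which makes [PLF] maps continuous, and [polyh] sets are
    closed. *)
Lemma ccell_near n (L : seq (afm n 1)) x :
  exists2 d : R, 0 < d & forall y, `|y - x| < d -> ccell L y x.
Proof.
elim: L => [|l L [d d0 h]]; first by exists 1.
have cl : cont_on setT (evl l : _ -> R^o) by exact: evl_cont.
have [d' d'0 h'] : exists2 d : R, 0 < d & forall y, `|y - x| < d ->
    (0 <= evl l y -> 0 <= evl l x) /\ (evl l y <= 0 -> evl l x <= 0).
  move/cont_on_realP: cl => /(_ x I).
  have [lx|lx|lx] := ltgtP (evl l x) 0.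
  - have e0 : 0 < - evl l x by lra.
    move=> /(_ _ e0)[d' d'0 h']; exists d' => // y yx.
    by have /andP[? ?] := h' y I yx; split => ?; lra.
  - move=> /(_ _ lx)[d' d'0 h']; exists d' => // y yx.
    by have /andP[? ?] := h' y I yx; split => ?; lra.
  - by move=> _; exists 1.
exists (Num.min d d'); first by rewrite lt_min d0.
move=> y; rewrite lt_min => /andP[y1 y2] m; rewrite inE => /predU1P[->|mL].
  exact: h'.
exact: h.
Qed.

Lemma seq_max_lip n p (A : seq (afm n p)) :
  exists2 C : R, 0 < C & forall a, a \in A -> forall x y, `|ev a x - ev a y| <= C * `|x - y|.
Proof.
elim: A => [|a A [C C0 h]]; first by exists 1.
have [C' C'0 h'] := ev_lip a; exists (C + C'); first lra.
move=> b; rewrite inE => /predU1P[->|bA] x y; rewrite mulrDl.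
  by rewrite (le_trans (h' _ _))// lerDr mulr_ge0// ltW.
by rewrite (le_trans (h _ bA _ _))// lerDl mulr_ge0.
Qed.

Lemma PLF_cont n p (X : set 'rV[R]_n) (f : 'rV[R]_n -> 'rV[R]_p) L A :
  PLF X f L A -> cont_on X f.
Proof.
move=> pf x Xx e e0; have [C C0 hC] := seq_max_lip A.
have [d d0 hd] := ccell_near L x.
exists (Num.min d (e / C)); first by rewrite lt_min d0 divr_gt0.
move=> y Xy; rewrite lt_min => /andP[y1 y2].
have [a aA ha] := pf y Xy.
rewrite (ha y Xy (@ccell_refl _ _ _)) (ha x Xx (hd _ y1)).
apply: (le_lt_trans (hC a aA _ _)).
by rewrite mulrC -ltr_pdivlMr.
Qed.

Lemma PLF_sub n p (X Y : set 'rV[R]_n) (f : 'rV[R]_n -> 'rV[R]_p) L A :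
  Y `<=` X -> PLF X f L A -> PLF Y f L A.
Proof.
move=> YX pf x /YX/pf[a aA h]; exists a => // y /YX; exact: h.
Qed.

Lemma PLF_eq n p (X : set 'rV[R]_n) (f g : 'rV[R]_n -> 'rV[R]_p) L A :
  (forall x, X x -> f x = g x) -> PLF X f L A -> PLF X g L A.
Proof.
move=> fg pf x /pf[a aA h]; exists a => // y Xy xy; rewrite -fg//; exact: h.
Qed.

Lemma PLF_more n p (X : set 'rV[R]_n) (f : 'rV[R]_n -> 'rV[R]_p) L L' A :
  {subset L <= L'} -> PLF X f L A -> PLF X f L' A.
Proof.
move=> LL pf x /pf[a aA h]; exists a => // y Xy xy; apply: h => //.
exact: ccell_sub xy.
Qed.

(** The functionals of [M] read through every affine piece in [A]: their signs decide in which cell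
    of [M] the image of a point lies. *)
Definition pull n p (A : seq (afm n p)) (M : seq (afm p 1)) : seq (afm n 1) :=
  [seq acomp a m | a <- A, m <- M].

Lemma ccell_pull n p (A : seq (afm n p)) (M : seq (afm p 1)) x y a :
  a \in A -> ccell (pull A M) x y -> ccell M (ev a x) (ev a y).
Proof.
move=> aA h m mM; rewrite -!evl_acomp; apply: h.
by apply: allpairs_f.
Qed.

Lemma ccell_cat n (L M : seq (afm n 1)) x y :
  ccell (L ++ M) x y -> ccell L x y /\ ccell M x y.
Proof.
by move=> h; split; apply: ccell_sub h => l lL; rewrite mem_cat lL ?orbT.
Qed.

Lemma PLF_comp n p q (X : set 'rV[R]_n) (Y : set 'rV[R]_p)
    (f : 'rV[R]_n -> 'rV[R]_p) (g : 'rV[R]_p -> 'rV[R]_q) L A M B :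
  (forall x, X x -> Y (f x)) -> PLF X f L A -> PLF Y g M B ->
  PLF X (fun x => g (f x)) (L ++ pull A M) [seq acomp a b | a <- A, b <- B].
Proof.
move=> XY pf pg x Xx; have [a aA ha] := pf x Xx.
have [b bB hb] := pg _ (XY x Xx).
exists (acomp a b); first exact: allpairs_f.
move=> y Xy /ccell_cat[xy /(ccell_pull aA) xy'].
rewrite ev_acomp -ha//; apply: hb; first exact: XY.
by rewrite (ha x)// ha.
Qed.

Lemma polyh_preimage n p (X : set 'rV[R]_n) (Y : set 'rV[R]_p)
    (f : 'rV[R]_n -> 'rV[R]_p) L A M :
  PLF X f L A -> polyh X L -> polyh Y M ->
  polyh (X `&` (fun x => Y (f x))) (L ++ pull A M).
Proof.
move=> pf pX pY x y [Xx Yx] /ccell_cat[xy xy'].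
have Xy := pX x y Xx xy; split=> //.
have [a aA ha] := pf x Xx; apply: (pY (f x)) => //.
by rewrite (ha x)// (ha y)//; exact: ccell_pull xy'.
Qed.

Lemma PLF_ev n p (a : afm n p) X : PLF X (ev a) [::] [:: a].
Proof. by move=> x _; exists a; rewrite ?inE. Qed.

(** * Simplices described by signs of functionals *)

Section Simplex.
Variables (N : nat) (s : seq 'rV[R]_N).
Hypothesis s_ai : affinely_independent s.

Let T : 'M[R]_(size s, N) := \matrix_i s`_i.
Let S : 'M[R]_(size s, N + 1) := row_mx T (const_mx 1).

Let mulT (w : 'I_(size s) -> R) : (\row_i w i) *m T = \sum_i w i *: s`_i.
Proof.
rewrite mulmx_sum_row; apply: eq_bigr => i _; rewrite mxE; congr (_ *: _).
by apply/rowP => j; rewrite !mxE.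
Qed.

Let mulS (w : 'I_(size s) -> R) :
  (\row_i w i) *m S = row_mx (\sum_i w i *: s`_i) ((\sum_i w i)%:M).
Proof.
rewrite /S mul_mx_row mulT; congr row_mx; apply/rowP => j.
rewrite !mxE !ord1 eqxx mulr1n; apply: eq_bigr => i _.
by rewrite !mxE mulr1.
Qed.

Let S_free : row_free S.
Proof.
apply: inj_row_free => v vS.
have vE : v = \row_i v ord0 i by apply/rowP => i; rewrite mxE.
rewrite vE mulS in vS.
have /eq_row_mx[v1 v2] : row_mx (\sum_i v ord0 i *: s`_i) (\sum_i v ord0 i)%:M =
    row_mx 0 0 :> 'rV_(N + 1) by rewrite vS row_mx0.
have {}v2 : \sum_i v ord0 i = 0.
  by have /matrixP/(_ ord0 ord0) := v2; rewrite !mxE eqxx mulr1n.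
by apply/rowP => i; rewrite mxE; exact: (s_ai v2 v1).
Qed.

(** Affine independence says that the vertices, extended by a coordinate 1, are linearly independent
    rows. A right inverse of that matrix, applied to [(x, 1)], extends the barycentric coordinates
    to affine functions on the whole space. *)
Definition bary : afm N (size s) :=
  (usubmx (pinvmx S), dsubmx (pinvmx S)).

Lemma baryE (w : 'I_(size s) -> R) : \sum_i w i = 1 ->
  ev bary (\sum_i w i *: s`_i) = \row_i w i.
Proof.
move=> w1; rewrite /ev /bary /=.
rewrite -[dsubmx _]mul1mx -mul_row_col vsubmxK -w1 -mulS -mulmxA.
by rewrite mulmxVp// mulmx1.
Qed.

Definition bary_sum : afm N 1 := acomp bary (const_mx 1, - 1).
Definition bary_rec : afm N N :=
  (1%:M - (acomp bary (T, 0)).1, - (acomp bary (T, 0)).2).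

Lemma bary_recE x : ev bary_rec x = x - ev bary x *m T.
Proof.
have -> : ev bary x *m T = ev (acomp bary (T, 0)) x.
  by rewrite ev_acomp [in RHS]/ev /= addr0.
by rewrite /bary_rec; move: (acomp _ _) => q; rewrite /ev /= mulmxBr mulmx1 opprD addrA.
Qed.

Lemma bary_sumE x : evl bary_sum x = \sum_i ev bary x ord0 i - 1.
Proof.
rewrite evl_acomp /evl; set b := ev bary x.
rewrite /ev /= mxE [X in _ + X]mxE [in X in _ + X]mxE eqxx mulr1n mxE.
by congr (_ - _); apply: eq_bigr => i _; rewrite [const_mx _ _ _]mxE mulr1.
Qed.

(** The simplex consists of the points whose extended barycentric coordinates are non-negative, have
    sum 1 and reproduce the point: sign conditions on these functionals. *)
Definition hull_L := coords bary ++ bary_sum :: coords bary_rec.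

Lemma hull_polyh : polyh (hull s) hull_L.
Proof.
move=> x y [w [w0 w1 xE]] xy.
have bx : ev bary x = \row_i w i by rewrite xE baryE.
have b0 i : 0 <= ev bary y ord0 i.
  rewrite -evl_coord; apply: (xy _ _).1; first by rewrite mem_cat mem_coords.
  by rewrite evl_coord bx mxE.
have bsum : \sum_i ev bary y ord0 i = 1.
  apply/eqP; rewrite -subr_eq0 -bary_sumE; apply/eqP.
  apply: (ccell_eq0 xy); first by rewrite mem_cat inE eqxx orbT.
  by rewrite bary_sumE bx -w1 -sumrB big1// => i _; rewrite mxE subrr.
have brec : y = ev bary y *m T.
  apply/eqP; rewrite -subr_eq0 -bary_recE; apply/eqP/rowP => j.
  rewrite [RHS]mxE -evl_coord; apply: (ccell_eq0 xy).
    by rewrite mem_cat inE mem_coords !orbT.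
  by rewrite evl_coord bary_recE bx mulT -xE subrr mxE.
exists (fun i => ev bary y ord0 i); split=> //.
rewrite -mulT (_ : \row_i _ = ev bary y)//.
by apply/rowP => i; rewrite mxE.
Qed.

(** [affine_on] speaks of two points. The induction is on the number [k] of vertices that may carry
    weight; the last one is split off as the end of a segment, the other weights being divided by
    [1 - t]. *)
Lemma affine_on_comb p (f : 'rV[R]_N -> 'rV[R]_p) (w : 'I_(size s) -> R) :
  affine_on (hull s) f -> (forall i, 0 <= w i) -> \sum_i w i = 1 ->
  f (\sum_i w i *: s`_i) = \sum_i w i *: f s`_i.
Proof.
move=> af.
have vert (i : 'I_(size s)) : hull s s`_i.
  exists (fun j => (j == i)%:R); split.
  - by move=> j; rewrite ler0n.
  - by rewrite (bigD1 i)//= eqxx big1 ?addr0// => j /negbTE ->.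
  - by rewrite (bigD1 i)//= eqxx scale1r big1 ?addr0// => j /negbTE ->; rewrite scale0r.
suff H k : forall w : 'I_(size s) -> R, (forall i, 0 <= w i) -> \sum_i w i = 1 ->
    (forall i : 'I_(size s), (k <= i)%N -> w i = 0) ->
    f (\sum_i w i *: s`_i) = \sum_i w i *: f s`_i.
  by move=> w0 w1; apply: (H (size s)) => // i; rewrite leqNgt ltn_ord.
elim: k => [|k IH] {}w w0 w1 wk.
  move: w1; rewrite big1 => [/eqP|i _]; last exact: wk.
  by rewrite eq_sym oner_eq0.
have [ks|ks] := ltnP k (size s); last first.
  by apply: IH => // i ki; have := ltn_ord i; lia.
pose i0 := Ordinal ks; pose t := w i0.
have sumD : \sum_(i | i != i0) w i = 1 - t.
  by have := w1; rewrite (bigD1 i0)//= -/t => h; lra.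
have t1 : t <= 1 by rewrite -subr_ge0 -sumD sumr_ge0.
have [te1|tn1] := eqVneq t 1.
  have w00 i : i != i0 -> w i = 0.
    move=> ii; have /eqP := sumD; rewrite te1 subrr psumr_eq0// => /allP/(_ i).
    by rewrite mem_index_enum ii => /(_ isT)/eqP.
  rewrite (bigD1 i0)//= big1 ?addr0; last by move=> i /w00 ->; rewrite scale0r.
  rewrite (bigD1 i0)//= big1 ?addr0; last by move=> i /w00 ->; rewrite scale0r.
  by rewrite -/t te1 !scale1r.
have t1' : 0 < 1 - t by rewrite subr_gt0 lt_neqAle tn1.
pose w' i := if i == i0 then 0 else w i / (1 - t).
have w'0 i : 0 <= w' i by rewrite /w'; case: ifP => // _; rewrite divr_ge0// ltW.
have w'1 : \sum_i w' i = 1.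
  rewrite (bigD1 i0)//= /w' eqxx add0r.
  rewrite (eq_bigr (fun i => w i / (1 - t))); last by move=> i /negbTE ->.
  by rewrite -mulr_suml sumD divff// gt_eqF.
have w'k (i : 'I_(size s)) : (k <= i)%N -> w' i = 0.
  rewrite /w'; case: eqP => // /eqP ne ki; rewrite wk ?mul0r// ltn_neqAle ki andbT.
  by apply: contra ne => /eqP ki'; apply/eqP/val_inj.
have split q (F : 'I_(size s) -> 'rV[R]_q) :
    \sum_i w i *: F i = t *: F i0 + (1 - t) *: \sum_i w' i *: F i.
  rewrite (bigD1 i0)//=; congr (_ + _).
  rewrite scaler_sumr [RHS](bigD1 i0)//= {1}/w' eqxx scale0r scaler0 add0r.
  apply: eq_bigr => i /negbTE ii; rewrite /w' ii scalerA mulrC divfK// gt_eqF//.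
rewrite !split -IH// af//; last by rewrite w0.
by exists w'.
Qed.

Lemma affine_on_ev p (f : 'rV[R]_N -> 'rV[R]_p) :
  affine_on (hull s) f -> exists a : afm N p, forall x, hull s x -> f x = ev a x.
Proof.
move=> af; exists (acomp bary (\matrix_i f s`_i, 0)) => x [w [w0 w1 ->]].
rewrite affine_on_comb// ev_acomp baryE// /ev /= addr0 mulmx_sum_row.
by apply: eq_bigr => i _; rewrite mxE; congr (_ *: _); apply/rowP => j; rewrite !mxE.
Qed.

End Simplex.

Lemma cover_polyh N (K : seq (seq 'rV[R]_N)) X :
  simplicial_cover K X -> exists L, polyh X L /\
    forall s x y, s \in K -> hull s x -> ccell L x y -> hull s y.
Proof.
move=> [ai XE]; exists (flatten [seq hull_L s | s <- K]).
have key s x y : s \in K -> hull s x -> ccell (flatten [seq hull_L s | s <- K]) x y ->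
    hull s y.
  move=> sK hx xy; apply: (hull_polyh (ai s sK) hx); apply: ccell_sub xy => l ls.
  by apply/flattenP; exists (hull_L s) => //; apply: map_f.
split=> // x y; rewrite XE => -[s /= sK hx] xy; exists s => //.
exact: key xy.
Qed.

Lemma pl_map_PLF N N' (X : set 'rV[R]_N) (Y : set 'rV[R]_N') f :
  pl_map X Y f -> exists L A, PLF X f L A /\ polyh X L.
Proof.
move=> [_ [K [cK af]]]; have [L [pX Ls]] := cover_polyh cK.
have [|ext hext] := @choice _ _ (fun s (a : afm N N') =>
    s \in K -> forall x, hull s x -> f x = ev a x).
  move=> s; have [sK|/negbTE sK] := boolP (s \in K); last first.
    by exists (0, 0).
  have [a ha] := affine_on_ev (cK.1 s sK) (af s sK).
  by exists a.
exists L, [seq ext s | s <- K]; split=> // x.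
rewrite {1}cK.2 => -[s /= sK hx].
exists (ext s); first exact: map_f.
by move=> y _ xy; apply: hext => //; exact: Ls xy.
Qed.


End Affine.

(** * PL invariance of domain *)

Section DomainInvariance.
Variable R : realType.

Lemma slope_delta n (l : afm R n 1) i : slope l (delta_mx 0 i) = l.1 i ord0.
Proof. by rewrite /slope -rowE mxE. Qed.

Lemma slopeD n (l : afm R n 1) u v : slope l (u + v) = slope l u + slope l v.
Proof. by rewrite /slope mulmxDl mxE. Qed.

Lemma slopeZ n (l : afm R n 1) c v : slope l (c *: v) = c * slope l v.
Proof. by rewrite /slope -scalemxAl mxE. Qed.

Lemma slope_exists n (l : afm R n 1) : l.1 != 0 -> exists v, slope l v = 1.
Proof.
move=> /matrix0Pn[i [j lij]]; rewrite ord1 in lij.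
exists ((l.1 i ord0)^-1 *: delta_mx 0 i).
by rewrite slopeZ slope_delta mulVf.
Qed.

Lemma evl_sub n (l : afm R n 1) x y : evl l x = evl l y + slope l (x - y).
Proof. by have := evl_line l y 1 (x - y); rewrite scale1r mul1r addrC subrK. Qed.

Lemma slope_prop n (l0 l : afm R n 1) : l0.1 != 0 ->
  (forall v, slope l0 v = 0 -> slope l v = 0) ->
  exists c, forall v, slope l v = c * slope l0 v.
Proof.
move=> /slope_exists[v0 v01] h; exists (slope l v0) => v.
have := h (v - slope l0 v *: v0).
rewrite -scaleNr !slopeD !slopeZ v01 mulr1 subrr => /(_ erefl).
lra.
Qed.

Lemma generic_point n (L : seq (afm R n 1)) p (r : R) : 0 < r ->
  exists2 y, `|y - p| < r & forall l, l \in L -> l.1 != 0 -> evl l y != 0.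
Proof.
move=> r0; elim: L => [|l L [y yp hy]].
  by exists p => //; rewrite subrr normr0.
have [l0|l0] := eqVneq l.1 0.
  exists y => // m; rewrite inE => /predU1P[->|]; first by rewrite l0 eqxx.
  exact: hy.
have [ly|ly] := eqVneq (evl l y) 0; last first.
  by exists y => // m; rewrite inE => /predU1P[->|/hy].
have [v v1] := slope_exists l0.
have {hy} [d d0 hd] : exists2 d : R, 0 < d & forall z, `|z - y| < d ->
    forall m, m \in L -> m.1 != 0 -> evl m z != 0.
  elim: L hy => [|m L IH] hy; first by exists 1.
  have [|d d0 hd] := IH; first by move=> k kL; apply: hy; rewrite inE kL orbT.
  have [m0|m0] := eqVneq m.1 0.
    exists d => // z zy k; rewrite inE => /predU1P[->|]; first by rewrite m0 eqxx.
    exact: hd.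
  have my : 0 < `|evl m y| by rewrite normr_gt0; apply: hy => //; rewrite inE eqxx.
  have [d' d'0 hd'] := evl_cont m (X := setT) (I : setT y) my.
  exists (Num.min d d'); first by rewrite lt_min d0.
  move=> z; rewrite lt_min => /andP[z1 z2] k; rewrite inE => /predU1P[->|]; last exact: hd.
  move=> _; apply/eqP => mz; have := hd' z I z2.
  have -> : (evl m z : R^o) - evl m y = - (evl m y : R^o) by rewrite mz sub0r.
  by rewrite normrN ltxx.
have mn0 : 0 < Num.min d (r - `|y - p|) by rewrite lt_min d0; lra.
have [s s0 sv] := small_multiple v mn0.
have := sv; rewrite lt_min => /andP[s1 s2].
exists (y + s *: v).
  rewrite addrAC (le_lt_trans (ler_normD _ _))//.
  lra.
move=> m; rewrite inE => /predU1P[->|mL m0].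
  by rewrite evl_line ly add0r v1 mulr1 gt_eqF.
by apply: hd => //; rewrite addrAC subrr add0r.
Qed.

Lemma sign_near n (L : seq (afm R n 1)) y :
  exists2 d : R, 0 < d & forall x, `|x - y| < d -> forall l, l \in L ->
    (0 < evl l y -> 0 < evl l x) /\ (evl l y < 0 -> evl l x < 0).
Proof.
elim: L => [|l L [d d0 hd]]; first by exists 1.
have [ly|ly] := eqVneq (evl l y) 0.
  exists d => // x xy m; rewrite inE => /predU1P[->|]; last exact: hd.
  by rewrite ly ltxx.
have ly' : 0 < `|evl l y| by rewrite normr_gt0.
have /cont_on_realP := evl_cont l (X := setT).
move=> /(_ y I _ ly')[d' d'0 hd'].
exists (Num.min d d'); first by rewrite lt_min d0.
move=> x; rewrite lt_min => /andP[x1 x2] m; rewrite inE => /predU1P[->|]; last exact: hd.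
have /andP[? ?] := hd' x I x2.
split=> h; [move: (gtr0_norm h)|move: (ltr0_norm h)] => h'; lra.
Qed.

Definition nball n (p : 'rV[R]_n) (r : R) : set 'rV[R]_n := [set x | `|x - p| < r].

Definition opp_af n (l : afm R n 1) : afm R n 1 := (- l.1, - l.2).

Lemma evl_opp n (l : afm R n 1) x : evl (opp_af l) x = - evl l x.
Proof. by rewrite /evl /ev /= mulmxN -opprD mxE. Qed.

Lemma slope_opp n (l : afm R n 1) x : slope (opp_af l) x = - slope l x.
Proof. by rewrite /slope /= mulmxN mxE. Qed.

(** At most one wall, the zero set of [l0], passes through [y], so on a small ball the signs of [L]
    are constant on each open side; any point [y'] of the positive side provides the affine
    piece. *)
Lemma half_affine d q (h : 'rV[R]_d -> 'rV[R]_q) L A y (r : R) (l0 : afm R d 1) :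
  0 < r -> PLF (nball y r) h L A -> l0.1 != 0 -> evl l0 y = 0 ->
  (forall l, l \in L -> evl l y = 0 -> exists c, forall v, slope l v = c * slope l0 v) ->
  exists2 r' : R, 0 < r' <= r & exists a, forall x, nball y r' x -> 0 <= evl l0 x ->
    h x = ev a x.
Proof.
move=> r0 pf l00 l0y hL.
have [d0 d00 hd] := sign_near L y.
pose r' := Num.min r d0; have r'0 : 0 < r' by rewrite lt_min r0.
have r'r : r' <= r by rewrite ge_min lexx.
have r'd : r' <= d0 by rewrite ge_min lexx orbT.
exists r'; first by rewrite r'0.
have [v v1] := slope_exists l00.
have [s s0 sv] := small_multiple v r'0.
pose y' := y + s *: v.
have yy' : `|y' - y| < r' by rewrite /y' addrAC subrr add0r.
have [|a aA ha] := pf y'; first exact: lt_le_trans yy' r'r.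
exists a => x xy l0x; apply: ha; first exact: lt_le_trans xy r'r.
move=> l lL; have [ly|ly|ly] := ltgtP (evl l y) 0.
- have [_ /(_ ly) ?] := hd y' (lt_le_trans yy' r'd) l lL.
  have [_ /(_ ly) ?] := hd x (lt_le_trans xy r'd) l lL.
  by split => ?; lra.
- have [/(_ ly) ? _] := hd y' (lt_le_trans yy' r'd) l lL.
  have [/(_ ly) ? _] := hd x (lt_le_trans xy r'd) l lL.
  by split => ?; lra.
- have [c hc] := hL l lL ly.
  have -> : evl l y' = c * s by rewrite /y' evl_line ly add0r hc v1 mulr1 mulrC.
  have -> : evl l x = c * evl l0 x.
    by rewrite (evl_sub l x y) ly add0r hc (evl_sub l0 x y) l0y add0r.
  split.
    by rewrite pmulr_lge0// => ?; rewrite mulr_ge0.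
  by rewrite pmulr_lle0// => ?; rewrite mulr_le0_ge0.
Qed.

(** One of [v] and [- v] points into the half-ball, so a nonzero kernel vector would give two points
    with one image. *)
Lemma half_inj d q (h : 'rV[R]_d -> 'rV[R]_q) y (r : R) (l0 : afm R d 1) a :
  0 < r -> evl l0 y = 0 ->
  (forall x x', nball y r x -> nball y r x' -> h x = h x' -> x = x') ->
  (forall x, nball y r x -> 0 <= evl l0 x -> h x = ev a x) -> row_free a.1.
Proof.
move=> r0 l0y inj ha; apply: inj_row_free => v va0.
wlog sv : v va0 / 0 <= slope l0 v.
  move=> H; have [/H->//|sv] := lerP 0 (slope l0 v).
  apply/eqP; rewrite -oppr_eq0; apply/eqP/H; first by rewrite mulNmx va0 oppr0.
  by rewrite -scaleN1r slopeZ mulN1r oppr_ge0 ltW.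
have [s s0 sv'] := small_multiple v r0.
have yb : nball y r y by rewrite /nball/= subrr normr0.
have y'b : nball y r (y + s *: v) by rewrite /nball/= addrAC subrr add0r.
have := inj _ _ y'b yb; rewrite ha//; last by rewrite evl_line l0y add0r mulr_ge0// ltW.
rewrite ha ?l0y// ev_line va0 scaler0 addr0 => /(_ erefl) /eqP.
rewrite -subr_eq0 addrAC subrr add0r scaler_eq0 gt_eqF//= => /eqP.
by [].
Qed.

(** On the two sides of the wall [h] is given by affine maps [a] and [b] with invertible linear
    parts that agree along the wall. Injectivity makes the sides go to opposite sides of the image
    wall, so the two half-balls together cover a neighborhood of [h y]. *)
Lemma wall_open d (h : 'rV[R]_d -> 'rV[R]_d) L A y (r : R) (l0 : afm R d 1) :
  0 < r -> PLF (nball y r) h L A ->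
  (forall x x', nball y r x -> nball y r x' -> h x = h x' -> x = x') ->
  l0.1 != 0 -> evl l0 y = 0 ->
  (forall l, l \in L -> evl l y = 0 -> exists c, forall v, slope l v = c * slope l0 v) ->
  exists2 e : R, 0 < e & forall z, `|z - h y| < e -> exists2 x, nball y r x & h x = z.
Proof.
move=> r0 pf inj l00 l0y hL.
have [r1 /andP[r10 r1r] [a ha]] := half_affine r0 pf l00 l0y hL.
have [r2 /andP[r20 r2r] [b hb]] : exists2 r' : R, 0 < r' <= r &
    exists a, forall x, nball y r' x -> 0 <= evl (opp_af l0) x -> h x = ev a x.
  apply: half_affine r0 pf _ _ _; first by rewrite oppr_eq0.
    by rewrite evl_opp l0y oppr0.
  move=> l lL /(hL l lL)[c hc]; exists (- c) => v; rewrite slope_opp hc; lra.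
pose rr := Num.min r1 r2; have rr0 : 0 < rr by rewrite lt_min r10.
have rr1 : rr <= r1 by rewrite ge_min lexx.
have rr2 : rr <= r2 by rewrite ge_min lexx orbT.
have {}ha x : nball y rr x -> 0 <= evl l0 x -> h x = ev a x.
  by move=> xy; apply: ha; exact: lt_le_trans xy rr1.
have {}hb x : nball y rr x -> evl l0 x <= 0 -> h x = ev b x.
  by move=> xy ?; apply: hb; [exact: lt_le_trans xy rr2|rewrite evl_opp oppr_ge0].
have [rrr inj'] : rr <= r /\
    forall x x', nball y rr x -> nball y rr x' -> h x = h x' -> x = x'.
  have rrr : rr <= r by exact: le_trans rr1 r1r.
  by split=> // x x' xy x'y; apply: inj; exact: lt_le_trans rrr.
have ua : a.1 \in unitmx by rewrite -row_free_unit; exact: half_inj rr0 l0y inj' ha.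
have ub : b.1 \in unitmx.
  rewrite -row_free_unit; apply: (half_inj (l0 := opp_af l0) rr0 _ inj').
    by rewrite evl_opp l0y oppr0.
  by move=> x xy; rewrite evl_opp oppr_ge0; exact: hb.
have yb : nball y rr y by rewrite /nball/= subrr normr0.
have hya : h y = ev a y by apply: ha => //; rewrite l0y.
have hyb : h y = ev b y by apply: hb => //; rewrite l0y.
have small v : exists2 s : R, 0 < s & nball y rr (y + s *: v).
  have [s s0 sv] := small_multiple v rr0; exists s => //.
  by rewrite /nball/= addrAC subrr add0r.
(* The side of the image wall to which [b] sends a vector, measured through the inverse of the
   linear part of [a]. It kills the wall directions, hence is a multiple [c] of [l0]. *)
pose l' : afm R d 1 := (b.1 *m invmx a.1 *m l0.1, 0).
have l'E v : slope l' v = slope l0 (v *m b.1 *m invmx a.1) by rewrite /slope /= !mulmxA.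
have [c hc] : exists c, forall v, slope l' v = c * slope l0 v.
  apply: slope_prop l00 _ => v lv.
  have [s s0 sv] := small v.
  have l0s : evl l0 (y + s *: v) = 0 by rewrite evl_line l0y lv mulr0 addr0.
  have := ha _ sv; rewrite l0s lexx (hb _ sv) ?l0s// => /(_ isT).
  rewrite !ev_line -hya -hyb => /addrI/(scalerI (lt0r_neq0 s0)) e.
  by rewrite l'E e mulmxK.
(* Otherwise [h] folds along the wall: a point on the negative side and the point in direction [w]
   on the non-negative side would have the same image. *)
have c0 : 0 < c.
  rewrite ltNge; apply/negP => c0.
  have [v v1] := slope_exists l00.
  have [s s0 sv] := small (- v); pose w := (- v) *m b.1 *m invmx a.1.
  have [t t0 tw] := small w.
  pose q := Num.min s t; have q0 : 0 < q by rewrite lt_min s0.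
  have shrink (s' : R) u : q <= s' -> nball y rr (y + s' *: u) -> nball y rr (y + q *: u).
    have nb u' : nball y rr (y + u') <-> `|u'| < rr.
      by rewrite /nball/= addrAC subrr add0r.
    move=> qs /nb h1; apply/nb; apply: le_lt_trans h1; rewrite !normrZ ler_wpM2r// !gtr0_norm//.
    exact: lt_le_trans q0 qs.
  have qv : nball y rr (y + q *: - v) by apply: shrink sv; rewrite ge_min lexx.
  have qw : nball y rr (y + q *: w) by apply: shrink tw; rewrite ge_min lexx orbT.
  have sNv : slope l0 (- v) = - 1 by rewrite -scaleN1r slopeZ v1 mulr1.
  have e1 : evl l0 (y + q *: - v) = - q by rewrite evl_line l0y sNv add0r mulrN1.
  have e2 : evl l0 (y + q *: w) = q * (- c).
    by rewrite evl_line l0y add0r -l'E hc sNv mulrN1.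
  have e2' : 0 <= evl l0 (y + q *: w) by rewrite e2 mulr_ge0// ?oppr_ge0// ltW.
  have : y + q *: - v = y + q *: w.
    apply: inj' => //; rewrite (ha _ qw e2') (hb _ qv) ?e1 ?oppr_le0 ?(ltW q0)//.
    by rewrite !ev_line -hya -hyb /w mulmxKV.
  by move/(congr1 (evl l0)) => e3; rewrite e3 in e1; lra.
have [C1 C10 hC1] := mulmx_lip (invmx a.1).
have [C2 C20 hC2] := mulmx_lip (invmx b.1).
have CC : 0 < 1 + C1 + C2 by lra.
exists (rr / (1 + C1 + C2)); first by rewrite divr_gt0.
move=> z; rewrite ltr_pdivlMr// => zy.
pose eta := z - h y; have n0 := normr_ge0 (z - h y).
have [me|me] := lerP 0 (slope l0 (eta *m invmx a.1)).
  have xb : nball y rr (y + eta *m invmx a.1).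
    rewrite /nball/= addrAC subrr add0r (le_lt_trans (hC1 _))// /eta.
    by apply: le_lt_trans zy; rewrite mulrC ler_wpM2l//; lra.
  exists (y + eta *m invmx a.1); first exact: lt_le_trans xb rrr.
  rewrite ha//; last by rewrite -[_ *m _]scale1r evl_line l0y add0r mul1r.
  by rewrite -[_ *m invmx _]scale1r ev_line -hya scale1r mulmxKV// /eta addrC subrK.
have xb : nball y rr (y + eta *m invmx b.1).
  rewrite /nball/= addrAC subrr add0r (le_lt_trans (hC2 _))// /eta.
  by apply: le_lt_trans zy; rewrite mulrC ler_wpM2l//; lra.
exists (y + eta *m invmx b.1); first exact: lt_le_trans xb rrr.
rewrite hb//; last first.
  rewrite -[_ *m _]scale1r evl_line l0y add0r mul1r.
  have := hc (eta *m invmx b.1); rewrite l'E mulmxKV// => e.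
  by move: me; rewrite e pmulr_rlt0// => /ltW.
by rewrite -[_ *m invmx _]scale1r ev_line -hyb scale1r mulmxKV// /eta addrC subrK.
Qed.

End DomainInvariance.

Section DomainInvariance2.
Variable R : realType.

Lemma through_point d (z0 : 'rV[R]_d) (c : 'cV[R]_d) :
  evl ((c, - (z0 *m c)) : afm R d 1) z0 = 0.
Proof. by rewrite /evl /ev /= subrr mxE. Qed.

(** A codimension 2 flat and a point span at most a hyperplane. *)
Lemma bad_functional d (l1 l2 : afm R d 1) (a : afm R d d) (z0 : 'rV[R]_d) :
  l1.1 != 0 -> (exists2 v, slope l1 v = 0 & slope l2 v != 0) ->
  exists m : afm R d 1, [/\ m.1 != 0, evl m z0 = 0 &
    forall x, evl l1 x = 0 -> evl l2 x = 0 -> evl m (ev a x) = 0].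
Proof.
move=> l10 [v v1 v2].
have [[x0 [x1 x2]]|nF] := pselect (exists x, evl l1 x = 0 /\ evl l2 x = 0); last first.
  exists (l1.1, - (z0 *m l1.1)); split=> //; first exact: through_point.
  by move=> x x1 x2; case: nF; exists x.
pose K := row_mx l1.1 l2.1.
have rK : \rank K = 2%N.
  rewrite -mxrank_tr tr_row_mx; apply/eqP.
  change (row_free (col_mx l1.1^T l2.1^T)); apply: inj_row_free => u.
  rewrite -[u]hsubmxK mul_row_col => uK.
  have uw w : lsubmx u ord0 ord0 * slope l1 w + rsubmx u ord0 ord0 * slope l2 w = 0.
    have aux (c : 'M[R]_1) (l : afm R d 1) :
        (c *m l.1^T *m w^T) ord0 ord0 = c ord0 ord0 * slope l w.
      by rewrite -mulmxA -trmx_mul mxE big_ord1 [_^T _ _]mxE.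
    rewrite -!aux; have := congr1 (fun A : 'rV_d => (A *m w^T) ord0 ord0) uK.
    by rewrite /= mulmxDl mul0mx mxE [RHS]mxE.
  have u2 : rsubmx u ord0 ord0 = 0.
    by have /eqP := uw v; rewrite v1 mulr0 add0r mulf_eq0 (negbTE v2) orbF => /eqP.
  have [w w1] := slope_exists l10.
  have u1 : lsubmx u ord0 ord0 = 0 by have := uw w; rewrite w1 u2 mul0r addr0 mulr1.
  by rewrite -row_mx0; congr row_mx; apply/rowP => i; rewrite ord1 ?u1 ?u2 [RHS]mxE.
pose e0 := ev a x0 - z0.
pose M := col_mx (kermx K *m a.1) e0.
have rM : (\rank M < d)%N.
  have d2 : (2 <= d)%N by rewrite -rK rank_leq_row.
  have h1 : (\rank (kermx K *m a.1)%R <= d - 2)%N.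
    by rewrite (leq_trans (mxrankM_maxl _ _))// mxrank_ker rK.
  have h2 : (\rank e0 <= 1)%N by apply: rank_leq_row.
  have : (\rank M <= \rank (kermx K *m a.1) + \rank e0)%N.
    by rewrite -addsmxE; exact: mxrank_adds_leqif.
  lia.
have cM : cokermx M != 0 by rewrite -mxrank_eq0 mxrank_coker subn_eq0 -ltnNge.
have [i [j cij]] := matrix0Pn _ cM.
pose c := col j (cokermx M).
have Mc : M *m c = 0 by rewrite /c colE mulmxA mulmx_coker mul0mx.
have /eq_col_mx[Mc1 Mc2] : col_mx (kermx K *m a.1 *m c) (e0 *m c) = col_mx 0 0.
  by rewrite -mul_col_mx Mc col_mx0.
exists (c, - (z0 *m c)); split.
- apply/matrix0Pn; exists i, ord0; rewrite mxE; exact: cij.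
- exact: through_point.
- move=> x lx1 lx2; rewrite /evl /ev /= -mulmxBl.
  have -> : x *m a.1 + a.2 - z0 = (x - x0) *m a.1 + (ev a x0 - z0).
    by rewrite mulmxBl /ev addrA addrA subrK.
  rewrite mulmxDl Mc2 addr0.
  have /submxP[D ->] : (x - x0 <= kermx K)%MS.
    apply/sub_kermxP; rewrite mul_mx_row -row_mx0; congr row_mx.
      apply/rowP => k; rewrite ord1 [RHS]mxE -[LHS]/(slope l1 (x - x0)).
      by have := evl_sub l1 x x0; rewrite lx1 x1 add0r.
    apply/rowP => k; rewrite ord1 [RHS]mxE -[LHS]/(slope l2 (x - x0)).
    by have := evl_sub l2 x x0; rewrite lx2 x2 add0r.
  by rewrite -[D *m _ *m _]mulmxA -mulmxA Mc1 mulmx0 mxE.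
Qed.

Lemma nball_compact n (p : 'rV[R]_n) (r : R) : compact [set x | `|x - p| <= r].
Proof.
apply: bounded_closed_compact.
  exists (r + `|p|); split; first exact: num_real.
  move=> M hM x xp; rewrite /= -[x](subrK p) (le_trans (ler_normD _ _))//.
  by rewrite /= in xp; lra.
apply: rclosed_closed; apply: (@rclosed_le _ _ _ (fun x => `|x - p|)).
apply: cont_on_norm; apply: cont_on_sub_fun; [exact: cont_on_id|exact: cont_on_cst].
Qed.

(** A frontier point of the image can be reached along a segment that avoids the image of
    the codimension 2 skeleton; the map is open at a preimage of such a point. *)
Lemma PL_invariance_of_domain d (h : 'rV[R]_d -> 'rV[R]_d) L A p (r : R) :
  0 < r -> PLF (nball p r) h L A ->
  (forall x x', nball p r x -> nball p r x' -> h x = h x' -> x = x') ->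
  exists2 e : R, 0 < e & forall z, `|z - h p| < e -> exists2 x, nball p r x & h x = z.
Proof.
case: d h L A p => [|d] h L A p r0 pf inj.
  exists 1 => // z _; exists p; first by rewrite /nball/= subrr normr0.
  by apply/rowP => -[].
pose B := [set x : 'rV[R]_d.+1 | `|x - p| <= r / 2].
have Br : B `<=` nball p r by move=> x; rewrite /B /nball/=; lra.
have cB : compact B by exact: nball_compact.
have ch : cont_on (nball p r) h by exact: PLF_cont pf.
have cnorm (X : set 'rV[R]_d.+1) q : cont_on X (fun x => `|x - q| : R^o).
  apply: cont_on_norm; apply: cont_on_sub_fun; [exact: cont_on_id|exact: cont_on_cst].
pose Sp := B `&` [set x | r / 2 <= `|x - p|].
have cSp : compact Sp.
  by apply: compact_rclosed => //; exact: (@rclosed_ge _ _ _ (fun x => `|x - p|)).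
have pr : nball p r p by rewrite /nball/= subrr normr0.
(* The image of the sphere of radius [r / 2] keeps the distance [be] from [h p]; inside the ball of
   radius [be / 2] preimages in [B] therefore avoid the sphere. *)
have [be be0 hbe] : exists2 b : R, 0 < b & forall x, Sp x -> b <= `|h x - h p|.
  apply: compact_pos_min => //.
    apply: cont_on_norm; apply: cont_on_sub_fun; last exact: cont_on_cst.
    by apply: cont_on_sub ch => x [/Br].
  move=> x [Bx xp]; rewrite normr_gt0 subr_eq0; apply/eqP => hxp.
  by move: xp; rewrite /= (inj _ _ (Br _ Bx) pr hxp) subrr normr0; lra.
exists (be / 2); first lra.
move=> z0 z0p; apply: contrapT => nz0.
have {}nz0 x : B x -> h x <> z0 by move=> Bx hx; apply: nz0; exists x => //; exact: Br.
pose prop (l1 l2 : afm R d.+1 1) := exists c, forall v, slope l2 v = c * slope l1 v.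
have nprop (l1 l2 : afm R d.+1 1) : l1.1 != 0 -> ~ prop l1 l2 ->
    exists2 v, slope l1 v = 0 & slope l2 v != 0.
  move=> l10 np; apply: contrapT => nv; apply: np; apply: slope_prop => // v v1.
  by apply/eqP; apply: contrapT => /negP v2; apply: nv; exists v.
(* For two non-proportional functionals and an affine piece, [mu] gives a hyperplane through [z0]
   that contains the image of their common zero set under that piece. *)
have [|mu hmu] := @choice _ _ (fun (t : afm R d.+1 1 * afm R d.+1 1 * afm R d.+1 d.+1)
    (m : afm R d.+1 1) => t.1.1.1 != 0 -> ~ prop t.1.1 t.1.2 ->
    [/\ m.1 != 0, evl m z0 = 0 &
    forall x, evl t.1.1 x = 0 -> evl t.1.2 x = 0 -> evl m (ev t.2 x) = 0]).
  move=> [[l1 l2] a] /=.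
  have [h0|nh] := pselect (l1.1 != 0 /\ ~ prop l1 l2).
    by have [m hm] := bad_functional a z0 h0.1 (nprop _ _ h0.1 h0.2); exists m.
  by exists (0, 0) => h1 h2; case: nh.
pose ms := [seq mu (ll.1, ll.2, a) | ll <- [seq (l1, l2) | l1 <- L, l2 <- L], a <- A].
have some_l y : exists l0 : afm R d.+1 1, l0.1 != 0 /\ evl l0 y = 0.
  exists (delta_mx ord0 ord0, - (y *m delta_mx ord0 ord0)); split.
    by apply/matrix0Pn; exists ord0, ord0; rewrite mxE eqxx oner_eq0.
  exact: through_point.
have be2 : 0 < be / 2 by lra.
have [d1 d10 hd1] := ch p pr _ be2.
have mn0 : 0 < Num.min d1 (r / 2) by rewrite lt_min d10/=; lra.
have [y1 y1p gy1] := generic_point L p mn0.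
move: y1p; rewrite lt_min => /andP[y1d y1r].
have pf_small y q : q + `|y - p| <= r -> PLF (nball y q) h L A /\
    forall x x', nball y q x -> nball y q x' -> h x = h x' -> x = x'.
  move=> qr; have sub : nball y q `<=` nball p r.
    move=> x; rewrite /nball/= => xy; rewrite -(subrK y x) -addrA.
    by rewrite (le_lt_trans (ler_normD _ _))//; lra.
  by split=> [|x x' /sub xx /sub xx']; [exact: PLF_sub pf|exact: inj].
pose q1 := r / 2 - `|y1 - p|; have q10 : 0 < q1 by rewrite /q1; lra.
have [pf1 inj1] := @pf_small y1 q1 ltac:(rewrite /q1; lra).
have [l1 [l10 l1y]] := some_l y1.
have [|e1 e10 he1] := wall_open q10 pf1 inj1 l10 l1y.
  move=> l lL ly; exists 0 => v; rewrite mul0r.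
  have [l00|l00] := eqVneq l.1 0; first by rewrite /slope l00 mulmx0 mxE.
  by have := gy1 l lL l00; rewrite ly eqxx.
have hy1 : `|h y1 - h p| < be / 2 by apply: hd1 => //; rewrite /nball/=; lra.
pose e2 := Num.min e1 (be / 2 - `|h y1 - h p|).
have e20 : 0 < e2 by rewrite lt_min e10/=; lra.
(* [z1] is in the image, because [h] is open at the generic point [y1], and it is off the
   hyperplanes [mu]. As these pass through [z0], the segment from [z0] to [z1] meets them at [z0]
   only. *)
have [z1 z1y gz1] := generic_point ms (h y1) e20.
move: z1y; rewrite lt_min => /andP[z1e z1b].
have [x1 x1b hx1] := he1 z1 z1e.
have Bx1 : B x1.
  move: x1b; rewrite /nball/B/q1/= => x1b; rewrite -(subrK y1 x1) -addrA.
  by rewrite (le_trans (ler_normD _ _))//; lra.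
have z1p : `|z1 - h p| < be / 2.
  by rewrite -(subrK (h y1) z1) -addrA (le_lt_trans (ler_normD _ _))//; lra.
pose seg (s : R) := z0 + s *: (z1 - z0).
pose T := [set s : R | 0 <= s <= 1 /\ exists2 x, B x & h x = seg s].
have T_one : T 1.
  split; first by rewrite ler01 lexx.
  by exists x1 => //; rewrite /seg scale1r addrC subrK.
have hT : has_inf T by split; [exists 1|exists 0 => s [/andP[]]].
(* The parameter at which the segment, coming from [z0], first meets the image; openness at a
   preimage of that point will produce an earlier one. *)
pose si := inf T.
have si0 : 0 <= si by apply: lb_le_inf; [exists 1|move=> s [/andP[]]].
have si1 : si <= 1 by apply: ge_inf => //; exact: hT.2.
have chB : rclosed setT [set h x | x in B].
  by apply: compact_is_rclosed; apply: compact_image cB; exact: cont_on_sub ch.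
pose nz := 1 + `|z1 - z0|; have nz00 : 0 < nz.
  by rewrite /nz; have := normr_ge0 (z1 - z0); lra.
have seg_lip s t : `|seg s - seg t| <= `|s - t| * nz.
  rewrite /seg opprD addrACA subrr add0r -scalerBl normrZ ler_wpM2l// /nz.
  by rewrite lerDr.
have [xs Bxs hxs] : exists2 x, B x & h x = seg si.
  apply: contrapT => nx.
  have nh : ~ [set h x | x in B] (seg si) by move=> [x Bx hx]; apply: nx; exists x.
  have [e e0 he] := chB _ I nh.
  have en : 0 < e / nz by rewrite divr_gt0.
  have [s Ts hs] := inf_adherent en hT; rewrite -/si in hs.
  have sis : si <= s by apply: ge_inf => //; exact: hT.2.
  have [_ [x Bx hx]] := Ts.
  apply: (he (h x)) => //; last by exists x.
  rewrite hx (le_lt_trans (seg_lip _ _))// -ltr_pdivlMr// ger0_norm; lra.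
have si_gt0 : 0 < si.
  rewrite lt_neqAle si0 andbT; apply/eqP => si00.
  by apply: (nz0 xs Bxs); rewrite hxs /seg -si00 scale0r addr0.
have segp : `|seg si - h p| < be / 2.
  have -> : seg si - h p = (1 - si) *: (z0 - h p) + si *: (z1 - h p).
    by rewrite /seg; apply/rowP => i; rewrite !mxE; ring.
  rewrite (le_lt_trans (ler_normD _ _))// !normrZ !ger0_norm//; last by lra.
  have -> : be / 2 = (1 - si) * (be / 2) + si * (be / 2) by lra.
  rewrite ler_ltD//; first by rewrite ler_wpM2l//; lra.
  by rewrite ltr_pM2l.
have xsp : `|xs - p| < r / 2.
  rewrite ltNge; apply/negP => xsp.
  by have := hbe xs (conj Bxs xsp); rewrite hxs; lra.
pose q := r / 2 - `|xs - p|; have q0 : 0 < q by rewrite /q; lra.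
have [pfs injs] := @pf_small xs q ltac:(rewrite /q; lra).
(* Two non-proportional functionals vanishing at [xs] would put [seg si] on a hyperplane [mu], hence
   also [z1], because [si > 0]. So at most one wall passes through [xs]. *)
have [l0 [l00 l0xs hl0]] : exists l0 : afm R d.+1 1, [/\ l0.1 != 0, evl l0 xs = 0 &
    forall l, l \in L -> evl l xs = 0 -> prop l0 l].
  have zero (l m : afm R d.+1 1) : m.1 = 0 -> prop l m.
    by move=> m0; exists 0 => v; rewrite mul0r /slope m0 mulmx0 mxE.
  have [[l0 [l0L l00 l0x]]|nl] :=
      pselect (exists l0, [/\ l0 \in L, l0.1 != 0 & evl l0 xs = 0]).
    exists l0; split=> // l lL lx; apply: contrapT => np.
    have [a aA ha] := pf xs (Br _ Bxs).
    have [m0 mz0 mF] := hmu (l0, l, a) l00 np.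
    have mms : mu (l0, l, a) \in ms.
      by apply: (allpairs_f (fun ll a => mu (ll.1, ll.2, a)) (x := (l0, l))) =>
        //; exact: allpairs_f.
    have := mF xs l0x lx; rewrite /= -(ha xs (Br _ Bxs) (@ccell_refl _ _ _ _)).
    rewrite hxs /seg evl_line mz0 add0r.
    have := evl_sub (mu (l0, l, a)) z1 z0; rewrite mz0 add0r => <- /eqP.
    by rewrite mulf_eq0 gt_eqF//= (negbTE (gz1 _ mms m0)).
    have [k0 [k00 k0x]] := some_l xs; exists k0; split=> // l lL lx.
  apply: zero; apply/eqP; apply: contrapT => /negP lN.
  by apply: nl; exists l.
have [e e0 he] := wall_open q0 pfs injs l00 l0xs hl0.
pose s := si - Num.min si (e / (2 * nz)).
have mm : 0 < Num.min si (e / (2 * nz)) by rewrite lt_min si_gt0 divr_gt0// mulr_gt0.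
have ssi : s < si by rewrite /s; lra.
have s0 : 0 <= s by rewrite /s subr_ge0 ge_min lexx.
have [|x xb hx] := he (seg s).
  rewrite hxs (le_lt_trans (seg_lip _ _))// ltr0_norm; last by lra.
  have : Num.min si (e / (2 * nz)) <= e / (2 * nz) by rewrite ge_min lexx orbT.
  rewrite ler_pdivlMr ?mulr_gt0// /s; set q' := Num.min _ _; nra.
have : si <= s.
  apply: ge_inf; first exact: hT.2.
  split; first by apply/andP; split=> //; lra.
  exists x => //; move: xb; rewrite /nball/B/q/= => xb; rewrite -(subrK xs x) -addrA.
  by rewrite (le_trans (ler_normD _ _))//; lra.
lra.
Qed.

(** No wall passes through a generic point, so [h] is affine at least on a half-ball there, with
    injective linear part; its rank gives the inequality. *)
Lemma PL_invariance_of_dim d e (h : 'rV[R]_d -> 'rV[R]_e) L A p (r : R) :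
  0 < r -> PLF (nball p r) h L A ->
  (forall x x', nball p r x -> nball p r x' -> h x = h x' -> x = x') -> (d <= e)%N.
Proof.
case: d h L A p => // d h L A p r0 pf inj.
have [y yp gy] := generic_point L p r0.
have q0 : 0 < r - `|y - p| by lra.
have sub : nball y (r - `|y - p|) `<=` nball p r.
  move=> x; rewrite /nball/= => xy; rewrite -(subrK y x) -addrA.
  by rewrite (le_lt_trans (ler_normD _ _))//; lra.
pose l0 : afm R d.+1 1 := (delta_mx ord0 ord0, - (y *m delta_mx ord0 ord0)).
have l00 : l0.1 != 0 by apply/matrix0Pn; exists ord0, ord0; rewrite mxE eqxx oner_eq0.
have l0y : evl l0 y = 0 by exact: through_point.
have [|r' /andP[r'0 r'r] [a ha]] := half_affine q0 (PLF_sub sub pf) l00 l0y.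
  move=> l lL ly; exists 0 => v; rewrite mul0r.
  have [l00'|l00'] := eqVneq l.1 0; first by rewrite /slope l00' mulmx0 mxE.
  by have := gy l lL l00'; rewrite ly eqxx.
have inj' x x' : nball y r' x -> nball y r' x' -> h x = h x' -> x = x'.
  by move=> xy x'y; apply: inj; apply: sub; exact: lt_le_trans r'r.
by have := half_inj r'0 l0y inj' ha; rewrite /row_free => /eqP <-; exact: rank_leq_col.
Qed.

End DomainInvariance2.

(** * Charts of PL manifolds with a collar *)

Section LocalCharts.
Variable R : realType.

Lemma polyh_closed n (X : set 'rV[R]_n) L : polyh X L -> closed X.
Proof.
move=> pX; apply: rclosed_closed => x _ nX.
have [d d0 hd] := ccell_near L x; exists d => // y _ yx Xy.
by apply: nX; apply: (pX y) => //; exact: hd.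
Qed.

Lemma compact_polyhedron_compact N (X : set 'rV[R]_N) :
  compact_polyhedron X -> compact X.
Proof.
move=> [K cK]; have [L [pX _]] := cover_polyh cK.
apply: bounded_closed_compact; last exact: polyh_closed pX.
pose M (s : seq 'rV[R]_N) := \sum_(i < size s) `|s`_i|.
have M0 s : 0 <= M s by rewrite sumr_ge0.
exists (\sum_(s <- K) M s); split; first exact: num_real.
move=> r hr x; rewrite cK.2 => -[s /= sK [w [w0 w1 ->]]].
apply: ltW; apply: le_lt_trans hr.
apply: (@le_trans _ _ (M s)); last first.
  by rewrite (big_rem s)//= lerDl sumr_ge0.
rewrite (le_trans (ler_norm_sum _ _ _))// ler_sum// => i _.
rewrite normrZ ger0_norm// ler_piMl//.
by rewrite -w1 (bigD1 i)//= lerDl sumr_ge0.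
Qed.

Definition coord_fun n (i : 'I_n) (s c : R) : afm R n 1 :=
  (s *: delta_mx i ord0, const_mx c).

Lemma coord_funE n (i : 'I_n) s c z : evl (coord_fun i s c) z = s * z ord0 i + c.
Proof.
rewrite /evl /ev /= mxE -scalemxAr mxE -colE mxE; congr (_ + _).
by rewrite mxE.
Qed.

Lemma slope_coord_fun n (i : 'I_n) s c v : slope (coord_fun i s c) v = s * v ord0 i.
Proof. by rewrite /slope /= -scalemxAr mxE -colE mxE. Qed.

Definition box_L n (p : 'rV[R]_n) (r : R) : seq (afm R n 1) :=
  [seq coord_fun i 1 (- p ord0 i - r) | i <- enum 'I_n] ++
  [seq coord_fun i (- 1) (p ord0 i - r) | i <- enum 'I_n].

Lemma box_polyh n (p : 'rV[R]_n) (r : R) :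
  polyh [set z | forall i, `|z ord0 i - p ord0 i| <= r] (box_L p r).
Proof.
move=> x y xb xy i; have := xb i; rewrite !ler_norml => /andP[h1 h2].
have [_] := xy (coord_fun i 1 (- p ord0 i - r))
  ltac:(by rewrite mem_cat; apply/orP; left; apply: map_f; rewrite mem_enum).
rewrite !coord_funE => h3.
have [_] := xy (coord_fun i (- 1) (p ord0 i - r))
  ltac:(by rewrite mem_cat; apply/orP; right; apply: map_f; rewrite mem_enum).
rewrite !coord_funE => h4; apply/andP.
have {}h3 := h3 ltac:(lra); have {}h4 := h4 ltac:(lra).
by split; lra.
Qed.

Lemma nbhd_open_cube d (t : 'rV[R]_d) (e : R) :
  0 < e -> (forall z, `|z - t| < e -> cube z) -> open_cube t.
Proof.
move=> e0 h i.
have he (s : R) : `|s| < e -> 0 <= t ord0 i + s <= 1.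
  move=> se; have := h (t + s *: delta_mx 0 i) _ i; rewrite !mxE !eqxx mulr1; apply.
  rewrite addrAC subrr add0r; apply/norm_rV_lt => // j; rewrite !mxE eqxx /=.
  by case: eqP => _; rewrite ?mulr1 ?mulr0 ?normr0.
have /andP[_ h1] := he (e / 2) ltac:(rewrite gtr0_norm; lra).
have /andP[h2 _] := he (- (e / 2)) ltac:(rewrite normrN gtr0_norm; lra).
by apply/andP; split; lra.
Qed.

Lemma open_cube_nbhd d (t : 'rV[R]_d) : open_cube t ->
  exists2 e : R, 0 < e & forall z, `|z - t| < e -> open_cube z.
Proof.
move=> ot; have [||e e0 he] := @fin_min_pos R 'I_d
    (fun i e => e <= t ord0 i /\ e <= 1 - t ord0 i).
- move=> i; have /andP[t0 t1] := ot i.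
  exists (Num.min (t ord0 i) (1 - t ord0 i)); first by rewrite lt_min t0 subr_gt0.
  by split; rewrite ge_min lexx ?orbT.
- by move=> i e e' e'0 ee' [h1 h2]; split; exact: le_trans ee' _.
exists e => // z zt i; have [h1 h2] := he i.
have := le_lt_trans (norm_rV_coord (z - t) i) zt; rewrite !mxE ltr_norml => /andP[? ?].
by apply/andP; split; lra.
Qed.

Lemma open_cube_sub d (t : 'rV[R]_d) : open_cube t -> cube t.
Proof. by move=> ot i; have /andP[h1 h2] := ot i; rewrite !ltW. Qed.

Lemma fin_argmin (I : finType) (P : pred I) (F : I -> R) (i0 : I) :
  P i0 -> exists i, P i /\ forall j, P j -> F i <= F j.
Proof.
by move=> Pi0; case: (Order.TotalTheory.arg_minP F Pi0) => i Pi hi; exists i.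
Qed.

(** [dl] is the distance to the boundary of the cube, near [x'], along the inward
    direction [nu]. *)
Record cube_depth_spec d (x' nu : 'rV[R]_d) (dl : 'rV[R]_d -> R) (rho : R) : Prop := {
  cd_rho : 0 < rho;
  cd_nu : `|nu| <= 1;
  cd_cube : forall z, `|z - x'| < rho -> (cube z <-> 0 <= dl z);
  cd_open : forall z, `|z - x'| < rho -> (open_cube z <-> 0 < dl z);
  cd_lip : forall z z', `|dl z - dl z'| <= `|z - z'|;
  cd_shift : forall z s, dl z <= 0 \/ ~ open_cube x' -> dl (z + s *: nu) = dl z + s;
  cd_pl : exists L A, PLF setT (fun z => dl z *: nu) L A;
  cd_act : ~ open_cube x' -> exists i0 : 'I_d, nu ord0 i0 * nu ord0 i0 = 1
}.

(** Coordinates equal to 0 or 1 at [x'] are active. [dl] is the least signed distance to an active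
    face and [nu] the sum of the inward normals of these faces, so moving along [nu] changes all the
    distances, hence their minimum, at unit rate. *)
Lemma cube_depth d (x' : 'rV[R]_d) : cube x' ->
  exists nu dl rho, cube_depth_spec x' nu dl rho.
Proof.
move=> cx.
pose act i := (x' ord0 i == 0) || (x' ord0 i == 1).
have [||r r0 hr] := @fin_min_pos R 'I_d
    (fun i e => ~~ act i -> e <= x' ord0 i /\ e <= 1 - x' ord0 i).
- move=> i; have [ai|] := boolP (act i); first by exists 1.
  rewrite negb_or => /andP[n0 n1]; have /andP[h0 h1] := cx i.
  have h0' : 0 < x' ord0 i by rewrite lt_neqAle eq_sym n0.
  have h1' : 0 < 1 - x' ord0 i by rewrite subr_gt0 lt_neqAle n1.
  exists (Num.min (x' ord0 i) (1 - x' ord0 i)); first by rewrite lt_min h0'.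
  by move=> _; split; rewrite ge_min lexx ?orbT.
- by move=> i e e' e'0 ee' h /h[h1 h2]; split; exact: le_trans ee' _.
have co z i : `|z - x'| < r -> `|z ord0 i - x' ord0 i| < r.
  by move=> zx; have := le_lt_trans (norm_rV_coord (z - x') i) zx; rewrite !mxE.
have [/existsP[i0 ai0]|] := boolP [exists i, act i]; last first.
  rewrite negb_exists => /forallP na.
  have oz z : `|z - x'| < r -> open_cube z.
    move=> zx i; have [h1 h2] := hr i (na i).
    by have := co z i zx; rewrite ltr_norml => /andP[? ?]; apply/andP; split; lra.
  (* No active face: the depth is constantly 1, and the shift property holds vacuously. *)
  exists 0, (fun=> 1), r; split=> //.
  - by rewrite normr0.
  - by move=> z /oz/open_cube_sub.
  - by move=> z /oz.
  - by move=> z z'; rewrite subrr normr0.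
  - by move=> z s [|[]]; [rewrite ler10|apply: oz; rewrite subrr normr0].
  - exists [::], [:: (0, 0)] => z _; exists (0, 0); rewrite ?inE// => y _ _.
    by rewrite scaler0 /ev /= mulmx0 addr0.
  - by case; apply: oz; rewrite subrr normr0.
pose sg i : R := if x' ord0 i == 0 then 1 else if x' ord0 i == 1 then - 1 else 0.
pose cc i : R := if x' ord0 i == 0 then 0 else 1.
pose sl i (z : 'rV[R]_d) : R := sg i * z ord0 i + cc i.
have sgP i : act i -> sg i * sg i = 1.
  by rewrite /act /sg; case: eqP => _ /=; rewrite ?mulr1// => ->; rewrite mulrNN mulr1.
have slP i z : act i -> (x' ord0 i = 0 /\ sl i z = z ord0 i) \/
    (x' ord0 i = 1 /\ sl i z = 1 - z ord0 i).
  rewrite /act /sl /sg /cc; case: eqP => [->|_ /=]; first by left; rewrite mul1r addr0.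
  by move=> /eqP ->; right; rewrite eqxx mulN1r addrC.
have [|am ham] := @choice _ _ (fun (z : 'rV[R]_d) i =>
    act i /\ forall j, act j -> sl i z <= sl j z).
  by move=> z; exact: (@fin_argmin _ act (fun i => sl i z) i0).
pose dl z := sl (am z) z.
have dlP z i : act i -> (forall j, act j -> sl i z <= sl j z) -> dl z = sl i z.
  move=> ai hi; have [a1 a2] := ham z.
  by apply/eqP; rewrite eq_le a2// hi.
pose nu : 'rV[R]_d := \row_i sg i.
(* The bound 1 keeps an active coordinate away from the opposite face. *)
pose rho := Num.min r 1.
have slz i z : act i -> `|z - x'| < rho -> (0 <= z ord0 i <= 1 <-> 0 <= sl i z) /\
    (0 < z ord0 i < 1 <-> 0 < sl i z).
  rewrite lt_min => ai /andP[_ zx].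
  have := le_lt_trans (norm_rV_coord (z - x') i) zx; rewrite !mxE ltr_norml => /andP[? ?].
  case: (slP i z ai) => -[xi ->]; split; split=> h;
    try (case/andP: h => ? ?); try (apply/andP; split); lra.
have nz i z : ~~ act i -> `|z - x'| < rho -> 0 < z ord0 i < 1.
  rewrite lt_min => nai /andP[zx _]; have [? ?] := hr i nai.
  by have := co z i zx; rewrite ltr_norml => /andP[? ?]; apply/andP; split; lra.
have slx i : act i -> sl i x' = 0.
  by move=> /(slP i x')[] [-> ->]; rewrite ?subrr.
have sl_lip i z z' : sl i z - sl i z' <= `|z - z'|.
  have -> : sl i z - sl i z' = sg i * (z ord0 i - z' ord0 i) by rewrite /sl; lra.
  rewrite (le_trans (ler_norm _))// normrM.
  have h := norm_rV_coord (z - z') i; rewrite !mxE in h.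
  apply: (le_trans _ h); rewrite ler_piMl// /sg.
  by case: ifP => _; rewrite ?normr1//; case: ifP => _; rewrite ?normrN ?normr1 ?normr0.
exists nu, dl, rho; split.
- by rewrite lt_min r0/=.
- apply/norm_rVP => // i; rewrite mxE /sg.
  by case: ifP => _; rewrite ?normr1//; case: ifP => _; rewrite ?normrN ?normr1 ?normr0.
- move=> z zx; split=> [cz|dz i].
    by have [a1 _] := ham z; apply/(slz _ _ a1 zx).1.
  have [ai|ni] := boolP (act i); last by have /andP[? ?] := nz i z ni zx; apply/andP; split; lra.
  by apply/(slz _ _ ai zx).1; apply: le_trans dz _; exact: (ham z).2.
- move=> z zx; split=> [cz|dz i].
    by have [a1 _] := ham z; apply/(slz _ _ a1 zx).2.
  have [ai|ni] := boolP (act i); last exact: nz.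
  by apply/(slz _ _ ai zx).2; apply: lt_le_trans dz _; exact: (ham z).2.
- move=> z z'; have key a b : dl a - dl b <= `|a - b|.
    have [a1 _] := ham b; apply: le_trans (sl_lip (am b) a b).
    by rewrite lerB// (ham a).2.
  by rewrite ler_norml; have := key z z'; have := key z' z; rewrite (distrC z'); lra.
- move=> z s _.
  have ss i : act i -> sl i (z + s *: nu) = sl i z + s.
    by move=> ai; rewrite /sl !mxE mulrDr mulrCA sgP// mulr1; lra.
  have [a1 a2] := ham z; rewrite (dlP _ (am z))//; last first.
    by move=> j aj; rewrite !ss// lerD2r a2.
  by rewrite ss.
(* [pc i] is the piece where the active face [i] is nearest; the signs of the differences [df]
   decide which face that is. *)
- pose pc i : afm R d d := (delta_mx i ord0 *m (sg i *: nu), cc i *: nu).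
  have pcE i z : ev (pc i) z = sl i z *: nu.
    rewrite /ev /pc /= mulmxA -colE /sl scalerDl; congr (_ + _).
    by rewrite -scalemxAr -scalerA mulmx_sum_row big_ord1 mxE;
      congr (_ *: (_ *: _)); apply/rowP => j; rewrite mxE.
  pose sf i := coord_fun i (sg i) (cc i).
  pose df i j : afm R d 1 := ((sf i).1 - (sf j).1, (sf i).2 - (sf j).2).
  have dfE i j z : evl (df i j) z = sl i z - sl j z.
    rewrite /sl -!coord_funE -/(sf i) -/(sf j) /evl /ev /df.
    by move: (sf i) (sf j) => u v /=; rewrite mulmxBr !mxE opprD addrACA.
  exists [seq df i j | i <- enum 'I_d, j <- enum 'I_d], [seq pc i | i <- enum 'I_d].
  move=> z _; exists (pc (am z)); first by rewrite map_f// mem_enum.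
  move=> y _ zy; rewrite pcE; congr (_ *: _); have [a1 a2] := ham z.
  apply: dlP => // j aj; rewrite -subr_le0 -dfE.
  have [_] := zy (df (am z) j) ltac:(apply: allpairs_f; rewrite mem_enum//).
  by apply; rewrite dfE subr_le0; exact: a2.
- by move=> _; exists i0; rewrite mxE sgP.
Qed.

End LocalCharts.

Section ManifoldCharts.
Variable R : realType.

Record homeo_data N N' (X : set 'rV[R]_N) (Y : set 'rV[R]_N') f g : Prop := {
  hd_f : exists L A, PLF X f L A /\ polyh X L;
  hd_g : exists L A, PLF Y g L A /\ polyh Y L;
  hd_im : forall x, X x -> Y (f x);
  hd_inv : forall y, Y y -> X (g y);
  hd_K : forall x, X x -> g (f x) = x;
  hd_invK : forall y, Y y -> f (g y) = y
}.

Lemma pl_homeoP N N' (X : set 'rV[R]_N) (Y : set 'rV[R]_N') f :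
  pl_homeo X Y f -> exists g, homeo_data X Y f g.
Proof.
move=> [g [pf pg fg gf]]; exists g; split.
- exact: pl_map_PLF pf.
- exact: pl_map_PLF pg.
- by case: pf.
- by case: pg.
- by move=> x Xx; apply: fg; rewrite inE.
- by move=> y Yy; apply: gf; rewrite inE.
Qed.

Lemma hd_f_cont N N' (X : set 'rV[R]_N) (Y : set 'rV[R]_N') f g :
  homeo_data X Y f g -> cont_on X f.
Proof. by move=> [[L [A [pf _]]] _ _ _ _ _]; exact: PLF_cont pf. Qed.

Lemma hd_g_cont N N' (X : set 'rV[R]_N) (Y : set 'rV[R]_N') f g :
  homeo_data X Y f g -> cont_on Y g.
Proof. by move=> [_ [L [A [pf _]]] _ _ _ _]; exact: PLF_cont pf. Qed.

Definition nbhd_in N (X U : set 'rV[R]_N) (x : 'rV[R]_N) : Prop :=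
  exists2 r : R, 0 < r & forall y, X y -> `|y - x| < r -> U y.

Lemma nbhd_inP N (X U : set 'rV[R]_N) x : within X (nbhs x) U <-> nbhd_in X U x.
Proof.
rewrite -[within _ _ _]/(\forall y \near within X (nbhs x), U y) near_withinE.
split=> [/nbhs_ballP[r /= r0 h]|[r r0 h]].
  by exists r => // y Xy yx; apply: h => //; rewrite -ball_normE /= distrC.
apply/nbhs_ballP; exists r => //= y yx Xy; apply: h => //.
by move: yx; rewrite -ball_normE /= distrC.
Qed.

Lemma nbhd_in_trans N (X Y U : set 'rV[R]_N) x :
  nbhd_in X Y x -> nbhd_in Y U x -> nbhd_in X U x.
Proof.
move=> [r r0 h] [r' r'0 h']; exists (Num.min r r'); first by rewrite lt_min r0.
by move=> y Xy; rewrite lt_min => /andP[y1 y2]; apply: h' => //; exact: h.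
Qed.

Lemma chart_ball N d (Q U V : set 'rV[R]_N) (f : 'rV[R]_N -> 'rV[R]_d) g y :
  homeo_data U (@cube R d) f g -> U `<=` Q -> U y -> open_cube (f y) ->
  nbhd_in Q V y ->
  exists r : R, [/\ 0 < r, nball (f y) r `<=` @cube R d &
    forall z, nball (f y) r z -> V (g z)].
Proof.
move=> hd UQ Uy oy [r r0 hV].
have [e e0 he] := open_cube_nbhd oy.
have cy := open_cube_sub oy.
have [d0 d00 hd0] := hd_g_cont hd cy r0.
exists (Num.min e d0); split; first by rewrite lt_min e0.
  by move=> z; rewrite /nball/= lt_min => /andP[/he/open_cube_sub].
move=> z; rewrite /nball/= lt_min => /andP[/he/open_cube_sub cz zy].
apply: hV; first exact: UQ (hd_inv hd cz).
by have := hd0 z cz zy; rewrite (hd_K hd Uy).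
Qed.

(** An interior point is sent into the open cube by some chart; invariance of domain, applied to the
    change of charts, makes every chart around it do so. *)
Lemma interior_chart N d (Q U : set 'rV[R]_N) (f : 'rV[R]_N -> 'rV[R]_d) g y :
  homeo_data U (@cube R d) f g -> U `<=` Q -> U y -> nbhd_in Q U y ->
  pl_interior d Q y -> open_cube (f y).
Proof.
move=> hd UQ Uy nU [U2 [f2 [[U2y U2Q /nbhd_inP nU2 /pl_homeoP[g2 hd2]] oy]]].
have [r [r0 rc rU]] := chart_ball hd2 U2Q U2y oy nU.
have [Lf [Af [pf _]]] := hd_f hd; have [Lg [Ag [pg _]]] := hd_g hd2.
have ph := PLF_comp rU (PLF_sub rc pg) pf.
have [|e e0 he] := PL_invariance_of_domain r0 ph.
  move=> z z' bz bz' fz; have gz : g2 z = g2 z'.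
    by rewrite -(hd_K hd (rU _ bz)) -(hd_K hd (rU _ bz')) fz.
  by rewrite -(hd_invK hd2 (rc _ bz)) -(hd_invK hd2 (rc _ bz')) gz.
apply: (nbhd_open_cube e0) => z zy.
have [|x bx <-] := he z; first by rewrite (hd_K hd2 U2y).
by apply: (hd_im hd); exact: rU.
Qed.

Lemma interior_of_chart N d (Q U : set 'rV[R]_N) (f : 'rV[R]_N -> 'rV[R]_d) y :
  pl_homeo U (@cube R d) f -> U `<=` Q -> U y -> nbhd_in Q U y ->
  open_cube (f y) -> pl_interior d Q y.
Proof.
move=> hf UQ Uy nU oy; exists U, f; split=> //; split=> //; exact/nbhd_inP.
Qed.

(** An open collar is attached to [Q] outside, which makes every point interior. *)
Definition collared d N (Q : set 'rV[R]_N) : set ('rV[R]_N * R) :=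
  [set p | [/\ Q p.1, 0 <= p.2 & p.2 = 0 \/ pl_boundary d Q p.1]].

(** Near [q] the boundary is the zero set of the depth read in the chart: positive depth gives an
    interior chart, and depth 0 excludes one by [interior_chart]. *)
Lemma good_chart N d (Q : set 'rV[R]_N) q : pl_manifold d Q -> Q q ->
  exists U f g (nu : 'rV[R]_d) dl rho,
    [/\ homeo_data U (@cube R d) f g, U `<=` Q, U q, nbhd_in Q U q &
    [/\ cube_depth_spec (f q) nu dl rho,
    forall y, U y -> `|f y - f q| < rho -> nbhd_in Q U y,
    forall y, U y -> `|f y - f q| < rho -> (pl_boundary d Q y <-> dl (f y) = 0) &
    forall y, U y -> `|f y - f q| < rho -> 0 <= dl (f y)]].
Proof.
move=> [_ mf] Qq; have [U [f [Uq UQ /nbhd_inP nU hf]]] := mf q Qq.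
have [g hd] := pl_homeoP hf.
have [nu [dl [rho cd]]] := cube_depth (hd_im hd Uq).
have [r r0 hr] := nU.
have r20 : 0 < r / 2 by lra.
have [e e0 he] := hd_g_cont hd (hd_im hd Uq) r20.
(* The bound [e] keeps [y] within [r / 2] of [q], so that [U] is still a neighborhood of [y]. *)
pose rho' := Num.min rho e.
have lr z : `|z| < rho' -> `|z| < rho by rewrite lt_min => /andP[].
have near_U y : U y -> `|f y - f q| < rho' -> nbhd_in Q U y.
  rewrite lt_min => Uy /andP[_ y2]; exists (r / 2) => // z Qz zy.
  apply: hr => //; have := he _ (hd_im hd Uy) y2; rewrite !(hd_K hd)// => yq.
  by rewrite -(subrK y z) -addrA (le_lt_trans (ler_normD _ _))//; lra.
exists U, f, g, nu, dl, rho'; split=> //; split=> //.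
- case: cd => h1 h2 h3 h4 h5 h6 h7 h8; split=> //; first by rewrite lt_min h1.
    by move=> z /lr; exact: h3.
  by move=> z /lr; exact: h4.
- move=> y Uy fy; have dy0 : 0 <= dl (f y).
    by apply/(cd_cube cd) => //; [exact: lr|exact: (hd_im hd)].
  split=> [[_ nI]|dy].
    apply/eqP; rewrite eq_le dy0 andbT leNgt; apply/negP => dy; apply: nI.
    apply: (interior_of_chart hf UQ Uy (near_U y Uy fy)).
    by apply/(cd_open cd) => //; exact: lr.
  split; first exact: UQ.
  move=> /(interior_chart hd UQ Uy (near_U y Uy fy))/(cd_open cd (lr _ _ fy)).
  by rewrite dy ltxx.
- by move=> y Uy fy; apply/(cd_cube cd); [exact: lr|exact: (hd_im hd)].
Qed.

(** The chart is continued over the collar in the outward direction: [(y, s)] goes to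
    [f y - s *: nu]. A point of non-negative depth comes from level 0; a negative depth is minus the
    height in the collar, and cancelling it along [nu] projects to the boundary. Climbing the collar
    is thus a translation by multiples of [w = - nu]. *)
Lemma local_chart N d (Q : set 'rV[R]_N) q : pl_manifold d Q -> Q q ->
  exists (O : set ('rV[R]_N * R)) (G : set 'rV[R]_d) kap lam (core : set 'rV[R]_N),
    [/\ chart (collared d Q) O G kap lam, nbhd_in Q core q,
        forall y, core y -> Q y /\ O (y, 0),
        exists L A, PLF core (fun y => kap (y, 0)) L A /\ polyh core L &
        exists w, forall p c, O p -> pl_boundary d Q p.1 -> 0 <= c ->
          G (kap p + c *: w) -> lam (kap p + c *: w) = (p.1, p.2 + c)].
Proof.
move=> mQ Qq.
have [U [f [g [nu [dl [rho [hd UQ Uq nU [cd near_U bdU dlU]]]]]]]] := good_chart mQ Qq.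
set x' := f q in cd near_U bdU dlU.
have rho0 := cd_rho cd.
have cx' : cube x' by exact: (hd_im hd).
have dx' : 0 <= dl x' by apply: dlU => //; rewrite subrr normr0.
pose kap (p : 'rV[R]_N * R) := f p.1 - p.2 *: nu.
pose mn z := Num.min (dl z) 0.
pose prj z := z - mn z *: nu.
pose lam z : 'rV[R]_N * R := (g (prj z), - mn z).
(* [prj] at most doubles the distance to [x'], because [dl] is 1-Lipschitz, [dl x'] is non-negative
   and [nu] has norm at most 1; hence half of [rho]. *)
pose G := nball x' (rho / 2).
pose O := [set p | [/\ collared d Q p, U p.1, `|f p.1 - x'| < rho & G (kap p)]].
have mn_le z : mn z <= 0 by rewrite /mn ge_min lexx orbT.
have mn_small z : `|mn z| <= `|z - x'|.
  rewrite ler0_norm// /mn; have [h|h] := leP (dl z) 0; last by rewrite oppr0.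
  have := cd_lip cd z x'; rewrite ler_norml => /andP[? _]; lra.
have prj_near z : G z -> `|prj z - x'| < rho.
  rewrite /G/nball/= => Gz; rewrite /prj addrAC (le_lt_trans (ler_normB _ _))//.
  rewrite normrZ; have := cd_nu cd => h.
  have : `|mn z| * `|nu| <= `|z - x'| * 1 by rewrite ler_pM.
  lra.
have dl_prj z : dl (prj z) = dl z - mn z.
  rewrite /prj /mn; have [h|h] := leP (dl z) 0; last by rewrite scale0r !subr0.
  by rewrite -scaleNr (cd_shift cd)//; left.
have mn_pos z : 0 <= dl z - mn z.
  by rewrite /mn; have [h|h] := leP (dl z) 0; rewrite ?subrr ?subr0// ltW.
have prj_cube z : G z -> cube (prj z).
  by move=> Gz; apply/(cd_cube cd); [exact: prj_near|rewrite dl_prj].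
have cdl (X : set 'rV[R]_d) : cont_on X (dl : _ -> R^o).
  by apply: (@cont_on_lip _ _ _ _ _ 1) => x y _ _; rewrite mul1r; exact: (cd_lip cd).
have cmn (X : set 'rV[R]_d) : cont_on X (mn : _ -> R^o).
  by apply: cont_on_min => //; exact: cont_on_cst.
have cprj (X : set 'rV[R]_d) : cont_on X prj.
  apply: cont_on_sub_fun; first exact: cont_on_id.
  by apply: cont_on_scale => //; exact: cont_on_cst.
have OU : O `<=` [set p | U p.1] by move=> p [].
have cf1 : cont_on [set p : 'rV[R]_N * R | U p.1] (fun p => f p.1).
  by apply: (cont_on_comp _ _ (hd_f_cont hd)) => //; exact: cont_on_fst.
have ckU : cont_on [set p : 'rV[R]_N * R | U p.1] kap.
  apply: cont_on_sub_fun => //; apply: cont_on_scale; first exact: cont_on_snd.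
  exact: cont_on_cst.
have lamE z : G z -> lam z = (g (prj z), - mn z) by [].
have lamU z : G z -> U (g (prj z)) by move=> Gz; apply: (hd_inv hd); exact: prj_cube.
have kapK z : G z -> kap (lam z) = z.
  move=> Gz; rewrite /kap /lam /= (hd_invK hd); last exact: prj_cube.
  by rewrite /prj scaleNr opprK subrK.
have lamO z : G z -> O (lam z).
  move=> Gz; have fg : f (g (prj z)) = prj z by apply: (hd_invK hd); exact: prj_cube.
  have nr : `|f (g (prj z)) - x'| < rho by rewrite fg; exact: prj_near.
  split=> //=; [|exact: lamU|by rewrite kapK].
  split=> /=; [exact/UQ/lamU|by rewrite oppr_ge0|].
  have [h|h] := leP (dl z) 0; last by left; rewrite /mn (min_idPr (ltW h)) oppr0.
  right; apply/bdU => //; first exact: lamU.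
  by rewrite fg dl_prj /mn (min_idPl h) subrr.
have prj_kap p : O p -> mn (kap p) = - p.2 /\ prj (kap p) = f p.1.
  move=> [[Qp p0 hp] Up fp Gp].
  have mk : mn (kap p) = - p.2.
    have d0 := dlU _ Up fp.
    case: hp => [p20|/(bdU _ Up fp) dp].
      by rewrite /mn /kap p20 scale0r subr0 oppr0; apply/min_idPr.
    rewrite /mn /kap -scaleNr (cd_shift cd) ?dp ?add0r//; last by left.
    by apply/min_idPl; rewrite oppr_le0.
  by split=> //; rewrite /prj mk scaleNr opprK /kap subrK.
(* A closed box inside the open ball [G], so that the core is polyhedral. *)
exists O, G, kap, lam, [set y | U y /\ forall i, `|f y ord0 i - x' ord0 i| <= rho / 4].
have kap0 y : kap (y, 0) = f y by rewrite /kap /= scale0r subr0.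
have core_near y : (forall i, `|f y ord0 i - x' ord0 i| <= rho / 4) -> `|f y - x'| < rho / 2.
  move=> h; apply: (@le_lt_trans _ _ (rho / 4)); last by lra.
  by apply/norm_rVP => [|i]; [lra|rewrite !mxE; exact: h].
split.
- split=> //.
  + by move=> p [].
  + move=> p [Wp Up fp Gp].
    have [r r0 hr] := near_U _ Up fp.
    have e1 : 0 < rho - `|f p.1 - x'| by lra.
    have [d1 d10 hd1] := cf1 p Up _ e1.
    have e2 : 0 < rho / 2 - `|kap p - x'| by move: Gp; rewrite /G/nball/=; lra.
    have [d2 d20 hd2] := ckU p Up _ e2.
    exists (Num.min r (Num.min d1 d2)); first by rewrite !lt_min r0 d10.
    move=> y Wy; rewrite !lt_min => /and3P[y0 y1 y2].
    have Uy : U y.1.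
      apply: hr; first by case: Wy.
      exact: le_lt_trans (norm_fst (y - p)) y0.
    split=> //.
      have := hd1 y Uy y1 => h; rewrite -(subrK (f p.1) (f y.1)) -addrA.
      by rewrite (le_lt_trans (ler_normD _ _))//; lra.
    have := hd2 y Uy y2 => h; rewrite /G/nball/= -(subrK (kap p) (kap y)) -addrA.
    by rewrite (le_lt_trans (ler_normD _ _))//; lra.
  + move=> z Gz; exists (rho / 2 - `|z - x'|); first by move: Gz; rewrite /G/nball/=; lra.
    move=> y _ yz; rewrite /G/nball/= -(subrK z y) -addrA.
    by rewrite (le_lt_trans (ler_normD _ _))//; lra.
  + by move=> p [].
  + move=> p Op; have [h1 h2] := prj_kap p Op; case: Op => _ Up _ _.
    by rewrite /lam h1 h2 opprK (hd_K hd)//; case: (p).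
  + exact: cont_on_sub ckU.
  + apply: cont_on_pair; last by apply: cont_on_opp.
    by apply: (cont_on_comp (B := @cube R d)) (hd_g_cont hd) => //.
- have [r r0 hr] := nU; have r40 : 0 < rho / 4 by lra.
  have [e e0 he] := hd_f_cont hd Uq r40.
  exists (Num.min r e); first by rewrite lt_min r0.
  move=> y Qy; rewrite lt_min => /andP[y1 y2]; have Uy := hr y Qy y1.
  split=> // i; have := norm_rV_coord (f y - x') i; rewrite !mxE => h.
  by apply: (le_trans h); apply/ltW/he.
- move=> y [Uy hy]; have := core_near y hy => h; split; first exact: UQ.
  split=> //=; [by split=> //=; [exact: UQ|left]|lra|by rewrite kap0].
- have [L [A [pf pU]]] := hd_f hd; exists (L ++ pull A (box_L x' (rho / 4))), A; split.
    apply: (PLF_eq (f := f)); first by move=> y _; rewrite kap0.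
    apply: (@PLF_more _ _ _ _ _ L); first by move=> l lL; rewrite mem_cat lL.
    by apply: PLF_sub pf => y [].
  exact: (polyh_preimage pf pU (@box_polyh _ _ _ _)).
- exists (- nu) => p c Op bp c0 Gc.
  have [[Qp p0 _] Up fp Gp] := Op.
  have dp : dl (f p.1) = 0 by apply/bdU.
  pose p' := (p.1, p.2 + c).
  have kp' : kap p + c *: - nu = kap p'.
    by rewrite /kap /p' /= scalerDl opprD scalerN addrA.
  have Op' : O p'.
    by split=> //=; [split=> //=; [rewrite addr_ge0|right]|rewrite -kp'].
  have [h1 h2] := prj_kap p' Op'.
  by rewrite kp' /lam h1 h2 opprK (hd_K hd).
Qed.

End ManifoldCharts.

(** * Escaping from a manifold with a spine *)

Section Escape.
Variable R : realType.

(** Compactness merges the local charts into one arrangement [M]: the closed cell of each point of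
    [Q] lies, at level 0, in the domain of a single chart, which is affine on it. *)
Lemma finite_charts N d (Q : set 'rV[R]_N) : pl_manifold d Q ->
  exists M : seq (afm R N 1), forall y, Q y ->
    exists (O : set ('rV[R]_N * R)) (G : set 'rV[R]_d) kap lam (a : afm R N d),
      chart (collared d Q) O G kap lam /\
      forall y', ccell M y y' -> [/\ Q y', O (y', 0) & kap (y', 0) = ev a y'].
Proof.
move=> mQ; have cQ := compact_polyhedron_compact mQ.1.
pose P (S : set 'rV[R]_N) := exists M : seq (afm R N 1), forall y, S y -> Q y ->
    exists (O : set ('rV[R]_N * R)) (G : set 'rV[R]_d) kap lam (a : afm R N d),
      chart (collared d Q) O G kap lam /\
      forall y', ccell M y y' -> [/\ Q y', O (y', 0) & kap (y', 0) = ev a y'].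
suff [M hM] : P Q by exists M => y Qy; exact: hM.
apply: (compact_ind cQ).
- by exists [::].
- by move=> A B BA [M hM]; exists M => y /BA; exact: hM.
- move=> A B [M hM] [M' hM']; exists (M ++ M') => y [Ay|By] Qy.
    have [ O [G [kap [lam [a [ch h]]]]]] := hM y Ay Qy.
    by exists O, G, kap, lam, a; split=> // y' /ccell_cat[/h].
  have [ O [G [kap [lam [a [ch h]]]]]] := hM' y By Qy.
  by exists O, G, kap, lam, a; split=> // y' /ccell_cat[_ /h].
- move=> q Qq; have [ O [G [kap [lam [core [ch [r r0 hr] cO [L [A [pf pc]]] _]]]]]] :=
    local_chart mQ Qq.
  exists r => //; exists L => y [Qy' yq] Qy.
  have cy := hr y Qy yq; have [a aA ha] := pf y cy.
  exists O, G, kap, lam, a; split=> // y' yy'.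
  have cy' := pc y y' cy yy'; have [Qy'' Oy] := cO y' cy'.
  by split=> //; exact: ha.
Qed.

(** [J] runs through down-closed families, from all sets to none, losing a maximal member at each
    step. The label [c] will be a set of positive functionals, which can only shrink in a limit;
    down-closed families then give relatively closed parts of [B]. *)
Lemma cell_induction (I : finType) V (Phi : set V -> Prop) (Y B : set V)
    (c : V -> {set I}) :
  (forall (J : {set {set I}}) s,
     (forall d d' : {set I}, d \in J -> d' \subset d -> d' \in J) -> s \in J ->
     (forall d : {set I}, d \in J -> s \subset d -> d = s) ->
     Phi (Y `|` [set b | B b /\ c b \in J]) ->
     Phi (Y `|` [set b | B b /\ c b \in J :\ s])) ->
  Phi (Y `|` B) -> Phi Y.
Proof.
move=> step PB.
suff H n (J : {set {set I}}) : #|J| = n ->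
    (forall d d' : {set I}, d \in J -> d' \subset d -> d' \in J) ->
    Phi (Y `|` [set b | B b /\ c b \in J]) -> Phi Y.
  apply: (H _ [set: {set I}]%SET erefl) => [d d' _ _|]; first by rewrite inE.
  congr Phi : PB; congr (_ `|` _); apply/seteqP; split=> [b Bb|b []//].
  by split=> //; rewrite inE.
elim: n J => [|n IH] J cJ dJ PJ.
  move/eqP: cJ; rewrite cards_eq0 => /eqP J0.
  congr Phi : PJ; apply/seteqP; split=> [b [//|[_]]|b]; last by left.
  by rewrite J0 inE.
have [s0 s0J] : exists s, s \in J by apply/card_gt0P; rewrite cJ.
have [s sJ' smax] := arg_maxnP (fun s : {set I} => #|s|) s0J.
have sJ : s \in J by [].
have max d : d \in J -> s \subset d -> d = s.
  by move=> dinJ sd; apply/esym/eqP; rewrite eqEcard sd; exact: smax.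
apply: (IH (J :\ s)); last exact: step.
  by have := cardsD1 s J; rewrite sJ cJ add1n => -[].
move=> d d'; rewrite !inE => /andP[ds dinJ] d'd; rewrite (dJ d)// andbT.
by apply/eqP => d's; move: ds; rewrite (max d) ?eqxx// -d's.
Qed.

Section EscapeContext.
Variables (N d m : nat) (Q : set 'rV[R]_N) (D D0 : set 'rV[R]_m) (eta : R).
Hypotheses (mQ : pl_manifold d Q) (cD : compact D) (Dc : D `<=` @cube R m).
Hypothesis eta0 : 0 < eta.

Let W := collared d Q.

(** Holds for [X = level0 Q] and is inherited by [level0 Y] when [X] collapses to [Y]. *)
Definition escapes (X : set ('rV[R]_N * R)) : Prop :=
  forall f : 'rV[R]_m -> 'rV[R]_N * R, cont_on D f ->
    (forall x, D x -> W (f x) /\ ~ X (f x)) ->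
    (forall x, D x -> D0 x -> eta <= (f x).2) ->
    exists g, homot D (fun x v => W v /\ (D0 x -> v = f x)) f g /\
      forall x, D x -> (g x).2 <> 0.

Definition level0 (X : set 'rV[R]_N) : set ('rV[R]_N * R) := [set p | X p.1 /\ p.2 = 0].

Let Hi : set ('rV[R]_N * R) := [set p | eta <= p.2].

Lemma high_rclosed : rclosed W Hi.
Proof. by apply: (@rclosed_ge _ _ _ (fun p => p.2)); exact: cont_on_snd. Qed.

Lemma level0_not_high p : p.2 = 0 -> ~ Hi p.
Proof. by rewrite /Hi /= => ->; rewrite leNgt eta0. Qed.

(** A push inside [O] does not move the points of [D0], which are high, and creates no intersection
    with [T], because [O] is disjoint from both. It may therefore precede the escape from the larger
    set. *)
Lemma escape_from (T A O : set ('rV[R]_N * R)) :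
  (forall p, O p -> ~ (T p \/ Hi p)) ->
  (forall f : 'rV[R]_m -> 'rV[R]_N * R, cont_on D f ->
    (forall x, D x -> W (f x)) -> (forall x, D x -> ~ T (f x)) ->
    exists g, homot D (push_inv W O f) f g /\ forall x, D x -> ~ A (g x)) ->
  escapes (T `|` A) -> escapes T.
Proof.
move=> OT cl esc f cf fWT fD0.
have [g [hg gA]] := cl f cf (fun x Dx => (fWT x Dx).1) (fun x Dx => (fWT x Dx).2).
have rel x v : D x -> push_inv W O f x v -> W v /\ (D0 x -> v = f x).
  move=> Dx [Wv nO _]; split=> // D0x; apply: nO => /OT; apply; right.
  exact: fD0.
have cg := homot_cont hg.
have [x Dx|x Dx D0x|h [hh h0]] := esc g cg.
- have [Wg nOg Og] := homot_end hg Dx; split=> // -[Tg|]; last exact: gA.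
  have [Of|nOf] := pselect (O (f x)).
    by apply: (OT _ (Og Of)); left.
  by move: Tg; rewrite nOg//; exact: (fWT x Dx).2.
- by have [_ ->] := rel x _ Dx (homot_end hg Dx); [exact: fD0|].
exists h; split=> //.
apply: (homot_trans (homot_weak rel hg)).
apply: homot_weak hh => x v Dx [Wv vg]; split=> // D0x.
by rewrite vg//; have [_ ->] := rel x _ Dx (homot_end hg Dx).
Qed.

Lemma level0_compact (X : set 'rV[R]_N) : compact X -> compact (level0 X).
Proof.
move=> cX; have -> : level0 X = [set (y, 0) | y in X].
  apply/seteqP; split=> [[y s] [/= Xy ->]|_ [y Xy <-]//]; by exists y.
apply: compact_image cX; apply: cont_on_pair; [exact: cont_on_id|exact: cont_on_cst].
Qed.

(** Positivity is an open condition, so this set can only grow at nearby points. [P] selects all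
    functionals in the general position step, and those nondecreasing in the free direction for a
    collapse. *)
Definition poscell n (L : seq (afm R n 1)) (P : pred (afm R n 1)) (t : 'rV[R]_n) :
    {set 'I_(size L)} :=
  [set i : 'I_(size L) | P (tnth (in_tuple L) i) && (0 < evl (tnth (in_tuple L) i) t)]%SET.

Lemma poscell_near n (L : seq (afm R n 1)) (P : pred (afm R n 1)) t :
  exists2 e : R, 0 < e & forall t', `|t' - t| < e -> poscell L P t \subset poscell L P t'.
Proof.
have [e e0 he] := sign_near L t; exists e => // t' tt'; apply/fintype.subsetP => i.
rewrite !inE => /andP[-> h] /=.
by have [] := he t' tt' (tnth (in_tuple L) i) (mem_tnth _ _) => ->.
Qed.

Lemma poscell_rclosed n (X : set 'rV[R]_n) (L : seq (afm R n 1))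
    (P : pred (afm R n 1)) (J : {set {set 'I_(size L)}}) :
  (forall e e' : {set 'I_(size L)}, e \in J -> e' \subset e -> e' \in J) ->
  rclosed X [set t | poscell L P t \in J].
Proof.
move=> dJ t Xt ntJ; have [e e0 he] := poscell_near L P t.
by exists e => // t' Xt' /he tt' t'J; apply: ntJ; exact: dJ t'J tt'.
Qed.

Lemma downset_setD1 n (J : {set {set 'I_n}}) (s : {set 'I_n}) :
  (forall e e' : {set 'I_n}, e \in J -> e' \subset e -> e' \in J) ->
  (forall e : {set 'I_n}, e \in J -> s \subset e -> e = s) ->
  forall e e' : {set 'I_n}, e \in J :\ s -> e' \subset e -> e' \in J :\ s.
Proof.
move=> dJ smax e e'; rewrite !inE => /andP[es eJ] e'e; rewrite (dJ e)// andbT.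
by apply/eqP => e's; move: es; rewrite (smax e) ?eqxx// -e's.
Qed.

(** The edges from the first vertex span the simplex with coefficients in [0, 1], so the [r]-cube
    parametrizes a set containing it; missing vertices give zero rows. *)
Lemma hull_flat n q (s : seq 'rV[R]_n) r (a : afm R n q) :
  (size s <= r.+1)%N ->
  exists (E : 'rV[R]_r -> 'rV[R]_q) (C : R), [/\ 0 <= C,
    forall x y, `|E x - E y| <= C * `|x - y| &
    forall x, hull s x -> exists2 c, @cube R r c & E c = ev a x].
Proof.
move=> sr.
pose Mx : 'M[R]_(r, q) := \matrix_(i < r)
  (if (i.+1 < size s)%N then (s`_i.+1 - s`_0) *m a.1 else 0).
have [C C0 hC] := mulmx_lip Mx.
exists (fun c => c *m Mx + ev a s`_0), C; split=> //.
  by move=> x y; rewrite opprD addrACA subrr addr0 -mulmxBl.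
move=> x [w [w0 w1 xE]].
case: s sr @Mx C C0 hC w w0 w1 xE => [|s0 s] sr Mx C C0 hC w w0 w1 xE.
  by move/eqP: w1; rewrite big_ord0 eq_sym oner_eq0.
(* Weights indexed by [nat], 0 past the last vertex. Index 0 is the base vertex, hence the shifts by
   one below. *)
pose ww (j : nat) : R := if insub j is Some i then w i else 0.
have wwE (i : 'I_(size (s0 :: s))) : ww i = w i by rewrite /ww valK.
have ww0 j : 0 <= ww j <= 1.
  rewrite /ww; case: insubP => [i _ _|_]; last by rewrite lexx ler01.
  by rewrite w0 -w1 (bigD1 i)//= lerDl sumr_ge0.
exists (\row_(i < r) ww i.+1); first by move=> i; rewrite mxE.
have xE' : x - s0 = \sum_(i < size s) ww i.+1 *: (s`_i - s0).
  rewrite xE -[X in _ - X]scale1r -w1 scaler_suml -sumrB big_ord_recl /= subrr add0r.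
  by apply: eq_bigr => i _; rewrite -scalerBr -wwE.
have -> : ev a x = (x - s0) *m a.1 + ev a s0 by rewrite /ev mulmxBl addrA subrK.
congr (_ + _); rewrite xE' mulmx_sum_row mulmx_suml.
rewrite -(big_mkord xpredT (fun i => ww i.+1 *: (s`_i - s0) *m a.1)).
transitivity (\sum_(0 <= i < r) (if (i < size s)%N then ww i.+1 *: (s`_i - s0) *m a.1 else 0)).
  rewrite big_mkord; apply: eq_bigr => i _; rewrite mxE rowK /=.
  by rewrite ltnS; case: ifP => _; rewrite ?scaler0// -scalemxAl.
rewrite (big_cat_nat (n := size s))//=.
rewrite [X in _ + X]big_nat_cond [X in _ + X]big1 ?addr0.
  by apply: eq_big_nat => i /andP[_ ->].
by move=> i /andP[/andP[h _] _]; rewrite ltnNge h.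
Qed.

(** Sign vectors cut the spine into pieces, each inside one simplex and one chart that is affine on
    it, hence inside a Lipschitz image of the [r]-cube. A piece [A] is cleared in a chart from which
    [T], the pieces treated before, is removed; [A] is closed there because its union with [T] is
    closed. *)
Lemma escape_general_position (P : set 'rV[R]_N) r : polyhedron_dim P r -> P `<=` Q ->
  (r + m < d)%N ->
  escapes (level0 P) -> escapes set0.
Proof.
move=> [K [cK szK _]] PQ rmd.
have cP : compact P by apply: compact_polyhedron_compact; exists K.
have [M hM] := finite_charts mQ; have [L [pP hL]] := cover_polyh cK.
(* With the opposites added, the set of positive functionals determines the full sign vector. *)
pose H0 := M ++ L; pose H := H0 ++ map (@opp_af _ _) H0.
pose sg := poscell H xpredT.
have sg_cell y y' : sg y = sg y' -> ccell H0 y y'.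
  move=> yy' l lH.
  have l1 : l \in H by rewrite mem_cat lH.
  have l2 : opp_af l \in H by rewrite mem_cat map_f ?orbT.
  have key k : k \in H -> (0 < evl k y) = (0 < evl k y').
    move=> kH; have /tnthP[i ki] : k \in in_tuple H by [].
    by have /setP/(_ i) := yy'; rewrite !inE -ki.
  have := key _ l1; have := key _ l2; rewrite !evl_opp !oppr_gt0 => h1 h2.
  split; first by rewrite !leNgt h1.
  by rewrite !leNgt h2.
rewrite -[level0 P]set0U.
apply: (@cell_induction _ _ escapes set0 (level0 P) (fun p => sg p.1)) => J s dJ sJ smax.
rewrite !set0U => esc.
pose TJ (J' : {set {set 'I_(size H)}}) := [set b | level0 P b /\ sg b.1 \in J'].
have TJ_cl (J' : {set {set 'I_(size H)}}) :
    (forall e e' : {set 'I_(size H)}, e \in J' -> e' \subset e -> e' \in J') ->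
    rclosed W (TJ J').
  move=> dJ'; apply: compact_is_rclosed.
  have -> : TJ J' = level0 (P `&` [set y | sg y \in J']).
    by apply/seteqP; split=> [[y t] [[/= ? ?] ?]|[y t] [[/= ? ?] ?]].
  apply: level0_compact; apply: compact_rclosed => //; exact: poscell_rclosed.
pose A := [set b | level0 P b /\ sg b.1 = s].
have TA : TJ J = TJ (J :\ s) `|` A.
  apply/seteqP; split=> [b [Pb bJ]|b [[Pb]|[Pb bs]]].
  - by have [bs|bs] := eqVneq (sg b.1) s; [right|left; split=> //; rewrite !inE bs].
  - by rewrite !inE => /andP[_ bJ].
  - by split=> //; rewrite bs.
have clT := TJ_cl _ (downset_setD1 dJ smax); have clTA := TJ_cl _ dJ.
set T := TJ (J :\ s) in clT TA *.
rewrite -/(TJ J) TA in esc.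
have [[[y0 t0] [[/= Py0 t00] sy0]]|nA] := pselect (exists b, A b); last first.
  have A0 : A = set0 by apply/seteqP; split=> // b Ab; case: nA; exists b.
  by rewrite A0 setU0 in esc.
have [ O0 [G0 [kap [lam [a [ch ha]]]]]] := hM y0 (PQ _ Py0).
have {}ha y : sg y = s -> O0 (y, 0) /\ kap (y, 0) = ev a y.
  rewrite -sy0 => /esym/sg_cell/ccell_cat[yy' _].
  by have [_] := ha y yy'.
have [sx sxK hy0] : exists2 s, s \in K & hull s y0 by move: Py0; rewrite cK.2.
have hy y : sg y = s -> hull sx y.
  by rewrite -sy0 => /esym/sg_cell/ccell_cat[_ /(hL _ _ _ sxK hy0)].
have [E [C [C0 lE hE]]] := hull_flat a (szK sx sxK).
have ch' := chart_restrict ch (rclosedU clT high_rclosed).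
set O := O0 `&` _ in ch'; set G := G0 `&` _ in ch'.
apply: (@escape_from T A O _ _ esc) => [p [_ h] h'|]; first exact: h.
move=> f cf fW fT.
pose A' := [set ev a y | y in [set y | P y /\ sg y = s]].
have AO p : A p -> O p.
  move=> [[Pp p0] sp]; have [Op _] := ha _ sp; split.
    by case: p p0 Op {Pp sp} => y t /= ->.
  move=> [[_]|]; first by rewrite !inE sp eqxx.
  exact: level0_not_high.
have AA' p : A p -> A' (kap p).
  move=> [[Pp p0] sp]; exists p.1 => //; have [_ <-] := ha _ sp.
  by case: p p0 {Pp sp} => y t /= ->.
have A'A p : O p -> A' (kap p) -> A p.
  move=> Op [y [Py sy] ky]; have [_ kay] := ha y sy.
  have Ay : A (y, 0) by split=> //; split.
  have : lam (kap (y, 0)) = lam (kap p) by rewrite kay ky.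
  by rewrite (chartK ch' Op) (chartK ch' (AO _ Ay)) => <-.
have [|||g [hg gA]] := @clear_general_position R m r _ d D W O G kap lam A'
  E C f ch' cD Dc rmd C0 lE _ _ cf fW _.
- by move=> _ [y [Py sy] <-]; have [c cc <-] := hE y (hy y sy); exists c.
- move=> z Gz nA'; have Oz := chart_inv ch' Gz; have kz := chart_invK ch' Gz.
  have nTA : ~ TJ J (lam z).
    rewrite TA => -[Tz|Az]; first by apply: Gz.2; left.
    by apply: nA'; rewrite -kz; exact: AA'.
  have [e e0 he] := clTA _ (chart_sub ch' Oz) nTA.
  have [e' e'0 he'] := chart_inv_cont ch' Gz e0.
  exists e' => // z' Gz' zz' A'z'.
  apply: (he (lam z')); [exact: (chart_sub ch' (chart_inv ch' Gz'))|exact: he'|].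
  by rewrite TA; right; apply: A'A; [exact: (chart_inv ch')|rewrite (chart_invK ch' Gz')].
- move=> x Dx nx; have nTA : ~ TJ J (f x).
    rewrite TA => -[/(fT x Dx)//|Ax]; apply: nx; split; [exact: AO|exact: AA'].
  have [e e0 he] := clTA _ (fW x Dx) nTA.
  have [e' e'0 he'] := cf x Dx _ e0; exists e' => // x' Dx' xx' [Ox' Ax'].
  apply: (he (f x')) => //; [exact: fW|exact: he'|].
  by rewrite TA; right; exact: A'A.
exists g; split=> // x Dx Ax; apply: (gA x Dx); [exact: AO|exact: AA'].
Qed.

End EscapeContext.
End Escape.

(** * Escaping backwards through an elementary collapse *)

Section EscapeCollapse.
Variable R : realType.
Variables (N d m : nat) (Q : set 'rV[R]_N) (D D0 : set 'rV[R]_m) (eta : R).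
Hypotheses (mQ : pl_manifold d Q) (cD : compact D).
Hypothesis eta0 : 0 < eta.

Let W := collared d Q.
Let Hi : set ('rV[R]_N * R) := [set p | eta <= p.2].

Lemma cube_polyh n : exists L, polyh (@cube R n) L.
Proof.
exists ([seq coord_fun i 1 0 | i <- enum 'I_n] ++ [seq coord_fun i 1 (- 1) | i <- enum 'I_n]).
move=> x y cx xy i; have /andP[h0 h1] := cx i.
have [+ _] := xy (coord_fun i 1 0)
  ltac:(by rewrite mem_cat; apply/orP; left; apply: map_f; rewrite mem_enum).
have [_] := xy (coord_fun i 1 (- 1))
  ltac:(by rewrite mem_cat; apply/orP; right; apply: map_f; rewrite mem_enum).
rewrite !coord_funE => h2 h3.
have {}h2 := h2 ltac:(lra); have {}h3 := h3 ltac:(lra).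
by apply/andP; split; lra.
Qed.

Lemma cube_compact n : compact (@cube R n).
Proof.
have [L pL] := cube_polyh n.
apply: bounded_closed_compact; last exact: polyh_closed pL.
exists 1; split; first exact: num_real.
move=> M M1 x cx /=; apply/norm_rVP => [|i]; first lra.
by have /andP[? ?] := cx i; rewrite ger0_norm//; lra.
Qed.

Lemma move_down n (L : seq (afm R n 1)) (v t : 'rV[R]_n) :
  exists2 e : R, 0 < e & forall l, l \in L -> 0 < evl l t -> 0 < evl l (t - e *: v).
Proof.
have [e e0 he] := sign_near L t.
have [s s0 sv] := small_multiple v e0; exists s => // l lL lt.
have [] := he (t - s *: v) _ l lL; last by move=> /(_ lt).
by rewrite addrAC subrr add0r normrN.
Qed.

(** For one functional: [x0], [x1] and [x] are its values at [t0], at [t0 - de *: v] and at a point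
    of the closure of the cell, and [sl] is its slope along [v]. The hypothesis for [0 <= sl] comes
    from the functional itself, the one for [sl <= 0] from its opposite. *)
Lemma cell_signs (x0 x1 x sl de : R) : 0 < de ->
  (0 <= sl -> (0 < x0 -> 0 < x1 /\ 0 <= x) /\
    (x0 <= 0 -> x <= 0 /\ x1 = x0 - de * sl)) ->
  (sl <= 0 -> (x0 < 0 -> x1 < 0 /\ x <= 0) /\
    (0 <= x0 -> 0 <= x /\ x1 = x0 - de * sl)) ->
  (0 <= x1 -> 0 <= x) /\ (x1 <= 0 -> x <= 0).
Proof.
move=> de0 hi hi'; have [sl0|sl0|sl0] := ltgtP sl 0.
- have [h1 h2] := hi' (ltW sl0).
  have sl' : de * sl < 0 by rewrite pmulr_rlt0.
  have [h|h] := ltP x0 0; first by have [? ?] := h1 h; split=> ?; lra.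
  by have [? ?] := h2 h; split=> ?; lra.
- have [h1 h2] := hi (ltW sl0).
  have sl' : 0 < de * sl by rewrite mulr_gt0.
  have [h|h] := ltP 0 x0; first by have [? ?] := h1 h; split=> ?; lra.
  by have [? ?] := h2 h; split=> ?; lra.
- have [h1 h2] := hi' ltac:(by rewrite sl0); have [h3 h4] := hi ltac:(by rewrite sl0).
  have [h|h|h] := ltgtP x0 0.
  + by have [? ?] := h1 h; split=> ?; lra.
  + by have [? ?] := h3 h; split=> ?; lra.
  + have [? _] := h2 ltac:(by rewrite h); have [? _] := h4 ltac:(by rewrite h).
    by split=> ?; lra.
Qed.

(** Cut the collapsing ball, seen as a cube with free direction [v], into cells on which
    a chart is affine.  A cell collects the points with given signs of the functionals
    as seen from just below: it contains its upper lids but not its lower ones.  Pushing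
    along [v] leaves a cell through the top, and going back along [- v] exits it into [Y]
    or into a cell with fewer positive functionals, which has already been cleared. *)
Lemma escape_collapse (X Y : set 'rV[R]_N) :
  X `<=` Q -> elementary_collapse X Y ->
  escapes d Q D D0 eta (level0 X) -> escapes d Q D D0 eta (level0 Y).
Proof.
move=> XQ [_ pY [e [B [f [/pl_homeoP[g hd] XYB BY]]]]] escX.
have cY := compact_polyhedron_compact pY.
have YQ : Y `<=` Q by move=> y Yy; apply: XQ; rewrite XYB; left.
have BQ : B `<=` Q by move=> y By; apply: XQ; rewrite XYB; right.
have [M hM] := finite_charts mQ.
have [Lc pc] := cube_polyh e.+1.
have [Lg [Ag [pg _]]] := hd_g hd.
(* [Y] meets the ball where [c0] vanishes, so [c0 > 0] describes what the collapse removes, and [v]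
   below points away from [Y]. *)
pose c0 : 'rV[R]_e.+1 -> R := fun t => t ord0 ord0.
pose l0 := @coord_fun R e.+1 ord0 1 0.
have l0E t : evl l0 t = c0 t by rewrite coord_funE mul1r addr0.
pose v : 'rV[R]_e.+1 := delta_mx 0 ord0.
(* [l0] detects the removed part, [Lc] describes the cube, [Lg] makes [g] affine and the pulled back
   [M] makes a chart after [g] affine. With the opposites, each functional or its opposite satisfies
   [up]. *)
pose H0 := l0 :: Lc ++ (Lg ++ pull Ag M); pose H := H0 ++ map (@opp_af _ _) H0.
(* For such a functional, being positive at [t] is the same as being positive just below [t], so a
   point of an upper lid belongs to the cell beneath it. *)
pose up := fun l : afm R e.+1 1 => 0 <= slope l v.
have l0H : l0 \in H by rewrite mem_cat inE eqxx.
have upl0 : up l0 by rewrite /up slope_coord_fun mul1r mxE !eqxx ler01.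
pose sg := poscell H up.
pose ll i := tnth (in_tuple H) i.
have llH i : ll i \in H by exact: mem_tnth.
have sgE t i : (i \in sg t) = up (ll i) && (0 < evl (ll i) t) by rewrite inE.
have idx l : l \in H -> exists i, ll i = l.
  by move=> lH; have /tnthP[i ->] : l \in in_tuple H by []; exists i.
have dn t s' l : evl l (t - s' *: v) = evl l t - s' * slope l v.
  by rewrite -scaleNr evl_line mulNr.
have [i0 i0E] := idx _ l0H.
have sg0 t : (i0 \in sg t) = (0 < c0 t) by rewrite sgE i0E upl0 l0E.
have fgK t : cube t -> f (g t) = t by exact: (hd_invK hd).
have gB t : cube t -> B (g t) by exact: (hd_inv hd).
have gY t : cube t -> Y (g t) -> c0 t <= 0.
  move=> ct Yg; have : (B `&` Y) (g t) by split=> //; exact: gB.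
  by rewrite BY => -[_]; rewrite fgK// /c0 => ->.
have gY' t : cube t -> c0 t <= 0 -> Y (g t).
  move=> ct t0; have : (B `&` Y) (g t); last by case.
  rewrite BY; split; first exact: gB.
  by rewrite fgK//; apply/eqP; rewrite eq_le t0; have /andP[] := ct ord0.
pose B0 := [set p : 'rV[R]_N * R | exists2 t, cube t & 0 < c0 t /\ p = (g t, 0)].
have XE : level0 X = level0 Y `|` B0.
  apply/seteqP; split=> [[y r] [/= + ->]|[y r] [[/= Yy ->]|[t ct [t0 [-> ->]]]]].
  - rewrite XYB => -[Yy|By]; first by left.
    have cf : cube (f y) by exact: (hd_im hd).
    have [h|h] := lerP (c0 (f y)) 0.
      by left; split=> //=; rewrite -(hd_K hd By); exact: gY'.
    by right; exists (f y) => //; rewrite (hd_K hd By).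
  - by split=> //=; rewrite XYB; left.
  - by split=> //=; rewrite XYB; right; exact: gB.
rewrite XE in escX.
apply: (@cell_induction _ _ (escapes d Q D D0 eta) (level0 Y) B0 (fun p => sg (f p.1))
  _ escX) => J s dJ sJ smax esc.
pose TJ (J' : {set {set 'I_(size H)}}) := level0 Y `|` [set b | B0 b /\ sg (f b.1) \in J'].
have TJ_cl (J' : {set {set 'I_(size H)}}) :
    (forall e e' : {set 'I_(size H)}, e \in J' -> e' \subset e -> e' \in J') ->
    rclosed W (TJ J').
  move=> dJ'; apply: compact_is_rclosed.
  pose Z := @cube R e.+1 `&` ([set t | c0 t <= 0] `|` [set t | sg t \in J']).
  have -> : TJ J' = level0 Y `|` [set (g t, 0) | t in Z].
    apply/seteqP; split=> p.
      move=> [?|[[t ct [t0 pE]] pJ]]; first by left.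
      right; exists t; last by rewrite pE.
      by split=> //; right; move: pJ; rewrite pE /= fgK.
    move=> [?|[t [ct h] <-]]; first by left.
    have [t0|t0] := lerP (c0 t) 0; first by left; split=> //; exact: gY'.
    case: h => [h|h]; first by move: h; rewrite /= leNgt t0.
    by right; split; [exists t|rewrite /= fgK].
  apply: compactU; first exact: level0_compact.
  apply: compact_image.
    apply: cont_on_pair; last exact: cont_on_cst.
    by apply: cont_on_sub (hd_g_cont hd) => t [].
  apply: compact_rclosed; first exact: cube_compact.
  apply: rclosedU; last exact: poscell_rclosed.
  apply: (@rclosed_le _ _ _ c0); apply: cont_on_coord; exact: cont_on_id.
pose A := [set b | B0 b /\ sg (f b.1) = s].
have TA : TJ J = TJ (J :\ s) `|` A.
  apply/seteqP; split=> [b [Yb|[Bb bJ]]|b [[Yb|[Bb]]|[Bb bs]]].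
  - by left; left.
  - have [bs|bs] := eqVneq (sg (f b.1)) s; first by right.
    by left; right; split=> //; rewrite !inE bs.
  - by left.
  - by rewrite !inE => /andP[_ bJ]; right.
  - by right; split=> //; rewrite bs.
have clT := TJ_cl _ (downset_setD1 dJ smax); have clTA := TJ_cl _ dJ.
rewrite -/(TJ J) TA in esc; rewrite -/(TJ (J :\ s)).
set T := TJ (J :\ s) in clT TA esc *.
have [[_ [[t0 ct0 [c00 ->]] /= st0]]|nA] := pselect (exists b, A b); last first.
  have A0 : A = set0 by apply/seteqP; split=> // b Ab; case: nA; exists b.
  by rewrite A0 setU0 in esc.
rewrite fgK// in st0.
have AE t : cube t -> sg t = s -> A (g t, 0).
  move=> ct tS; split; last by rewrite /= fgK.
  by exists t => //; split=> //; rewrite -sg0 tS -st0 sg0.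
have AP p : A p -> exists2 t, cube t & sg t = s /\ p = (g t, 0).
  by move=> [[t ct [_ ->]]] /=; rewrite fgK// => tS; exists t.
(* The closure of the cell [s]: strict inequalities are relaxed. *)
pose Cs t := forall i, up (ll i) ->
  (i \in s -> 0 <= evl (ll i) t) /\ (i \notin s -> evl (ll i) t <= 0).
have sgCs t : sg t = s -> Cs t.
  move=> tS i ui; rewrite -tS !sgE ui /= -leNgt.
  by split=> // /ltW.
have [de de0 hde] := move_down H v t0.
(* A point of the cell slightly below [t0]. Functionals not constant along [v] do not vanish there,
   and those constant along [v] have their sign fixed by [s]; so the closed cell of the arrangement
   at [t1] contains all of [Cs]. *)
pose t1 := t0 - de *: v.
have st1 : sg t1 = s.
  apply/setP => i; rewrite -st0 !sgE; have [ui|//] := boolP (up (ll i)).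
  apply/idP/idP => /=; last exact: hde.
  by move=> h; apply: lt_le_trans h _; rewrite dn gerBl mulr_ge0// ltW.
have Cs_cell t : Cs t -> ccell H0 t1 t.
  move=> Ct l lH0.
  have lH : l \in H by rewrite mem_cat lH0.
  have lH' : opp_af l \in H by rewrite mem_cat map_f ?orbT.
  have [i iE] := idx _ lH; have [i' i'E] := idx _ lH'.
  have hi : up l -> (0 < evl l t0 -> 0 < evl l t1 /\ 0 <= evl l t) /\
      (evl l t0 <= 0 -> evl l t <= 0 /\ evl l t1 = evl l t0 - de * slope l v).
    move=> ul; have [|c1 c2] := Ct i; first by rewrite iE.
    rewrite iE -st0 sgE iE ul /= in c1 c2.
    split=> h; first by split; [exact: hde|exact: c1].
    by split; [apply: c2; rewrite -leNgt|rewrite dn].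
  have hi' : up (opp_af l) -> (evl l t0 < 0 -> evl l t1 < 0 /\ evl l t <= 0) /\
      (0 <= evl l t0 -> 0 <= evl l t /\ evl l t1 = evl l t0 - de * slope l v).
    move=> ul; have [|c1 c2] := Ct i'; first by rewrite i'E.
    rewrite i'E -st0 sgE i'E ul /= !evl_opp oppr_gt0 oppr_ge0 oppr_le0 -leNgt in c1 c2.
    split=> h; last by split; [exact: c2|rewrite dn].
    by split; [have := hde _ lH'; rewrite !evl_opp !oppr_gt0; apply|exact: c1].
  apply: (cell_signs de0 hi) => sl.
  by apply: hi'; rewrite /up slope_opp oppr_ge0.
have ct1 : cube t1.
  move=> i; rewrite /t1 !mxE eqxx /=; have /andP[h1 h2] := ct0 i.
  case: (eqVneq i ord0) => [i00|_]; last by rewrite mulr0 subr0 h1.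
  have : 0 < c0 t1 by rewrite -sg0 st1 -st0 sg0.
  rewrite /c0 /t1 !mxE !eqxx /= mulr1 i00 in h1 h2 * => h.
  by apply/andP; split; lra.
have [a aA ha] := pg t1 ct1.
have [ O0 [G0 [kap [lam [a' [ch ha']]]]]] := hM (g t1) (BQ _ (gB _ ct1)).
pose b := acomp a a'.
have hb t : Cs t -> [/\ cube t, O0 (g t, 0) & kap (g t, 0) = ev b t].
  move=> /Cs_cell tc.
  have ct : cube t.
    apply: pc ct1 _; apply: ccell_sub tc => l lL.
    by rewrite inE mem_cat lL orbT.
  have gt : g t = ev a t.
    apply: ha => //; apply: ccell_sub tc => l lL.
    by rewrite inE !mem_cat lL !orbT.
  have gt1 : g t1 = ev a t1 by apply: ha => //; exact: ccell_refl.
  have [|_ h1 h2] := ha' (g t).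
    rewrite gt gt1; apply: (ccell_pull aA); apply: ccell_sub tc => l lL.
    by rewrite inE !mem_cat lL !orbT.
  by split=> //; rewrite h2 gt ev_acomp.
pose w := v *m b.1.
have hw t s' : ev b (t + s' *: v) = ev b t + s' *: w by exact: ev_line.
have hw' t s' : ev b (t - s' *: v) = ev b t - s' *: w by rewrite -!scaleNr hw.
have ch' := chart_restrict ch (rclosedU clT (@high_rclosed _ N d Q eta)).
set O := O0 `&` _ in ch'; set G := G0 `&` _ in ch'.
have kinj t t' : Cs t -> Cs t' -> ev b t = ev b t' -> t = t'.
  move=> Ct Ct'; have [h1 h2 <-] := hb t Ct; have [h3 h4 <-] := hb t' Ct'.
  move=> /(congr1 lam); rewrite !(chartK ch)// => -[gg].
  by rewrite -(fgK _ h1) -(fgK _ h3) gg.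
have oppH l : l \in H -> opp_af l \in H.
  rewrite !mem_cat => /orP[lH|/mapP[k kH ->]]; first by rewrite map_f ?orbT.
  by rewrite /opp_af /= !opprK -surjective_pairing kH.
(* [b] is known to be injective on [Cs] only. The vector [q], killed by its linear part, is tested
   at [t1], where a small step along [q] stays in [Cs]; this forces [q = 0]. *)
have span_inj t t' s' : Cs t -> Cs t' -> ev b t' = ev b t + s' *: w -> t' = t + s' *: v.
  move=> Ct Ct' tt'; pose q := t' - t - s' *: v.
  have qb : q *m b.1 = 0.
    have eb : t' *m b.1 = t *m b.1 + s' *: w.
      by move: tt'; rewrite -hw /ev => /addIr ->; rewrite mulmxDl -scalemxAl.
    by rewrite /q !mulmxBl eb -scalemxAl -/w (addrC (t *m b.1)) addrK subrr.
  have [r r0 hr] := sign_near H t1.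
  have [rq rq0 rqr] := small_multiple q r0.
  have rqq : `|t1 + rq *: q - t1| < r by rewrite addrAC subrr add0r.
  have slq l : slope l q = evl l t' - evl l t - s' * slope l v.
    by rewrite /q -scaleNr slopeD slopeZ (evl_sub l t' t); lra.
  have C1 : Cs (t1 + rq *: q).
    move=> i ui; have [hp hn] := hr _ rqq _ (llH i).
    split=> iS.
      by apply/ltW/hp; move: iS; rewrite -st1 sgE => /andP[].
    have i0' : evl (ll i) t0 <= 0 by move: iS; rewrite -st0 sgE ui /= -leNgt.
    have [sv|sv] := eqVneq (slope (ll i) v) 0; last first.
      apply/ltW/hn; rewrite /t1 dn.
      have : 0 < de * slope (ll i) v by rewrite mulr_gt0// lt_neqAle eq_sym sv.
      lra.
    have [j jE] := idx _ (oppH _ (llH i)).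
    have uj : up (ll j) by rewrite jE /up slope_opp sv oppr0.
    have [jS|jS] := boolP (j \in s).
      apply/ltW/hn; move: jS; rewrite -st1 sgE jE evl_opp oppr_gt0 => /andP[_].
      by [].
    have z x : Cs x -> evl (ll i) x = 0.
      move=> Cx; have := (Cx i ui).2 iS; have := (Cx j uj).2 jS.
      by rewrite jE evl_opp; lra.
    rewrite evl_line slq sv (z t)// (z t')// (z t1) ?subrr ?mulr0 ?subr0 ?mulr0 ?addr0//.
    exact: sgCs.
  have := kinj (t1 + rq *: q) t1 C1 (sgCs _ st1).
  rewrite ev_line qb scaler0 addr0 => /(_ erefl) /eqP.
  rewrite -subr_eq0 addrAC subrr add0r scaler_eq0 gt_eqF//= /q => /eqP q00.
  by apply/eqP; rewrite -subr_eq0 opprD addrA q00.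
have w0 : w != 0.
  apply/eqP => w00; have := kinj t1 t0 (sgCs _ st1) (sgCs _ st0).
  rewrite hw' w00 scaler0 subr0 => /(_ erefl)/rowP/(_ ord0).
  rewrite !mxE !eqxx mulr1 => /eqP.
  by rewrite -subr_eq0 addrAC subrr add0r oppr_eq0 gt_eqF.
pose A' := [set ev b t | t in [set t | cube t /\ sg t = s]].
have AO p : A p -> O p.
  move=> Ap; have [t ct [tS pE]] := AP p Ap; rewrite pE.
  have [_ Ot _] := hb t (sgCs _ tS); split=> //.
  move=> [[[/= Yt _]|[_]]|]; last exact: level0_not_high.
    have := gY _ ct Yt; apply/negP; rewrite -ltNge.
    by rewrite -sg0 tS -st0 sg0.
  by rewrite /= fgK// !inE tS eqxx.
have AA' p : A p -> A' (kap p).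
  move=> Ap; have [t ct [tS pE]] := AP p Ap; rewrite pE.
  by have [_ _ ->] := hb t (sgCs _ tS); exists t.
have A'A p : O p -> A' (kap p) -> A p.
  move=> Op [t [ct tS] kt]; have [_ _ kbt] := hb t (sgCs _ tS).
  have At := AE t ct tS.
  have : lam (kap (g t, 0)) = lam (kap p) by rewrite kbt kt.
  by rewrite (chartK ch' Op) (chartK ch' (AO _ At)) => <-.
apply: (@escape_from _ N d m Q D D0 eta T A O _ _ esc) => [p [_ h] h'|]; first exact: h.
move=> h ch_ hW hT.
pose C := D `&` [set x | A (h x)].
have cC : compact C.
  apply: compact_rclosed => // x Dx nAx.
  have nTA : ~ TJ J (h x) by rewrite TA => -[/(hT x Dx)|].
  have [r r0 hr] := clTA _ (hW x Dx) nTA.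
  have [r' r'0 hr'] := ch_ x Dx _ r0; exists r' => // y Dy yx Ay.
  apply: (hr (h y)) => //; [exact: hW|exact: hr'|].
  by rewrite TA; right.
pose th x := f (h x).1.
have thC : cont_on C th.
  apply: (cont_on_comp (B := B)) (hd_f_cont hd).
    by move=> x [_ /AP[t ct [_ ->]]]; exact: gB.
  apply: (cont_on_comp (B := setT)) (@cont_on_fst _ _ _ _) => //.
  by apply: cont_on_sub ch_ => x [].
have [||ep ep0 hep] := @fin_min_pos R 'I_(size H)
    (fun i r => i \in s -> forall x, C x -> r <= evl (ll i) (th x)).
- move=> i; have [iS|niS] := boolP (i \in s); last by exists 1.
  have [||r r0 hr] := @compact_pos_min _ _ C (fun x => evl (ll i) (th x)) cC.
  + by apply: (cont_on_comp (B := setT)) thC (@evl_cont _ _ _ _).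
  + move=> x [_ /AP[t ct [tS hx]]]; rewrite /th hx /= fgK//.
    by move: iS; rewrite -tS sgE => /andP[].
  + by exists r => // _ x; exact: hr.
- by move=> i r r' _ r'r hr iS x Cx; apply: le_trans r'r _; exact: hr.
(* A compact part of the cell that contains all points hit, [ep] being a lower bound there for the
   functionals of [s]. These do not decrease along [v], so moving along [v] within the cell does not
   leave [K2]. *)
pose K2 := @cube R e.+1 `&` [set t | forall i, up (ll i) ->
  (i \in s -> ep <= evl (ll i) t) /\ (i \notin s -> evl (ll i) t <= 0)].
have K2s t : K2 t -> sg t = s.
  move=> [ct tK]; apply/setP => i; rewrite sgE.
  have [ui|nui] := boolP (up (ll i)) => /=; last first.
    by rewrite -st0 sgE (negbTE nui).
  have [h1 h2] := tK i ui; have [iS|niS] := boolP (i \in s).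
    by apply: lt_le_trans ep0 (h1 iS).
  by apply/negbTE; rewrite -leNgt; exact: h2.
have cK2 : compact K2.
  apply: compact_rclosed; first exact: cube_compact.
  move=> t ct nt; have [i /not_implyP[ui /not_andP[]]] : exists i, ~ (up (ll i) ->
    (i \in s -> ep <= evl (ll i) t) /\ (i \notin s -> evl (ll i) t <= 0)).
    by apply/existsNP => hall; apply: nt.
    move=> /not_implyP[iS hi].
    have [r r0 hr] := @rclosed_ge _ _ _ _ ep (@evl_cont _ _ (ll i) (@cube R e.+1)) t ct hi.
    by exists r => // t' ct' t't /(_ i ui)[/(_ iS) h1 _]; exact: hr h1.
  move=> /not_implyP[iS hi].
  have [r r0 hr] := @rclosed_le _ _ _ _ 0 (@evl_cont _ _ (ll i) (@cube R e.+1)) t ct hi.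
  by exists r => // t' ct' t't /(_ i ui)[_ /(_ iS) h1]; exact: hr h1.
have [||||||g' [hg' gA']] := @clear_collapse R _ _ d D W O G kap lam A'
    [set ev b t | t in K2] w h ch' _ w0 _ _ _ _ ch_ hW _.
- move=> _ [t [ct tS] <-]; have [_ _ <-] := hb t (sgCs _ tS).
  by apply: (chart_im ch'); apply: AO; exact: AE.
- move=> _ s' [t [ct tS] <-] s'0.
  (* The functionals of [s] lost on the way back. If there are none, the end point is still in the
     cell. Otherwise, at the first zero, the positive functionals form a proper subset of [s]: that
     point is in [T], so outside [G]. *)
  pose bad := [pred i | (i \in s) && (evl (ll i) (t - s' *: v) <= 0)].
  have upS i : i \in s -> up (ll i) by rewrite -st0 sgE => /andP[].
  have down i c : up (ll i) -> 0 <= c -> evl (ll i) (t - c *: v) <= evl (ll i) t.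
    by move=> ui c00'; rewrite dn gerBl mulr_ge0.
  have tpos i : i \in s -> 0 < evl (ll i) t by rewrite -tS sgE => /andP[].
  have tneg i : up (ll i) -> i \notin s -> evl (ll i) t <= 0.
    by move=> ui; rewrite -tS sgE ui /= -leNgt.
  have [/existsP[i1 bi1]|nb] := boolP [exists i, bad i]; last first.
    left; rewrite -hw'; exists (t - s' *: v) => //.
    have sgS : sg (t - s' *: v) = s.
      apply/setP => i; rewrite sgE; have [ui|nui] := boolP (up (ll i)) => /=; last first.
        by rewrite -st0 sgE (negbTE nui).
      have [iS|niS] := boolP (i \in s).
        rewrite ltNge; apply/negP => hi; case/negP: nb; apply/existsP; exists i.
        by rewrite /= iS.
      apply/negbTE; rewrite -leNgt; apply: le_trans (tneg i ui niS).
      by apply: down => //; exact: ltW.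
    by split=> //; have [] := hb _ (sgCs _ sgS).
  right.
  pose tau i := evl (ll i) t / slope (ll i) v.
  have bslope i : bad i -> 0 < slope (ll i) v.
    move=> /andP[iS hi]; rewrite lt_neqAle eq_sym; apply/andP; split; last exact: upS.
    apply/eqP => s0; move: hi; rewrite /= dn s0 mulr0 subr0.
    by apply/negP; rewrite -ltNge; exact: tpos.
  have [i2 [bi2 mi2]] := @fin_argmin R _ bad tau i1 bi1.
  have i2S : i2 \in s by case/andP: bi2.
  have tau0 : 0 < tau i2 by rewrite divr_gt0 ?tpos ?bslope.
  have taus : tau i2 <= s'.
    rewrite ler_pdivrMr ?bslope//; case/andP: bi2 => _; rewrite dn subr_le0.
    by [].
  exists (tau i2); first by rewrite tau0.
  pose u := t - tau i2 *: v.
  have zi2 : evl (ll i2) u = 0.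
    by rewrite /u dn /tau divfK ?subrr// gt_eqF// bslope.
  have Cu : Cs u.
    move=> i ui; split=> iS; last first.
      by apply: le_trans (tneg i ui iS); apply: down => //; exact: ltW.
    have [bi|nbi] := boolP (bad i).
      by rewrite /u dn subr_ge0 -ler_pdivlMr ?bslope//; exact: mi2.
    move: nbi; rewrite /bad /= iS /= -ltNge => /ltW h1; apply: le_trans h1 _.
    by rewrite /u !dn lerB// ler_wpM2r.
  have [cu Ou ku] := hb u Cu.
  rewrite -hw' -ku => -[_ /=]; rewrite (chartK ch)// => nT; apply: nT; left.
  have [h0|h0] := lerP (c0 u) 0; first by left; split=> //; exact: gY'.
  right; split; first by exists u.
  rewrite /= fgK// !inE; apply/andP; split.
    by apply/eqP => su; move: i2S; rewrite -su sgE zi2 ltxx andbF.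
  apply: (dJ s) => //; apply/fintype.subsetP => i; rewrite sgE => /andP[ui hi].
  apply: contraTT hi => niS; rewrite -leNgt.
  by apply: le_trans (tneg i ui niS); apply: down => //; exact: ltW.
- by apply: compact_image cK2; exact: ev_cont.
- by move=> _ [t Kt <-]; exists t => //; split; [case: Kt|exact: K2s].
- move=> _ s' [t Kt <-] s'0 [t' [ct' st'] h1].
  have Ct := sgCs _ (K2s t Kt); have Ct' := sgCs _ st'.
  have tt' : t' = t + s' *: v by apply: span_inj => //; rewrite h1.
  exists t' => //; split=> // i ui; split=> iS; last exact: (Ct' i ui).2.
  rewrite tt' evl_line; have := (Kt.2 i ui).1 iS.
  have : 0 <= s' * slope (ll i) v by rewrite mulr_ge0.
  lra.
- move=> x Dx Ox Ax; have Ahx := A'A _ Ox Ax.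
  have [t ct [tS hx]] := AP _ Ahx.
  have [_ _ kt] := hb t (sgCs _ tS).
  exists t; last by rewrite hx kt.
  split=> // i ui; split=> iS; last exact: (sgCs _ tS i ui).2.
  have := hep i iS x (conj Dx Ahx).
  by rewrite /th hx /= fgK.
exists g'; split=> // x Dx Ax; apply: (gA' x Dx); [exact: AO|exact: AA'].
Qed.
End EscapeCollapse.

(** * Pushing a map to the boundary of a manifold with a spine *)

Section CompressManifold.
Variable R : realType.

Lemma collapses_sub N (X Y : set 'rV[R]_N) : collapses X Y -> Y `<=` X.
Proof.
elim=> // Y' Z _ IH [_ _ [e [B [f [_ YE _]]]]] z Zz.
by apply: IH; rewrite YE; left.
Qed.

Lemma boundary_rclosed N d (Q : set 'rV[R]_N) :
  pl_manifold d Q -> rclosed Q (pl_boundary d Q).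
Proof.
move=> mQ x Qx nB.
have [U [f [g [nu [dl [rho [hd UQ Ux nU [cd near_U bdU dlU]]]]]]]] := good_chart mQ Qx.
have rho0 := cd_rho cd.
have cfx : `|f x - f x| < rho by rewrite subrr normr0.
have dx : 0 < dl (f x).
  rewrite lt_neqAle dlU// andbT eq_sym; apply/eqP => dx.
  by apply: nB; apply/bdU.
have mn0 : 0 < Num.min rho (dl (f x)) by rewrite lt_min rho0.
have [e e0 he] := hd_f_cont hd Ux mn0.
have [r r0 hr] := nU.
exists (Num.min e r); first by rewrite lt_min e0.
move=> y Qy; rewrite lt_min => /andP[y1 y2] By.
have Uy := hr y Qy y2; have := he y Uy y1; rewrite lt_min => /andP[h1 h2].
have dy := (bdU y Uy h1).1 By.
have := cd_lip cd (f y) (f x); rewrite dy sub0r normrN gtr0_norm// => h3.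
by have := le_lt_trans h3 h2; rewrite ltxx.
Qed.

(** A map that avoids all of [level0 Q] already has nonzero heights. Each elementary collapse
    shrinks the set to be avoided at the start, down to the spine, and general position shrinks it
    to the empty set. *)
Lemma escape_spine N d m (Q P : set 'rV[R]_N) r (D D0 : set 'rV[R]_m) (eta : R) :
  spine d Q P -> polyhedron_dim P r -> (r + m < d)%N -> compact D ->
  D `<=` @cube R m -> 0 < eta -> escapes d Q D D0 eta set0.
Proof.
move=> [mQ _ pP PQ QP] dP rmd cD Dc eta0.
have PQ' : P `<=` Q by exact: collapses_sub QP.
apply: (@escape_general_position R N d m Q D D0 eta mQ cD Dc eta0 P r dP PQ' rmd).
have escQ : escapes d Q D D0 eta (level0 Q).
  move=> f cf fW fD0; exists f; split.
    by apply: homot_refl => // x Dx; split=> //; exact: (fW x Dx).1.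
  move=> x Dx f0; have [[Qx _ _] nQ] := fW x Dx.
  by apply: nQ; split.
elim: QP => // Y Z QY IH YZ.
apply: (escape_collapse mQ cD eta0 _ YZ IH).
exact: collapses_sub QY.
Qed.

(** In a chart at a boundary point, translation along [w] climbs the collar and lifts what lies over
    a neighborhood of that point. Points over the boundary keep their projection and never descend,
    so such pushes can be composed; [compact_ind] runs over subsets of the boundary. *)
Lemma collar_push N d m (Q : set 'rV[R]_N) (D : set 'rV[R]_m) :
  pl_manifold d Q -> compact (pl_boundary d Q) ->
  forall f : 'rV[R]_m -> 'rV[R]_N * R, cont_on D f ->
    (forall x, D x -> collared d Q (f x)) ->
  exists g, homot D (fun x v => collared d Q v /\
      (pl_boundary d Q (f x).1 -> v.1 = (f x).1 /\ (f x).2 <= v.2)) f g /\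
    forall x, D x -> pl_boundary d Q (f x).1 -> 0 < (g x).2.
Proof.
move=> mQ cB; set W := collared d Q; set bd := pl_boundary d Q in cB *.
pose Inv (f : 'rV[R]_m -> 'rV[R]_N * R) x v :=
  W v /\ (bd (f x).1 -> v.1 = (f x).1 /\ (f x).2 <= v.2).
pose P (S : set 'rV[R]_N) := forall f, cont_on D f -> (forall x, D x -> W (f x)) ->
  exists g, homot D (Inv f) f g /\
    forall x, D x -> bd (f x).1 -> S (f x).1 -> 0 < (g x).2.
have Irefl f : cont_on D f -> (forall x, D x -> W (f x)) -> homot D (Inv f) f f.
  by move=> cf fW; apply: homot_refl => // x Dx; split; [exact: fW|].
suff PB : P bd.
  move=> f cf fW; have [g [hg h]] := PB f cf fW; exists g; split=> // x Dx bx.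
  exact: h.
apply: (compact_ind cB).
- by move=> f cf fW; exists f; split; [exact: Irefl|].
- move=> S S' SS PS f cf fW; have [g [hg h]] := PS f cf fW; exists g; split=> // x Dx bx /SS.
  exact: h.
- move=> S S' PS PS' f cf fW; have [g [hg h]] := PS f cf fW.
  have gI x (Dx : D x) := homot_end hg Dx.
  have [g' [hg' h']] := PS' g (homot_cont hg) (fun x Dx => (gI x Dx).1).
  have g'I x (Dx : D x) := homot_end hg' Dx.
  exists g'; split.
    apply: (homot_trans hg); apply: homot_weak hg' => x v Dx [Wv vg]; split=> // bx.
    have [_ /(_ bx) [g1 g2]] := gI x Dx.
    have [v1 v2] : v.1 = (g x).1 /\ (g x).2 <= v.2 by apply: vg; rewrite g1.
    by rewrite v1 g1; split=> //; exact: (le_trans g2 v2).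
  move=> x Dx bx Sx; have [_ /(_ bx) [g1 g2]] := gI x Dx.
  have bgx : bd (g x).1 by rewrite g1.
  have [_ /(_ bgx) [_ g3]] := g'I x Dx.
  case: Sx => Sx; last by apply: h' => //; rewrite g1.
  by apply: lt_le_trans g3; exact: h.
- move=> q bq; have Qq : Q q by case: bq.
  have [ O [G [kap [lam [core [ch [r r0 hr] cO _ [w hw]]]]]]] := local_chart mQ Qq.
  have Oq : O (q, 0) by apply: (cO q _).2; apply: hr => //; rewrite subrr normr0.
  have [||dl [phi [S [[dl0 cS SG] phi01 lphi phi1 phiS]]]] :=
    @lip_bump R d [set kap (q, 0)] G (@compact_set1 _ _) _ _ (chart_im_open ch).
  + by exists (kap (q, 0)).
  + by move=> _ ->; exact: (chart_im ch).
  have cphi (X : set 'rV[R]_d) : cont_on X (phi : _ -> R^o).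
    by apply: (@cont_on_lip _ _ _ _ _ dl^-1) => x y _ _; exact: lphi.
  have w0 : 0 < 1 + `|w| by rewrite ltr_pwDl.
  (* The displacement stays below [dl], hence in [G]; the [1 +] guards against [w = 0]. *)
  pose e := dl / (2 * (1 + `|w|)); have e0 : 0 < e by rewrite divr_gt0// mulr_gt0.
  have ew : e * `|w| < dl.
    rewrite /e mulrAC ltr_pdivrMr ?mulr_gt0// ltr_pM2l// mulrDr mulr1.
    have := normr_ge0 w => nw; lra.
  (* Within [dl / 2] of [kap (q, 0)] the bump is positive, so the height really increases. *)
  have dl20 : 0 < dl / 2 by rewrite divr_gt0.
  have [d1 d10 hd1] := chart_cont ch Oq dl20.
  exists (Num.min r d1); first by rewrite lt_min r0.
  move=> f cf fW.
  pose Dl x := (e * phi (kap (f x))) *: w.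
  have cDl : cont_on (D `&` (fun x => O (f x))) Dl.
    apply: (cont_on_scale (a := fun x => e * phi (kap (f x)))); last exact: cont_on_cst.
    apply: (cont_on_scale (W := R^o) (a := fun=> e)); first exact: cont_on_cst.
    apply: (cont_on_comp (B := setT)) (cphi _) => //.
    apply: (cont_on_comp (B := O)) (chart_cont ch); first by move=> x [].
    by apply: cont_on_sub cf => x [].
  have [||g [hg gO gnO]] := chart_push ch cS SG cf fW cDl.
  + move=> x Dx Ox Dl0; apply: (phiS _ _).1 => phi0; apply: Dl0.
    by rewrite /Dl phi0 mulr0 scale0r.
  + move=> x Dx Ox c /andP[c0 c1].
    have [phi0|/eqP phi0] := eqVneq (phi (kap (f x))) 0.
      by rewrite /Dl phi0 mulr0 scale0r scaler0 addr0; exact: (chart_im ch).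
    apply: (phiS _ phi0).2; rewrite addrAC subrr add0r /Dl scalerA normrZ.
    have /andP[p0 p1] := phi01 (kap (f x)).
    rewrite ger0_norm; last by rewrite !mulr_ge0// ltW.
    have : c * phi (kap (f x)) <= 1 by rewrite mulr_ile1.
    rewrite (_ : c * _ * _ = c * phi (kap (f x)) * (e * `|w|)); last by ring.
    move=> h; apply: le_lt_trans ew; rewrite ler_piMl//.
    by rewrite mulr_ge0// ltW.
  have up x v (c : R) : D x -> O (f x) -> bd (f x).1 -> 0 <= c -> O v ->
      kap v = kap (f x) + c *: Dl x ->
      v = ((f x).1, (f x).2 + c * (e * phi (kap (f x)))).
    move=> Dx Ox bx c0 Ov; rewrite /Dl scalerA => kv.
    have /andP[p0 _] := phi01 (kap (f x)).
    rewrite -(chartK ch Ov) kv hw//; first by rewrite !mulr_ge0// ltW.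
    by rewrite -kv; exact: (chart_im ch).
  exists g; split.
    apply: homot_weak hg => x v Dx [[Wv nOv Ov] kv]; split=> // bx.
    have [Ox|nOx] := pselect (O (f x)); last by rewrite nOv.
    have [c /andP[c0 c1] kvc] := kv Ox.
    rewrite (up x v c Dx Ox bx c0 (Ov Ox) kvc) /=; split=> //.
    have /andP[p0 _] := phi01 (kap (f x)).
    by rewrite lerDl !mulr_ge0// ltW.
  move=> x Dx bx [_]; rewrite lt_min => /andP[xr xd].
  have /andP[p0 _] := phi01 (kap (f x)).
  have [Qx fx0 _] := fW x Dx.
  have [fx2|fx2] := eqVneq (f x).2 0; last first.
    have fxp : 0 < (f x).2 by rewrite lt_neqAle eq_sym fx2.
    have [Ox|nOx] := pselect (O (f x)); last by rewrite gnO.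
    have [Og kg] := gO x Dx Ox.
    rewrite -[Dl x]scale1r in kg; rewrite (up x _ 1 Dx Ox bx ler01 Og kg) /=.
    by rewrite ltr_wpDr// !mulr_ge0// ltW.
  have fxE : f x = ((f x).1, 0) by rewrite -fx2 -surjective_pairing.
  have Ox : O (f x) by rewrite fxE; apply: (cO _ _).2; exact: hr.
  have [Og kg] := gO x Dx Ox.
  rewrite -[Dl x]scale1r in kg; rewrite (up x _ 1 Dx Ox bx ler01 Og kg) /=.
  rewrite fx2 add0r mul1r mulr_gt0//.
  have : `|kap (f x) - kap (q, 0)| < dl / 2.
    apply: hd1 => //; rewrite fxE prod_normE gt_max /= subrr normr0 d10 andbT.
    exact: xd.
  have := lphi (kap (f x)) (kap (q, 0)); rewrite (phi1 _ erefl) => h1 h2.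
  have : dl^-1 * `|kap (f x) - kap (q, 0)| < 1 by rewrite mulrC ltr_pdivrMr// mul1r; lra.
  move: h1; rewrite ler_norml => /andP[h1 _] h3.
  lra.
Qed.

(** Nonzero heights exist only over the boundary, so the projection ends there. Points starting in
    the boundary rise vertically in the first homotopy and are frozen in the second, hence do not
    move after projection. *)
Lemma compress_manifold N d m (Q P : set 'rV[R]_N) r (D : set 'rV[R]_m)
    (f : 'rV[R]_m -> 'rV[R]_N) :
  spine d Q P -> polyhedron_dim P r -> (r + m < d)%N -> compact D ->
  D `<=` @cube R m -> cont_on D f -> (forall x, D x -> Q (f x)) ->
  exists g, homot D (fun x y => Q y /\ (pl_boundary d Q (f x) -> y = f x)) f g /\
    forall x, D x -> pl_boundary d Q (g x).
Proof.
move=> sQ dP rmd cD Dc cf fQ; have [mQ _ _ _ _] := sQ.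
set bd := pl_boundary d Q.
have rB : rclosed Q bd by exact: boundary_rclosed.
have cB : compact bd.
  have -> : bd = Q `&` bd by apply/seteqP; split=> [y [? ?]|y []//]; split.
  apply: compact_rclosed => //; exact: compact_polyhedron_compact mQ.1.
pose f0 x : 'rV[R]_N * R := (f x, 0).
have cf0 : cont_on D f0 by apply: cont_on_pair => //; exact: cont_on_cst.
have fW x : D x -> collared d Q (f0 x) by move=> Dx; split=> //=; [exact: fQ|left].
have [g1 [hg1 pos1]] := collar_push mQ cB cf0 fW.
have cg1 := homot_cont hg1.
pose D0 := [set x | bd (f x)].
have cD0 : compact (D `&` D0).
  by apply: compact_rclosed => //; exact: (rclosed_preimage cf fQ rB).
have [||eta eta0 heta] := @compact_pos_min _ _ (D `&` D0) (fun x => (g1 x).2) cD0.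
- apply: (cont_on_comp (B := setT)) (@cont_on_snd _ _ _ _) => //.
  by apply: cont_on_sub cg1 => x [].
- by move=> x [Dx bx]; exact: pos1.
have esc := @escape_spine N d m Q P r D D0 eta sQ dP rmd cD Dc eta0.
have [x Dx|x Dx D0x|g2 [hg2 n2]] := esc g1 cg1.
- by split=> //; have [] := homot_end hg1 Dx.
- exact: heta.
have cfst : cont_on (setT : set ('rV[R]_N * R)) (fun p => p.1) by exact: cont_on_fst.
exists (fun x => (g2 x).1); split; last first.
  move=> x Dx; have [[_ _ [h|//]] _] := homot_end hg2 Dx.
  by have := n2 x Dx h.
apply: (@homot_trans _ _ _ _ _ _ (fun x => (g1 x).1)).
  apply: (homot_post (B := setT)) cfst _ _ hg1 => // x v Dx [[Qv _ _] h].
  by split=> // bx; have [] := h bx.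
apply: (homot_post (B := setT)) cfst _ _ hg2 => // x v Dx [[Qv _ _] h].
split=> // bx; rewrite h//.
by have [_ /(_ bx)[]] := homot_end hg1 Dx.
Qed.

End CompressManifold.

(** * Boundaries of the intersections of handlebodies *)

Section LocallyEuclidean.
Variable R : realType.

(** [S] is an [e]-manifold without boundary near [x].  By invariance of domain the chart
    and the parametrization need not be mutually inverse. *)
Record pl_euclidean N (e : nat) (S : set 'rV[R]_N) (x : 'rV[R]_N) : Prop := {
  pl_euclidean_chart : exists (r : R) (th : 'rV[R]_N -> 'rV[R]_e),
    [/\ 0 < r, exists L A, PLF (S `&` nball x r) th L A &
      forall y y', (S `&` nball x r) y -> (S `&` nball x r) y' -> th y = th y' -> y = y'];
  pl_euclidean_param : exists p (r : R) (ch : 'rV[R]_e -> 'rV[R]_N),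
    [/\ 0 < r /\ ch p = x, exists L A, PLF (nball p r) ch L A,
      forall z, nball p r z -> S (ch z) &
      forall z z', nball p r z -> nball p r z' -> ch z = ch z' -> z = z']
}.

Lemma pl_euclidean_closed_manifold N n (M : set 'rV[R]_N) x :
  pl_closed_manifold n M -> M x -> pl_euclidean n M x.
Proof.
move=> [mM bM] Mx.
have : pl_interior n M x.
  by apply: contrapT => nI; have : (pl_boundary n M) x by []; rewrite bM.
move=> [U [f [[Ux UM /nbhd_inP nU /pl_homeoP[g hd]] ox]]].
have [r r0 hr] := nU; split.
  exists r, f; split=> //.
    have [L [A [pf _]]] := hd_f hd; exists L, A.
    by apply: PLF_sub pf => y [My yx]; exact: hr.
  move=> y y' [My yx] [My' y'x] ff.
  by rewrite -(hd_K hd (hr _ My yx)) -(hd_K hd (hr _ My' y'x)) ff.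
have [r' [r'0 rc rU]] := chart_ball hd UM Ux ox nU.
exists (f x), r', g; split=> //.
- by split=> //; exact: (hd_K hd).
- by have [L [A [pf _]]] := hd_g hd; exists L, A; exact: PLF_sub pf.
- by move=> z zr; apply: UM; exact: rU.
- move=> z z' zr z'r gg.
  by rewrite -(hd_invK hd (rc _ zr)) -(hd_invK hd (rc _ z'r)) gg.
Qed.

Definition drop_coord d (i : 'I_d.+1) : 'M[R]_(d.+1, d) := col' i 1%:M.
Definition ins_coord d (i : 'I_d.+1) : 'M[R]_(d, d.+1) := row' i 1%:M.

Lemma drop_coordE d (i : 'I_d.+1) (w : 'rV[R]_d.+1) j :
  (w *m drop_coord i) ord0 j = w ord0 (lift i j).
Proof.
rewrite mxE (bigD1 (lift i j))//= !mxE eqxx mulr1 big1 ?addr0// => l li.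
by rewrite !mxE (negbTE li) mulr0.
Qed.

Lemma ins_coordE d (i : 'I_d.+1) (v : 'rV[R]_d) j :
  (v *m ins_coord i) ord0 (lift i j) = v ord0 j.
Proof.
rewrite mxE (bigD1 j)//= !mxE eqxx mulr1 big1 ?addr0// => l lj.
by rewrite !mxE (inj_eq lift_inj) (negbTE lj) mulr0.
Qed.

Lemma ins_coord0 d (i : 'I_d.+1) (v : 'rV[R]_d) : (v *m ins_coord i) ord0 i = 0.
Proof.
by rewrite mxE big1// => l _; rewrite !mxE eq_sym (negbTE (neq_lift _ _)) mulr0.
Qed.

(** The depth grows at unit rate along [nu], so its zero set, the boundary, is a graph in that
    direction. Projecting along [nu] and dropping the coordinate [i0] is a chart; inserting that
    coordinate and subtracting [dl] times [nu] is a parametrization. *)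
Lemma pl_euclidean_boundary N d (Q : set 'rV[R]_N) x :
  pl_manifold d.+1 Q -> pl_boundary d.+1 Q x -> pl_euclidean d (pl_boundary d.+1 Q) x.
Proof.
move=> mQ bx; have Qx : Q x by case: bx.
have [U [f [g [nu [dl [rho [hd UQ Ux nU [cd near_U bdU dlU]]]]]]]] := good_chart mQ Qx.
set x' := f x in cd near_U bdU dlU.
have rho0 := cd_rho cd.
have xx : `|x' - x'| < rho by rewrite subrr normr0.
have dx : dl x' = 0 by apply/bdU.
have nox : ~ open_cube x' by move=> /(cd_open cd xx); rewrite dx ltxx.
have [i0 nui] := cd_act cd nox.
have nu0 : nu ord0 i0 != 0.
  by apply/eqP => h; move/eqP: nui; rewrite h mulr0 eq_sym oner_eq0.
have shift z s : dl (z + s *: nu) = dl z + s by apply: (cd_shift cd); right.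
have [Lf [Af [pf _]]] := hd_f hd; have [Lg [Ag [pg _]]] := hd_g hd.
split.
- have [r r0 hr] := nU; have [e e0 he] := hd_f_cont hd Ux rho0.
  exists (Num.min r e).
  (* Projection along [nu] to the hyperplane where the coordinate [i0] vanishes; [nu ord0 i0] is its
     own inverse. *)
  pose z_ (z : 'rV[R]_d.+1) := z - (z ord0 i0 * nu ord0 i0) *: nu.
  pose a : afm R d.+1 d := (((1%:M - (nu ord0 i0 *: delta_mx i0 ord0) *m nu) *m drop_coord i0), 0).
  have aE z : ev a z = z_ z *m drop_coord i0.
    rewrite /ev /= addr0 mulmxA; congr (_ *m _).
    rewrite mulmxBr mulmx1 mulmxA; congr (_ - _).
    rewrite -scalemxAr -colE; apply/rowP => j; rewrite !mxE big_ord1 !mxE; ring.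
  exists (fun y => ev a (f y)).
  have sub : pl_boundary d.+1 Q `&` nball x (Num.min r e) `<=`
      [set y | [/\ U y, `|f y - x'| < rho & dl (f y) = 0]].
    move=> y [By]; rewrite /nball/= lt_min => /andP[y1 y2].
    have Uy : U y by apply: hr => //; case: By.
    have fy := he y Uy y2; split=> //; exact/(bdU y Uy fy).
  split; first by rewrite lt_min r0.
    exists (Lf ++ pull Af [::]), [seq acomp a1 b1 | a1 <- Af, b1 <- [:: a]].
    apply: (PLF_comp (Y := setT)) => //; last exact: PLF_ev.
    by apply: PLF_sub pf => y /sub[].
  move=> y y' /sub[Uy _ dy] /sub[Uy' _ dy'] /=; rewrite !aE => zz.
  have zi z : z_ z ord0 i0 = 0 by rewrite !mxE -mulrA nui mulr1 subrr.
  have {}zz : z_ (f y) = z_ (f y').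
    apply/rowP => j; case: (unliftP i0 j) => [k ->|->]; last by rewrite !zi.
    by rewrite -!drop_coordE zz.
  have ff : f y = f y' + (f y ord0 i0 * nu ord0 i0 - f y' ord0 i0 * nu ord0 i0) *: nu.
    by rewrite scalerBl addrCA -/(z_ (f y')) -zz /z_ addrC subrK.
  have := shift (f y') (f y ord0 i0 * nu ord0 i0 - f y' ord0 i0 * nu ord0 i0).
  rewrite -ff dy dy' add0r => h; rewrite -h scale0r addr0 in ff.
  by rewrite -(hd_K hd Uy) -(hd_K hd Uy') ff.
- pose io : afm R d d.+1 := (ins_coord i0, x' ord0 i0 *: delta_mx 0 i0).
  have ioE v j : ev io v ord0 (lift i0 j) = v ord0 j.
    by rewrite /ev /= mxE ins_coordE !mxE [lift _ _ == _]eq_sym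
      (negbTE (neq_lift _ _)) andbF mulr0 addr0.
  have io0 v : ev io v ord0 i0 = x' ord0 i0.
    by rewrite /ev /= mxE ins_coord0 !mxE !eqxx mulr1 add0r.
  pose p : 'rV[R]_d := x' *m drop_coord i0.
  have iop : ev io p = x'.
    apply/rowP => j; case: (unliftP i0 j) => [k ->|->]; last exact: io0.
    by rewrite ioE drop_coordE.
  pose prj z := z - dl z *: nu.
  have prj0 z : dl (prj z) = 0 by rewrite /prj -scaleNr shift subrr.
  have near v : nball p (rho / 2) v -> `|prj (ev io v) - x'| < rho.
    rewrite /nball/= => vp.
    have h : `|ev io v - x'| < rho / 2.
      apply: le_lt_trans vp; rewrite -iop; apply/norm_rVP => // j.
      rewrite mxE [X in _ + X]mxE.
      case: (unliftP i0 j) => [k ->|->]; last by rewrite !io0 subrr normr0.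
      by rewrite !ioE; have := norm_rV_coord (v - p) k; rewrite !mxE.
    rewrite /prj addrAC (le_lt_trans (ler_normB _ _))// normrZ.
    have : `|dl (ev io v)| * `|nu| <= `|ev io v - x'| * 1.
      rewrite ler_pM//; last exact: (cd_nu cd).
      by have := cd_lip cd (ev io v) x'; rewrite dx subr0.
    lra.
  have cprj v : nball p (rho / 2) v -> cube (prj (ev io v)).
    by move=> /near h; apply/(cd_cube cd h); rewrite prj0.
  have [Lp [Ap pp]] := cd_pl cd.
  have pprj : PLF setT prj Lp [seq (1%:M - a.1, - a.2) | a <- Ap].
    move=> z _; have [a aA ha] := pp z I; exists (1%:M - a.1, - a.2).
      exact: (map_f (fun a : afm R d.+1 d.+1 => (1%:M - a.1, - a.2))).
    move=> y _ zy; rewrite /prj ha// /ev /= mulmxBr mulmx1 opprD addrA.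
    by [].
  exists p, (rho / 2), (fun v => g (prj (ev io v))); split.
  + split; first by rewrite divr_gt0.
    by rewrite iop /prj dx scale0r subr0 (hd_K hd).
  + have := PLF_comp (X := nball p (rho / 2)) (fun _ _ => I) (@PLF_ev _ _ _ io _) pprj.
    move=> h; have := PLF_comp cprj h pg => h'.
    by eexists; eexists; exact: h'.
  + move=> v vp; have cv := cprj v vp.
    have fg : f (g (prj (ev io v))) = prj (ev io v) by exact: (hd_invK hd).
    apply/bdU; [exact: (hd_inv hd)|by rewrite fg; exact: near|by rewrite fg].
  + move=> v v' vp v'p /(congr1 f); rewrite !(hd_invK hd); [|exact: cprj|exact: cprj].
    move=> e; have e0 : dl (ev io v) = dl (ev io v').
      move/rowP/(_ i0): e; rewrite !mxE -!/(ev io _ ord0 i0) => e.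
      have := io0 v; have := io0 v'; rewrite /ev !mxE => e1 e2.
      rewrite e1 e2 in e; move/addrI/oppr_inj: e => e.
      exact: (mulIf nu0 e).
    move: e; rewrite /prj e0 => /addIr e.
    by apply/rowP => j; rewrite -!ioE e.
Qed.

End LocallyEuclidean.

Section MultisectionBoundary.
Variable R : realType.

(** The inverse of a chart of [T] followed by a chart of [S] is an injective piecewise affine map
    between equal dimensions. Its image is open, so [T] misses no point of [S] near [x]. *)
Lemma interior_nbhd N e (S T : set 'rV[R]_N) x :
  T `<=` S -> pl_interior e T x -> pl_euclidean e S x -> nbhd_in S T x.
Proof.
move=> TS [U [f [[Ux UT /nbhd_inP nU /pl_homeoP[g hd]] ox]]] le.
have [[r [th [r0 [L [A pth]] inj]]] _] := le.
have Sx : S x by exact/TS/UT.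
have bx : (S `&` nball x r) x by split=> //; rewrite /nball/= subrr normr0.
have nV : nbhd_in T (S `&` nball x r) x by exists r => // y Ty yx; split=> //; exact: TS.
have [r2 [r20 rc rV]] := chart_ball hd UT Ux ox nV.
have [Lg [Ag [pg _]]] := hd_g hd.
have ph := PLF_comp rV (PLF_sub rc pg) pth.
have [|e0 e00 he0] := PL_invariance_of_domain r20 ph.
  move=> z z' bz bz' /(inj _ _ (rV _ bz) (rV _ bz')) gg.
  by rewrite -(hd_invK hd (rc _ bz)) -(hd_invK hd (rc _ bz')) gg.
have [r3 r30 hr3] := PLF_cont pth bx e00.
exists (Num.min r r3); first by rewrite lt_min r0.
move=> y Sy; rewrite lt_min => /andP[y1 y2].
have by_ : (S `&` nball x r) y by [].
have [|t bt ht] := he0 (th y); first by rewrite (hd_K hd Ux); exact: hr3.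
have <- : g t = y by apply: inj => //; exact: rV.
by apply/UT/(hd_inv hd); exact: rc.
Qed.

(** [x] may be a boundary point of [S]. Moving towards the centre of the cube in a chart gives a
    point near [x] with a full ball around it, which embeds in a chart of [T]. *)
Lemma dim_mono N a b (S T : set 'rV[R]_N) x :
  pl_manifold a S -> pl_manifold b T -> S x -> T x -> nbhd_in S T x -> (a <= b)%N.
Proof.
move=> mS mT Sx Tx nT.
have [_ /(_ x Sx)[U [f [Ux US /nbhd_inP nU /pl_homeoP[g hd]]]]] := mS.
have [_ /(_ x Tx)[U' [f' [U'x U'T /nbhd_inP nU' /pl_homeoP[g' hd']]]]] := mT.
have [r r0 hr] := nbhd_in_trans nT nU'.
have cx := hd_im hd Ux.
have [e e0 he] := hd_g_cont hd cx r0.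
pose c : 'rV[R]_a := const_mx (2^-1).
pose s := Num.min 1 (e / 2).
have s0 : 0 < s by rewrite lt_min ltr01 divr_gt0.
have s1 : s <= 1 by rewrite ge_min lexx.
have se : s <= e / 2 by rewrite ge_min lexx orbT.
pose t := f x + s *: (c - f x).
have ot : open_cube t.
  move=> i; rewrite !mxE; have /andP[h0 h1] := cx i.
  set u := f x ord0 i in h0 h1 *; nra.
have tx : `|t - f x| < e.
  rewrite /t addrAC subrr add0r normrZ gtr0_norm//.
  apply: (@le_lt_trans _ _ (s * 1)); last by lra.
  rewrite ler_pM2l//; apply/norm_rVP => // i; rewrite !mxE.
  have /andP[h0 h1] := cx i; rewrite ler_norml; apply/andP; split; lra.
have ct := open_cube_sub ot.
have gtx : `|g t - x| < r by have := he t ct tx; rewrite (hd_K hd Ux).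
have nV : nbhd_in S U' (g t).
  exists (r - `|g t - x|); first by rewrite subr_gt0.
  move=> y Sy yt; apply: hr => //; rewrite -(subrK (g t) y) -addrA.
  by rewrite (le_lt_trans (ler_normD _ _))//; lra.
have ogt : open_cube (f (g t)) by rewrite (hd_invK hd).
have [r2 [r20 rc rV]] := chart_ball hd US (hd_inv hd ct) ogt nV.
have [Lg [Ag [pg _]]] := hd_g hd; have [Lf [Af [pf _]]] := hd_f hd'.
have ph := PLF_comp rV (PLF_sub rc pg) pf.
apply: (PL_invariance_of_dim r20 ph) => z z' bz bz' ff.
have gg : g z = g z' by rewrite -(hd_K hd' (rV _ bz)) -(hd_K hd' (rV _ bz')) ff.
by rewrite -(hd_invK hd (rc _ bz)) -(hd_invK hd (rc _ bz')) gg.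
Qed.

(** Read in a chart of [T], the parametrization of [S] covers a neighborhood of the image of [x],
    which is therefore not on the boundary of the cube. *)
Lemma euclidean_interior N e (S T : set 'rV[R]_N) x :
  pl_manifold e T -> T x -> pl_euclidean e S x -> nbhd_in S T x -> pl_interior e T x.
Proof.
move=> mT Tx [_ [p [r [ch [[r0 chp] [L [A pch]] chS inj]]]]] nT.
have [_ /(_ x Tx)[U [f [Ux UT /nbhd_inP nU hf]]]] := mT.
have [g hd] := pl_homeoP hf.
have [r1 r10 hr1] := nbhd_in_trans nT nU.
have pr : nball p r p by rewrite /nball/= subrr normr0.
have [d d0 hdd] := PLF_cont pch pr r10.
pose r' := Num.min r d; have r'0 : 0 < r' by rewrite lt_min r0.
have sub : nball p r' `<=` nball p r.
  by move=> z; rewrite /nball/= lt_min => /andP[].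
have rU z : nball p r' z -> U (ch z).
  move=> zr; apply: hr1; first by apply: chS; exact: sub.
  rewrite -chp; apply: hdd; first exact: sub.
  by move: zr; rewrite /nball/= lt_min => /andP[].
have [Lf [Af [pf _]]] := hd_f hd.
have ph := PLF_comp rU (PLF_sub sub pch) pf.
have [|e0 e00 he0] := PL_invariance_of_domain r'0 ph.
  move=> z z' bz bz' ff; apply: inj; [exact: sub|exact: sub|].
  by rewrite -(hd_K hd (rU _ bz)) -(hd_K hd (rU _ bz')) ff.
apply: (interior_of_chart hf UT Ux nU); apply: (nbhd_open_cube e00) => z zx.
have [|t bt <-] := he0 z; first by rewrite chp.
by apply: (hd_im hd); exact: rU.
Qed.

Section Multisection.
Variables (N n k : nat) (M : set 'rV[R]_N) (H : 'I_k.+1 -> set 'rV[R]_N).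
Hypotheses (cM : pl_closed_manifold n M) (ms : multisection n M H) (k2 : (2 <= k)%N).

Definition meetH (I : {set 'I_k.+1}) : set 'rV[R]_N := \bigcap_(i in [set` I]) H i.

(** The candidate for the boundary of [meetH I]. For the empty [I] it is all of [M], which starts
    the induction. *)
Definition rimH (I : {set 'I_k.+1}) : set 'rV[R]_N :=
  [set x | meetH I x /\ exists2 j, j \notin I & H j x].

Lemma meetH_setU1 (I : {set 'I_k.+1}) j x : meetH (j |: I) x <-> meetH I x /\ H j x.
Proof.
split=> [h|[h hj] i /=]; last by rewrite in_setU1 => /predU1P[->//|iI]; exact: h.
by split; [move=> i iI; apply: h; rewrite /= in_setU1 iI orbT|apply: h; rewrite /= setU11].
Qed.

Lemma meetH_manifold (I : {set 'I_k.+1}) : (0 < #|I| <= k)%N ->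
  pl_manifold (n - #|I| + 1) (meetH I).
Proof. by move=> hI; have [] := multisection_intersection ms hI. Qed.

Lemma multisection_dim_ge : (2 * k <= n)%N.
Proof. by case: (multisection_dim ms); lia. Qed.

Lemma handlebody_closed j : rclosed setT (H j).
Proof.
have [mj _ _] := @multisection_intersection _ _ _ _ _ _ ms [set j]%SET ltac:(rewrite cards1; lia).
have -> : H j = meetH [set j]%SET.
  by apply/seteqP; split=> [x Hx i /=|x]; [rewrite inE => /eqP ->|apply; rewrite /= inE].
by apply: compact_is_rclosed; exact: compact_polyhedron_compact mj.1.
Qed.

(** An interior point of [meetH (i |: I)] has a neighborhood in [rimH I] contained in
    [meetH (i |: I)].  If it were in [H j], then [meetH (j |: I)] would lie there in
    [meetH (j |: (i |: I))], which has smaller dimension. *)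
Lemma boundary_step (I : {set 'I_k.+1}) i : i \notin I -> (#|I|.+2 <= k)%N ->
  (forall x, rimH I x -> pl_euclidean (n - #|I|) (rimH I) x) ->
  forall x, pl_boundary (n - #|i |: I| + 1) (meetH (i |: I)) x <-> rimH (i |: I) x.
Proof.
move=> iI Ik le x.
have cI : #|i |: I| = #|I|.+1 by rewrite cardsU1 iI.
have ng := multisection_dim_ge.
have mI : pl_manifold (n - #|I|) (meetH (i |: I)).
  have -> : (n - #|I| = n - #|i |: I| + 1)%N by rewrite cI; lia.
  by apply: meetH_manifold; rewrite cI; lia.
have -> : (n - #|i |: I| + 1 = n - #|I|)%N by rewrite cI; lia.
have HS : meetH (i |: I) `<=` rimH I by move=> y /meetH_setU1[h hi]; split=> //; exists i.
split=> [bx|[Hx [j jI Hj]]].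
  have Hx : meetH (i |: I) x by case: bx.
  split=> //; apply: contrapT => nj.
  (* The other handlebodies are closed and finite in number, so a ball around [x] avoids them all;
     there [rimH I] and [meetH (i |: I)] coincide, which makes [x] an interior point. *)
  have [||r r0 hr] := @fin_min_pos R 'I_k.+1 (fun j r => j \notin i |: I ->
      forall y, `|y - x| < r -> ~ H j y).
  - move=> j; have [jI|jI] := boolP (j \in i |: I); first by exists 1.
    have nHj : ~ H j x by move=> Hj; apply: nj; exists j.
    by have [r r0 hr] := handlebody_closed Logic.I nHj; exists r => // _ y yx; apply: hr.
  - by move=> j r r' r'0 r'r h jI y yx; apply: h => //; exact: lt_le_trans r'r.
  case: bx => _; apply; apply: (euclidean_interior mI Hx (le x (HS _ Hx))).
  exists r => // y [HIy [j jI Hj]] yx; apply/meetH_setU1; split=> //.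
  have [<-//|ji] := eqVneq j i.
  by case: (hr j _ y yx) => //; rewrite in_setU1 negb_or ji.
split=> // intx.
have [r r0 hr] := interior_nbhd HS intx (le x (HS _ Hx)).
have [HIx Hix] := (meetH_setU1 _ _ _).1 Hx.
have jI' : j \notin I by apply: contra jI => h; rewrite in_setU1 h orbT.
have cj : #|j |: I| = #|I|.+1 by rewrite cardsU1 jI'.
have cij : #|j |: (i |: I)| = #|I|.+2 by rewrite cardsU1 jI cI.
have mj : pl_manifold (n - #|I|) (meetH (j |: I)).
  have -> : (n - #|I| = n - #|j |: I| + 1)%N by rewrite cj; lia.
  by apply: meetH_manifold; rewrite cj; lia.
have mij : pl_manifold (n - #|I| - 1) (meetH (j |: (i |: I))).
  have -> : (n - #|I| - 1 = n - #|j |: (i |: I)| + 1)%N by rewrite cij; lia.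
  by apply: meetH_manifold; rewrite cij; lia.
have : (n - #|I| <= n - #|I| - 1)%N.
  apply: (@dim_mono N _ _ (meetH (j |: I)) (meetH (j |: (i |: I))) x mj mij).
  - exact/meetH_setU1.
  - exact/meetH_setU1.
  - exists r => // y /meetH_setU1[HIy Hjy] yx; apply/meetH_setU1; split=> //; apply: hr => //.
    by split=> //; exists j.
lia.
Qed.

Lemma rimH_set0 : rimH (@finset.set0 _) = M.
Proof.
rewrite (multisection_cover ms); apply/seteqP; split=> [x [_ [j _ Hj]]|x [j _ Hj]].
  by exists j.
by split=> [i /=|]; [rewrite inE|exists j => //; rewrite inE].
Qed.

(** Induction on the size of [I]: with one [i] removed, [rimH (I :\ i)] is [M] or, by induction, the
    boundary of a manifold, hence Euclidean of the dimension that [boundary_step] asks for. *)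
Lemma multisection_boundary (I : {set 'I_k.+1}) : (0 < #|I| < k)%N ->
  pl_boundary (n - #|I| + 1) (meetH I) = rimH I.
Proof.
move cI : #|I| => s; elim: s I cI => // s IH I cI sk.
have [i iI] : exists i, i \in I by apply/card_gt0P; rewrite cI.
have cI' : #|I :\ i| = s by have := cardsD1 i I; rewrite iI cI add1n => -[].
have IE : i |: (I :\ i) = I by rewrite finset.setD1K.
have nS x : rimH (I :\ i) x -> pl_euclidean (n - #|I :\ i|) (rimH (I :\ i)) x.
  have [s0|s0] := posnP s.
    have -> : I :\ i = (@finset.set0 _) by apply/eqP; rewrite -cards_eq0 cI' s0.
    rewrite rimH_set0 cards0 subn0; exact: pl_euclidean_closed_manifold.
  rewrite -IH//; last by rewrite s0 /=; lia.
  rewrite cI' addn1; apply: pl_euclidean_boundary.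
  rewrite -addn1 -cI'; apply: meetH_manifold; rewrite cI'; lia.
have iI' : i \notin I :\ i by rewrite finset.setD11.
have sk' : (#|I :\ i|.+2 <= k)%N by rewrite cI'.
have step := boundary_step iI' sk' nS; rewrite IE cI in step.
by apply/seteqP; split=> x /step.
Qed.

End Multisection.
End MultisectionBoundary.

(** * Compression into the intersections *)

Section CompressMultisection.
Variable R : realType.

(** The homotopy in [Q] is extended by the constant one over the part of the cube sent to [Z]: where
    both apply, [f] is in the boundary of [Q] and does not move. *)
Lemma compress_piece N d m (Q P Z : set 'rV[R]_N) r (f : 'rV[R]_m -> 'rV[R]_N) :
  spine d Q P -> polyhedron_dim P r -> (r + m < d)%N ->
  rclosed setT Q -> rclosed setT Z -> (forall y, Q y -> (Z y <-> pl_boundary d Q y)) ->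
  cont_on (@cube R m) f -> (forall x, cube x -> Z (f x) \/ Q (f x)) ->
  exists g, homot (@cube R m) (fun x v => (Z v \/ Q v) /\ (Z (f x) -> v = f x)) f g /\
    forall x, cube x -> Z (g x).
Proof.
move=> sQ dP rmd cQ cZ QZ cf fZQ.
pose D := @cube R m `&` [set x | Q (f x)].
have rQ : rclosed (@cube R m) [set x | Q (f x)] by exact: (rclosed_preimage (Y := setT) cf).
have rZ : rclosed (@cube R m) [set x | Z (f x)] by exact: (rclosed_preimage (Y := setT) cf).
have cD : compact D by apply: compact_rclosed => //; exact: cube_compact.
have Dc : D `<=` @cube R m by move=> x [].
have [||g0 [[F [cF F0 F1 FI]] hg0]] := compress_manifold (f := f) sQ dP rmd cD Dc.
- exact: cont_on_sub cf.
- by move=> x [].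
pose K (p : R * 'rV[R]_m) := if `[< Q (f p.2) >] then F p else f p.2.
have KQ p : Q (f p.2) -> K p = F p by rewrite /K; case: asboolP.
have KnQ p : ~ Q (f p.2) -> K p = f p.2 by rewrite /K; case: asboolP.
have KZ t x : 0 <= t <= 1 -> cube x -> Z (f x) -> K (t, x) = f x.
  move=> t01 cx Zx; have [Qx|/(@KnQ (t, x))//] := pselect (Q (f x)).
  rewrite KQ//; have [_] := FI t x t01 (conj cx Qx); apply.
  exact/QZ.
exists (fun x => K (1, x)); split; last first.
  move=> x cx; have [Zx|nZ] := pselect (Z (f x)); first by rewrite KZ// ler01 lexx.
  have Qx : Q (f x) by case: (fZQ x cx).
  rewrite KQ// F1//; have Dx : D x by [].
  by apply/(QZ _ _).2; [case: (hg0 x Dx)|exact: hg0].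
exists K; split=> //.
- have := @cont_on_glue _ _ _ [set p : R * 'rV[R]_m | 0 <= p.1 <= 1 /\ cube p.2]
    [set p | Q (f p.2)] [set p | Z (f p.2)] K.
  have csnd (A : set (R * 'rV[R]_m)) : cont_on A snd by exact: cont_on_snd.
  apply.
  + by move=> [t x] [/= _ /fZQ[]]; [right|left].
  + apply: (rclosed_preimage (Y := @cube R m) (B := [set x | Q (f x)]) (csnd _)) => //.
    by move=> p [].
  + apply: (rclosed_preimage (Y := @cube R m) (B := [set x | Z (f x)]) (csnd _)) => //.
    by move=> p [].
  + apply: (@cont_on_eq _ _ _ _ F); first by move=> p [_ Qp]; rewrite KQ.
    by apply: cont_on_sub cF => -[t x] [[/= t01 cx] Qx]; split.
  + apply: (@cont_on_eq _ _ _ _ (fun p : R * 'rV[R]_m => f p.2)).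
      by move=> [t x] [[/= t01 cx] Zx]; rewrite KZ.
    by apply: (cont_on_comp (B := @cube R m)) (csnd _) cf => p [[]].
- move=> x cx; have [Qx|nQ] := pselect (Q (f x)); last by rewrite KnQ.
  by rewrite KQ// F0.
- move=> t x t01 cx; split; last exact: KZ.
  have [Qx|nQ] := pselect (Q (f x)); last by rewrite KnQ//; exact: fZQ.
  by right; rewrite KQ//; have [] := FI t x t01 (conj cx Qx).
Qed.

Variables (N n k : nat) (M : set 'rV[R]_N) (H : 'I_k.+1 -> set 'rV[R]_N).
Hypotheses (cM : pl_closed_manifold n M) (ms : multisection n M H) (k2 : (2 <= k)%N).

Let T := intersection_union H.

Lemma intersection_union_subS r : T r.+1 `<=` T r.
Proof.
move=> x [I /= cI Ix]; have [i iI] : exists i, i \in I by apply/card_gt0P; rewrite cI.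
exists (I :\ i); first by have := cardsD1 i I; rewrite iI cI add1n => -[].
by move=> j /=; rewrite !inE => /andP[_ jI]; exact: Ix.
Qed.

Lemma intersection_union1 : T 1 = M.
Proof.
rewrite (multisection_cover ms); apply/seteqP; split=> [x [I /= /eqP/cards1P[i ->] h]|x [i _ Hi]].
  by exists i => //; apply: h; rewrite /= inE.
exists [set i]%SET; first by rewrite /= cards1.
by move=> j /=; rewrite inE => /eqP ->.
Qed.

Lemma intersection_union_sub r : (0 < r)%N -> T r `<=` M.
Proof.
by case: r => // r _; rewrite -intersection_union1;
  elim: r => // r IH x /intersection_union_subS/IH.
Qed.

Lemma meetH_closed (I : {set 'I_k.+1}) : rclosed setT (meetH H I).
Proof.
move=> x _ nI; have [i nHi] : exists i, ~ (i \in I -> H i x).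
  by apply/existsNP => h; apply: nI => i iI; exact: h.
move/not_implyP: nHi => [iI nHi].
have [r r0 hr] := handlebody_closed ms k2 (Logic.I : setT x) nHi.
by exists r => // y _ yx Iy; apply: (hr y) => //; exact: Iy.
Qed.

Lemma intersection_union_closed r : rclosed setT (T r).
Proof.
move=> x _ nT.
have [||e e0 he] := @fin_min_pos R {set 'I_k.+1} (fun I e => #|I| = r ->
    forall y, `|y - x| < e -> ~ meetH H I y).
- move=> I; have [cI|cI] := pselect (#|I| = r); last by exists 1.
  have nI : ~ meetH H I x by move=> Ix; apply: nT; exists I.
  by have [e e0 he] := meetH_closed (Logic.I : setT x) nI;
    exists e => // _ y yx; exact: (he y Logic.I yx).
- by move=> I e e' e'0 e'e h cI y yx; apply: h => //; exact: lt_le_trans e'e.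
by exists e => // y _ yx [I cI Iy]; exact: (he I cI y yx Iy).
Qed.

Lemma rimH_intersection_union (I : {set 'I_k.+1}) x : rimH H I x -> T #|I|.+1 x.
Proof.
move=> [Ix [j jI Hj]]; exists (j |: I); first by rewrite /= cardsU1 jI.
by apply/meetH_setU1.
Qed.

(** The [r]-fold intersections are cleared one after another, [J] listing those left. Two different
    ones meet only inside [T r.+1], so the current one meets the others and [T r.+1] exactly in its
    boundary, and these form the set [Z]. *)
Lemma compress_stage m r (f : 'rV[R]_m -> 'rV[R]_N) :
  (0 < r < k)%N -> (2 * r + m <= n)%N -> cont_on (@cube R m) f ->
  (forall x, cube x -> T r (f x)) ->
  exists g, homot (@cube R m) (fun x v => T r v /\ (T r.+1 (f x) -> v = f x)) f g /\
    forall x, cube x -> T r.+1 (g x).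
Proof.
move=> rk rmn cf fT.
have ng := multisection_dim_ge ms.
pose TJ (J : {set {set 'I_k.+1}}) := T r.+1 `|` [set x | exists2 I, I \in J & meetH H I x].
suff key s (J : {set {set 'I_k.+1}}) : #|J| = s -> (forall I, I \in J -> #|I| = r) ->
    forall f : 'rV[R]_m -> 'rV[R]_N, cont_on (@cube R m) f -> (forall x, cube x -> TJ J (f x)) ->
    exists g, homot (@cube R m) (fun x v => T r v /\ (T r.+1 (f x) -> v = f x)) f g /\
      forall x, cube x -> T r.+1 (g x).
  apply: (key _ [set I : {set 'I_k.+1} | #|I| == r]%SET erefl) => //.
    by move=> I; rewrite inE => /eqP.
  by move=> x /fT[I /= cI Ix]; right; exists I => //; rewrite inE; apply/eqP.
elim: s J {f cf fT} => [|s IH] J cJ cI f cf fT.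
  have fT' x : cube x -> T r.+1 (f x).
    by move=> /fT[//|[I]]; move/eqP: cJ; rewrite cards_eq0 => /eqP ->; rewrite inE.
  exists f; split=> //; apply: homot_refl => // x cx; split=> //.
  by apply: intersection_union_subS; exact: fT'.
have [I IJ] : exists I, I \in J by apply/card_gt0P; rewrite cJ.
have cIr := cI I IJ.
have rI : (0 < #|I| <= k)%N by rewrite cIr; lia.
have [mI _ [P sP dP]] := multisection_intersection ms rI.
have bI := multisection_boundary cM ms k2 (I := I) ltac:(by rewrite cIr).
have dP' : polyhedron_dim P r.
  have rk' : (r == k) = false by lia.
  by move: dP; rewrite cIr rk' andbF.
pose Z := TJ (J :\ I).
have rZ : rclosed setT Z.
  apply: rclosedU; first exact: intersection_union_closed.
  move=> x _ nx.
  have [||e e0 he] := @fin_min_pos R {set 'I_k.+1} (fun I' e => I' \in J :\ I ->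
      forall y, `|y - x| < e -> ~ meetH H I' y).
  - move=> I'; have [I'J|I'J] := boolP (I' \in J :\ I); last by exists 1.
    have nI : ~ meetH H I' x by move=> Ix; apply: nx; exists I'.
    by have [e e0 he] := meetH_closed (Logic.I : setT x) nI;
      exists e => // _ y yx; exact: (he y Logic.I yx).
  - by move=> I' e e' e'0 e'e h I'J y yx; apply: h => //; exact: lt_le_trans e'e.
  by exists e => // y _ yx [I' I'J Iy]; exact: (he I' I'J y yx Iy).
have QZ y : meetH H I y -> (Z y <-> pl_boundary (n - #|I| + 1) (meetH H I) y).
  move=> Iy; rewrite bI; split=> [Zy|/rimH_intersection_union]; last by rewrite cIr; left.
  have [J' [cJ' JI] J'y] : exists2 J' : {set 'I_k.+1}, (r <= #|J'|)%N /\ J' != I & meetH H J' y.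
    case: Zy => [[J' /= cJ' J'y]|[J']]; last first.
      rewrite !inE => /andP[J'I J'J] J'y; exists J' => //; split=> //.
      by rewrite (cI J' J'J).
    exists J' => //; split; first by rewrite cJ'.
    by apply/eqP => JE; move: cJ'; rewrite JE cIr; lia.
  have [j jJ' jI] : exists2 j, j \in J' & j \notin I.
    apply/subsetPn; apply: contra JI => sub; rewrite eqEcard sub cIr.
    exact: cJ'.
  by split=> //; exists j => //; exact: J'y.
have rmd : (r + m < n - #|I| + 1)%N by rewrite cIr; lia.
have fZQ x : cube x -> Z (f x) \/ meetH H I (f x).
  move=> /fT[?|[I' I'J Ix]]; first by left; left.
  have [<-|ne] := eqVneq I' I; first by right.
  by left; right; exists I' => //; rewrite !inE ne.
have [g [hg gZ]] := compress_piece sP dP' rmd (@meetH_closed I) rZ QZ cf fZQ.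
have cJ' : #|J :\ I| = s by have := cardsD1 I J; rewrite IJ cJ add1n => -[].
have cI' I' : I' \in J :\ I -> #|I'| = r by rewrite !inE => /andP[_]; exact: cI.
have [g' [hg' g'T]] := IH (J :\ I) cJ' cI' g (homot_cont hg) gZ.
exists g'; split=> //.
have hT v : Z v \/ meetH H I v -> T r v.
  move=> [[/intersection_union_subS//|[I' I'J I'v]]|Iv]; last by exists I.
  by exists I' => //; exact: cI'.
have hg1 : homot (@cube R m) (fun x v => T r v /\ (T r.+1 (f x) -> v = f x)) f g.
  apply: homot_weak hg => x v _ [hv Zv]; split; first exact: hT.
  by move=> Tx; apply: Zv; left.
apply: (homot_trans hg1); apply: homot_weak hg' => x v cx [Tv Tg]; split=> // Tx.
have [_ /(_ Tx) gx] := homot_end hg1 cx.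
by rewrite Tg gx.
Qed.

(** The last stage has [r = s - 1], hence the [+ 2]. Points in [T s] are fixed by every stage
    because [T r] decreases with [r]. *)
Lemma compress_all m s (f : 'rV[R]_m -> 'rV[R]_N) :
  (0 < s <= k)%N -> (2 * s + m <= n + 2)%N -> cont_on (@cube R m) f ->
  (forall x, cube x -> M (f x)) ->
  exists g, homot (@cube R m) (fun x v => M v /\ (T s (f x) -> v = f x)) f g /\
    forall x, cube x -> T s (g x).
Proof.
elim: s f => // -[|s] IH f sk smn cf fM.
  exists f; rewrite intersection_union1; split=> //; apply: homot_refl => // x cx; split=> //.
  exact: fM.
have [||g [hg gT]] := IH f _ _ cf fM; [lia|lia|].
have [||g' [hg' g'T]] := compress_stage (m := m) (r := s.+1) (f := g) _ _ (homot_cont hg) gT;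
  [lia|lia|].
exists g'; split=> //.
have hg1 : homot (@cube R m) (fun x v => M v /\ (T s.+2 (f x) -> v = f x)) f g.
  by apply: homot_weak hg => x v _ [Mv Tv]; split=> // /intersection_union_subS.
apply: (homot_trans hg1); apply: homot_weak hg' => x v cx [Tv Tg]; split.
  exact: intersection_union_sub Tv.
move=> Tx; have [_ /(_ Tx) gx] := homot_end hg1 cx.
by rewrite Tg gx.
Qed.

End CompressMultisection.

(** * Homotopy groups *)

Section HomotopyGroups.
Variable R : realType.

(** The constraint that turns [homot] into based homotopy of spheroids. *)
Definition spheroid_inv m N (X : set 'rV[R]_N) (x : 'rV[R]_N) (t : 'rV[R]_m) v : Prop :=
  X v /\ (cube_boundary t -> v = x).

Lemma cube_boundaryE m (t : 'rV[R]_m) : cube_boundary t <-> cube t /\ ~ open_cube t.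
Proof. by []. Qed.

Lemma spheroidP m N (X : set 'rV[R]_N) x (f : 'rV[R]_m -> 'rV[R]_N) :
  spheroid X x f <-> cont_on (@cube R m) f /\ forall t, cube t -> spheroid_inv X x t (f t).
Proof.
split=> [[/cont_onP cf fX fb]|[cf h]].
  by split=> // t ct; split; [exact: fX|exact: fb].
split; first exact/cont_onP.
  by move=> t ct; have [] := h t ct.
by move=> t bt; have [_] := h t bt.1; apply.
Qed.

Lemma unit_cubeE m : (`[0%R, 1%R] `*` @cube R m : set (R * 'rV[R]_m)) =
  [set p | 0 <= p.1 <= 1 /\ cube p.2].
Proof. by apply/seteqP; split=> [[s t] [/=]|[s t] [/= s01 ct]]; rewrite ?in_itv /=; split. Qed.

Lemma homotopicP m N (X : set 'rV[R]_N) x (f g : 'rV[R]_m -> 'rV[R]_N) :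
  homotopic X x f g <-> homot (@cube R m) (spheroid_inv X x) f g.
Proof.
split=> [[F [cF F01 Fs]]|[F [cF F0 F1 FI]]].
  exists F; split.
  - by rewrite -unit_cubeE; apply/cont_onP.
  - by move=> t /F01[].
  - by move=> t /F01[].
  - by move=> s t s01 ct; have /spheroidP[_ h] := Fs s s01; exact: h.
exists F; split.
- by rewrite unit_cubeE; apply/cont_onP.
- by move=> t ct; rewrite F0// F1.
- move=> s s01; apply/spheroidP; split; last by move=> t ct; exact: FI.
  have cp : cont_on (@cube R m) (fun t => (s, t) : R * 'rV[R]_m).
    by apply: cont_on_pair; [exact: cont_on_cst|exact: cont_on_id].
  exact: (cont_on_comp _ cp cF).
Qed.

Lemma homot_sym (U V : normedModType R) (D : set U) (Inv : U -> V -> Prop) f g :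
  homot D Inv f g -> homot D Inv g f.
Proof.
move=> [F [cF F0 F1 FI]]; exists (fun p => F (1 - p.1, p.2)); split.
- apply: (cont_on_comp _ _ cF).
    by move=> [s x] [/= /andP[s0 s1] Dx]; split=> //=; rewrite subr_ge0 s1 gerBl s0.
  apply: cont_on_pair; last exact: cont_on_snd.
  apply: (@cont_on_sub_fun _ _ R^o); [exact: cont_on_cst|exact: cont_on_fst].
- by move=> x Dx; rewrite subr0 F1.
- by move=> x Dx; rewrite subrr F0.
- by move=> s x /andP[s0 s1] Dx; apply: FI => //; rewrite subr_ge0 s1 gerBl s0.
Qed.

Section Classes.
Variables (m N : nat) (x : 'rV[R]_N).
Implicit Types (X M : set 'rV[R]_N) (f g : 'rV[R]_m -> 'rV[R]_N).

Lemma homotopic_refl X f : spheroid X x f -> homotopic X x f f.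
Proof. by move=> /spheroidP[cf h]; apply/homotopicP; exact: homot_refl. Qed.

Lemma homotopic_sym X f g : homotopic X x f g -> homotopic X x g f.
Proof. by move=> /homotopicP h; apply/homotopicP; exact: homot_sym. Qed.

Lemma homotopic_trans X f g h :
  homotopic X x f g -> homotopic X x g h -> homotopic X x f h.
Proof.
move=> /homotopicP fg /homotopicP gh; apply/homotopicP; exact: (homot_trans fg gh).
Qed.

Lemma homotopic_sub X M f g : X `<=` M -> homotopic X x f g -> homotopic M x f g.
Proof.
move=> XM /homotopicP h; apply/homotopicP; apply: homot_weak h => t v _ [Xv vx].
by split=> //; exact: XM.
Qed.

Lemma spheroid_sub X M f : X `<=` M -> spheroid X x f -> spheroid M x f.
Proof.
move=> XM /spheroidP[cf h]; apply/spheroidP; split=> // t ct.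
by have [Xt bt] := h t ct; split=> //; exact: XM.
Qed.

Lemma homotopy_class_eq X f g :
  homotopic X x f g -> homotopy_class X x f = homotopy_class X x g.
Proof.
move=> fg; apply/seteqP; split=> h [sh hh]; split=> //.
  exact: homotopic_trans (homotopic_sym fg) hh.
exact: homotopic_trans fg hh.
Qed.

Lemma homotopy_class_self X f : spheroid X x f -> homotopy_class X x f f.
Proof. by move=> sf; split=> //; exact: homotopic_refl. Qed.

Lemma homotopy_incl_class X M f : X `<=` M -> spheroid X x f ->
  homotopy_incl M x (homotopy_class X x f) = homotopy_class M x f.
Proof.
move=> XM sf; apply/seteqP; split=> [h [f' [_ ff'] hM]|h hM].
  by rewrite (homotopy_class_eq (homotopic_sub XM ff')).
by exists f => //; exact: homotopy_class_self.
Qed.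

Lemma cont_on_set_coord (A : set 'rV[R]_m) (i : 'I_m) (c : 'rV[R]_m -> R) :
  cont_on A (c : _ -> R^o) -> cont_on A (fun t => set_coord i (c t) t).
Proof.
move=> cc; apply: cont_on_rV => j.
have [ji|ji] := eqVneq j i.
  by apply: cont_on_eq cc => t _; rewrite mxE ji eqxx.
apply: (@cont_on_eq _ _ _ _ (fun t : 'rV[R]_m => t ord0 j : R^o)).
  by move=> t _; rewrite mxE (negbTE ji).
by apply: cont_on_coord; exact: cont_on_id.
Qed.

Lemma cube_set_coord (i : 'I_m) c (t : 'rV[R]_m) :
  cube t -> 0 <= c <= 1 -> cube (set_coord i c t).
Proof. by move=> ct c01 j; rewrite mxE; case: eqP. Qed.

Lemma set_coord_boundary (i : 'I_m) c (t : 'rV[R]_m) : 0 <= c <= 1 -> cube t ->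
  (0 < c < 1 -> 0 < t ord0 i < 1) -> cube_boundary t -> cube_boundary (set_coord i c t).
Proof.
move=> c01 ct hc /cube_boundaryE[_ nt]; apply/cube_boundaryE.
split; first exact: cube_set_coord.
move=> os; apply: nt => j; have := os j; rewrite mxE.
by case: eqP => [-> /hc|].
Qed.

Lemma set_coord_end (i : 'I_m) c (t : 'rV[R]_m) : c = 0 \/ c = 1 -> cube t ->
  cube_boundary (set_coord i c t).
Proof.
move=> c01 ct; apply/cube_boundaryE; split.
  by apply: cube_set_coord => //; case: c01 => ->; rewrite lexx ler01.
by move=> /(_ i); rewrite mxE eqxx; case: c01 => ->; rewrite ltxx ?andbF.
Qed.

(** Where the coordinate [i] is 1/2, both homotopies are evaluated on the boundary of the cube and
    give [x], so they glue. Constant homotopies yield that the concatenation of spheroids is a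
    spheroid. *)
Lemma concat_homot X (i : 'I_m) f f' g g' :
  homot (@cube R m) (spheroid_inv X x) f f' -> homot (@cube R m) (spheroid_inv X x) g g' ->
  homot (@cube R m) (spheroid_inv X x) (concat i f g) (concat i f' g').
Proof.
move=> [F [cF F0 F1 FI]] [G [cG G0 G1 GI]].
pose lo (t : 'rV[R]_m) := set_coord i (2 * t ord0 i) t.
pose hi (t : 'rV[R]_m) := set_coord i (2 * t ord0 i - 1) t.
have clo (t : 'rV[R]_m) : cube t -> t ord0 i <= 2^-1 -> cube (lo t).
  by move=> ct h; apply: cube_set_coord => //; have /andP[? ?] := ct i; apply/andP; split; lra.
have chi (t : 'rV[R]_m) : cube t -> 2^-1 <= t ord0 i -> cube (hi t).
  by move=> ct h; apply: cube_set_coord => //; have /andP[? ?] := ct i; apply/andP; split; lra.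
pose K (p : R * 'rV[R]_m) := if p.2 ord0 i <= 2^-1 then F (p.1, lo p.2) else G (p.1, hi p.2).
have cti (A : set (R * 'rV[R]_m)) : cont_on A (fun p => p.2 ord0 i : R^o).
  by apply: cont_on_coord; exact: cont_on_snd.
have ct2 (A : set 'rV[R]_m) : cont_on A (fun t => 2 * t ord0 i : R^o).
  apply: (cont_on_scale (W := R^o) (a := fun=> 2)); first exact: cont_on_cst.
  by apply: cont_on_coord; exact: cont_on_id.
have cclo (A : set (R * 'rV[R]_m)) : cont_on A (fun p => (p.1, lo p.2) : R * 'rV[R]_m).
  apply: cont_on_pair; first exact: cont_on_fst.
  apply: (cont_on_comp (B := setT)) (@cont_on_snd _ _ _ _) _ => //.
  exact: cont_on_set_coord.
have cchi (A : set (R * 'rV[R]_m)) : cont_on A (fun p => (p.1, hi p.2) : R * 'rV[R]_m).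
  apply: cont_on_pair; first exact: cont_on_fst.
  apply: (cont_on_comp (B := setT)) (@cont_on_snd _ _ _ _) _ => //.
  apply: cont_on_set_coord; apply: (@cont_on_sub_fun _ _ R^o) => //.
  exact: cont_on_cst.
exists K; split.
- have := @cont_on_glue _ _ _ [set p : R * 'rV[R]_m | 0 <= p.1 <= 1 /\ cube p.2]
    [set p : R * 'rV[R]_m | p.2 ord0 i <= 2^-1]
    [set p : R * 'rV[R]_m | 2^-1 <= p.2 ord0 i] K.
  apply.
  + by move=> p _ /=; case: (lerP (p.2 ord0 i) 2^-1) => [|/ltW]; [left|right].
  + by apply: (@rclosed_le _ _ _ (fun p : R * 'rV[R]_m => p.2 ord0 i)).
  + by apply: (@rclosed_ge _ _ _ (fun p : R * 'rV[R]_m => p.2 ord0 i)).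
  + apply: (@cont_on_eq _ _ _ _ (fun p : R * 'rV[R]_m => F (p.1, lo p.2))).
      by move=> p [_ /= h]; rewrite /K h.
    apply: (cont_on_comp _ (cclo _) cF) => p [[/= s01 ct] h]; split=> //=.
    exact: clo.
  + apply: (@cont_on_eq _ _ _ _ (fun p : R * 'rV[R]_m => G (p.1, hi p.2))).
      move=> [s t] [[/= s01 ct] h]; rewrite /K /=; case: ifP => // h'.
      have ti : t ord0 i = 2^-1 by apply/eqP; rewrite eq_le h' h.
      have bl : cube_boundary (lo t) by apply: set_coord_end => //; right; rewrite ti; lra.
      have bh : cube_boundary (hi t) by apply: set_coord_end => //; left; rewrite ti; lra.
      have [_ ->//] := FI s (lo t) s01 bl.1.
      by have [_ ->] := GI s (hi t) s01 bh.1.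
    apply: (cont_on_comp _ (cchi _) cG) => p [[/= s01 ct] h]; split=> //=.
    exact: chi.
- move=> t ct; rewrite /K /concat /=; case: ifP => h; first by rewrite F0//; exact: clo.
  by rewrite G0//; apply: chi => //; move/negbT: h; rewrite -ltNge => /ltW.
- move=> t ct; rewrite /K /concat /=; case: ifP => h; first by rewrite F1//; exact: clo.
  by rewrite G1//; apply: chi => //; move/negbT: h; rewrite -ltNge => /ltW.
- move=> s t s01 ct; rewrite /K /=; have /andP[t0 t1] := ct i; case: ifP => h.
    have cl := clo t ct h; have [XF bF] := FI s _ s01 cl; split=> // bt.
    apply: bF; apply: set_coord_boundary => //; first by apply/andP; split; lra.
    by move=> /andP[? ?]; apply/andP; split; lra.
  have h' : 2^-1 <= t ord0 i by move/negbT: h; rewrite -ltNge => /ltW.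
  have cl := chi t ct h'; have [XG bG] := GI s _ s01 cl; split=> // bt.
  apply: bG; apply: set_coord_boundary => //; first by apply/andP; split; lra.
  by move=> /andP[? ?]; apply/andP; split; lra.
Qed.

Lemma homotopic_concat X (i : 'I_m) f f' g g' :
  homotopic X x f f' -> homotopic X x g g' ->
  homotopic X x (concat i f g) (concat i f' g').
Proof.
by move=> /homotopicP ff /homotopicP gg; apply/homotopicP; exact: concat_homot.
Qed.

Lemma spheroid_concat X (i : 'I_m) f g :
  spheroid X x f -> spheroid X x g -> spheroid X x (concat i f g).
Proof.
move=> /homotopic_refl/homotopicP ff /homotopic_refl/homotopicP gg.
have h := concat_homot i ff gg.
by apply/spheroidP; split=> [|t ct]; [exact: homot_cont h|exact: (homot_end h)].
Qed.

Lemma homotopy_mul_class X (i : 'I_m) f g : spheroid X x f -> spheroid X x g ->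
  homotopy_mul i X x (homotopy_class X x f) (homotopy_class X x g) =
  homotopy_class X x (concat i f g).
Proof.
move=> sf sg; apply/seteqP; split=> [h [f' [g' [[_ ff] [_ gg] hh]]]|h hh].
  by rewrite (homotopy_class_eq (homotopic_concat i ff gg)).
by exists f, g; split=> //; exact: homotopy_class_self.
Qed.

Lemma homotopy_incl_morphism X M : X `<=` M -> homotopy_morphism m X M x.
Proof.
move=> XM; split=> [_ [f sf <-]|i _ _ [f sf <-] [g sg <-]].
  by exists f; [exact: (spheroid_sub XM sf)|rewrite homotopy_incl_class].
rewrite homotopy_mul_class// !homotopy_incl_class//; last exact: spheroid_concat.
by rewrite homotopy_mul_class//; exact: (spheroid_sub XM).
Qed.

End Classes.

(** The homotopy is stationary wherever [f] is already in [X], not only on the boundary of the cube.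
    It can thus be applied to a spheroid and, one dimension higher, to a homotopy whose ends lie in
    [X]. *)
Definition compressible N (m : nat) (X M : set 'rV[R]_N) : Prop :=
  forall f : 'rV[R]_m -> 'rV[R]_N, cont_on (@cube R m) f ->
    (forall t, cube t -> M (f t)) ->
    exists g, homot (@cube R m) (fun t v => M v /\ (X (f t) -> v = f t)) f g /\
      forall t, cube t -> X (g t).

Arguments compressible [N] m X M.

Lemma compressible_surj N m (X M : set 'rV[R]_N) x : X `<=` M -> X x ->
  compressible m X M ->
  set_surj (@homotopy_group R m N X x) (@homotopy_group R m N M x) (homotopy_incl M x).
Proof.
move=> XM Xx cXM _ [f /spheroidP[cf fI] <-].
have [g [hg gX]] := cXM f cf (fun t ct => (fI t ct).1).
have hg' : homot (@cube R m) (spheroid_inv M x) f g.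
  apply: homot_weak hg => t v ct [Mv vX]; split=> // bt.
  by have [_ /(_ bt) fx] := fI t ct; rewrite vX fx.
have sg : spheroid X x g.
  apply/spheroidP; split; first exact: homot_cont hg.
  move=> t ct; split; first exact: gX.
  by have [] := homot_end hg' ct.
exists (homotopy_class X x g); first by exists g.
rewrite homotopy_incl_class//; apply: homotopy_class_eq.
by apply: homotopic_sym; apply/homotopicP.
Qed.

(** A homotopy in [M] between spheroids of [X] is a map of the (1 + m)-cube, with time as first
    coordinate. Its ends, and its sides at the base point, are already in [X] and stay fixed, so the
    compressed map is a homotopy in [X]. *)
Lemma compressible_inj N m (X M : set 'rV[R]_N) x : X `<=` M -> X x ->
  compressible (1 + m) X M ->
  set_inj (@homotopy_group R m N X x) (homotopy_incl M x).
Proof.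
move=> XM Xx cXM A B /set_mem[f sf <-] /set_mem[g sg <-].
rewrite !homotopy_incl_class// => fg.
have : homotopic M x f g.
  have : homotopy_class M x g g by apply: homotopy_class_self; exact: (spheroid_sub XM sg).
  by rewrite -fg => -[].
move=> /homotopicP[F [cF F0 F1 FI]].
have [_ fX] := (spheroidP _ _ _).1 sf; have [_ gX] := (spheroidP _ _ _).1 sg.
pose un (y : 'rV[R]_(1 + m)) : R * 'rV[R]_m := (y ord0 (lshift m ord0), rsubmx y).
pose jn (p : R * 'rV[R]_m) : 'rV[R]_(1 + m) := row_mx (const_mx p.1) p.2.
have unjn p : un (jn p) = p.
  by rewrite /un /jn row_mxEl mxE row_mxKr; case: p.
have cun (A' : set 'rV[R]_(1 + m)) : cont_on A' un.
  apply: cont_on_pair; first by apply: cont_on_coord; exact: cont_on_id.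
  apply: (@cont_on_lip _ _ _ _ _ 1) => y z _ _; rewrite mul1r -linearB /=.
  exact: norm_rsubmx.
have cjn (A' : set (R * 'rV[R]_m)) : cont_on A' jn.
  apply: cont_on_rV => j; case: (splitP j) => k jk.
    have -> : j = lshift m k by exact: val_inj.
    apply: (@cont_on_eq _ _ _ _ (fun p : R * 'rV[R]_m => p.1 : R^o)).
      by move=> p _; rewrite row_mxEl mxE.
    exact: cont_on_fst.
  have -> : j = rshift 1 k by exact: val_inj.
  apply: (@cont_on_eq _ _ _ _ (fun p : R * 'rV[R]_m => p.2 ord0 k : R^o)).
    by move=> p _; rewrite row_mxEr.
  by apply: cont_on_coord; exact: cont_on_snd.
have cube_un y : cube y -> 0 <= (un y).1 <= 1 /\ cube (un y).2.
  by move=> cy; split; [exact: cy|move=> i; rewrite mxE; exact: cy].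
have cube_jn s t : 0 <= s <= 1 -> cube t -> cube (jn (s, t)).
  move=> s01 ct j; case: (splitP j) => k jk.
    have -> : j = lshift m k by exact: val_inj.
    by rewrite row_mxEl mxE.
  have -> : j = rshift 1 k by exact: val_inj.
  by rewrite row_mxEr; exact: ct.
have cFu : cont_on (@cube R (1 + m)) (fun y => F (un y)).
  by apply: (cont_on_comp _ (cun _) cF) => y /cube_un.
have [y cy|h [hh hX]] := cXM (fun y => F (un y)) cFu.
  have [s01 ct] := cube_un y cy; have [] := FI _ _ s01 ct.
  by rewrite -surjective_pairing.
have hjn s t : 0 <= s <= 1 -> cube t -> X (F (s, t)) -> h (jn (s, t)) = F (s, t).
  move=> s01 ct Xst; have [_] := homot_end hh (cube_jn s t s01 ct).
  by rewrite unjn; apply.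
apply: homotopy_class_eq; apply/homotopicP.
exists (fun p => h (jn p)); split.
- by apply: (cont_on_comp _ (cjn _) (homot_cont hh)) => -[s t] [/= s01 ct]; exact: cube_jn.
- by move=> t ct; rewrite hjn ?lexx ?ler01// F0//; have [] := fX t ct.
- by move=> t ct; rewrite hjn ?lexx ?ler01// F1//; have [] := gX t ct.
- move=> s t s01 ct; split; first by apply: hX; exact: cube_jn.
  by move=> bt; have [_ /(_ bt) Fx] := FI s t s01 ct; rewrite hjn// Fx.
Qed.

Lemma compressible_onto N m (X M : set 'rV[R]_N) : X `<=` M ->
  compressible m X M -> homotopy_onto m X M.
Proof.
by move=> XM cXM x Xx; split; [exact: homotopy_incl_morphism|exact: compressible_surj].
Qed.

Lemma compressible_iso N m (X M : set 'rV[R]_N) : X `<=` M ->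
  compressible m X M -> compressible (1 + m) X M -> homotopy_iso m X M.
Proof.
move=> XM cm cm1 x Xx; have hm := homotopy_incl_morphism m x XM; split=> //.
split; [exact: hm.1|exact: compressible_inj|exact: compressible_surj].
Qed.

End HomotopyGroups.

Local Close Scope ring_scope.
Local Open Scope classical_set_scope.

Theorem theorem18 (R : realType) (N n k : nat) (M : set 'rV[R]_N)
    (H : 'I_k.+1 -> set 'rV[R]_N) :
  pl_closed_manifold n M -> nonempty_connected M -> multisection n M H ->
  (n = (2 * k)%N ->
     forall j : nat, (j + 2 <= k)%N ->
       homotopy_onto (2 * j + 2) (intersection_union H (k - j)) M /\
       forall m : nat, (m <= 2 * j + 1)%N ->
         homotopy_iso m (intersection_union H (k - j)) M) /\
  (n = (2 * k + 1)%N ->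
     forall j : nat, (j + 2 <= k)%N ->
       homotopy_onto (2 * j + 3) (intersection_union H (k - j)) M /\
       forall m : nat, (m <= 2 * j + 2)%N ->
         homotopy_iso m (intersection_union H (k - j)) M).
Proof.
move=> cM _ ms.
(* For [s = k - j] this is the bound of [compress_all]. An isomorphism in degree [m] also uses
   degree [m + 1], so the onto statement reaches one degree further. *)
have comp j m : (j + 2 <= k)%N -> (m + 2 * k <= n + 2 * j + 2)%N ->
    @compressible R N m (intersection_union H (k - j)) M.
  by move=> jk mn f cf fM; apply: (compress_all cM ms) => //; lia.
have sub j : (j + 2 <= k)%N -> intersection_union H (k - j) `<=` M.
  by move=> jk; apply: (intersection_union_sub ms); lia.
split=> nE j jk; split.
- by apply: compressible_onto; [exact: sub|apply: comp => //; lia].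
- by move=> m mj; apply: compressible_iso; [exact: sub|apply: comp => //; lia..].
- by apply: compressible_onto; [exact: sub|apply: comp => //; lia].
- by move=> m mj; apply: compressible_iso; [exact: sub|apply: comp => //; lia..].
Qed.
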